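(* Let $C \subset \mathbb{P}^3$ be a curve lying on a reducible reduced quadric $\mathcal{Q} = \mathcal{H} \cup \mathcal{H}'$ (the union of two distinct planes $\mathcal{H}, \mathcal{H}'$). Then $C$ is not arithmetically Cohen-Macaulay if and only if $\mu(I_C) = 4$. In this case, up to a change of coordinates, $C$ is defined by $$I_C = \left(xy,\ x^2A + xhF,\ y^2B + yhG,\ xAG + yBF + hFG\right),$$ where $A, B, F, G \in R$ and $h \in K[z,t]$ are homogeneous polynomials (such that the displayed generators are homogeneous), $x, y, F, G$ is a regular sequence, and $y \nmid A$ and $x \nmid B$ if $h = 0$.
   Context: $K$ is an algebraically closed field, $\mathbb{P}^3 = \mathbb{P}^3_K$, and $R = K[x,y,z,t]$ is its homogeneous coordinate ring. A curve is a pure one-dimensional locally Cohen-Macaulay closed subscheme of $\mathbb{P}^3$ (i.e. without zero-dimensional components, isolated or embedded). $I_C \subset R$ is the saturated homogeneous ideal of $C$, and $\mu(I_C)$ is its number of minimal generators. $C$ is arithmetically Cohen-Macaulay if $R/I_C$ is a Cohen-Macaulay ring. *)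

(* Defs.v *)
From HB Require Import structures.
From mathcomp Require Import all_boot all_order all_algebra.
From mathcomp.multinomials Require Export mpoly.

Set Implicit Arguments.
Unset Strict Implicit.
Unset Printing Implicit Defensive.

Import GRing.Theory.
Local Open Scope ring_scope.

(* [n] is the maximum of the set of numbers [E]; no [n] qualifies when [E] is
   empty or unbounded. *)
Definition is_max (E : nat -> Prop) (n : nat) : Prop :=
  E n /\ forall m, E m -> (m <= n)%N.

Section CommutativeAlgebra.
Variable A : comNzRingType.

(* Ideals are the bundled [idealr] of MathComp: they are proper, with Boolean
   membership. Generated ideals, which may be improper, are Prop predicates. *)

Definition ideal_gen (s : seq A) (f : A) : Prop :=
  exists c : nat -> A, f = \sum_(i < size s) c i * s`_i.

Definition generates (s : seq A) (I : idealr A) : Prop :=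
  forall f, f \in I <-> ideal_gen s f.

Definition noetherian : Prop := forall I : idealr A, exists s, generates s I.

Definition min_gens (I : idealr A) (n : nat) : Prop :=
  (exists s, generates s I /\ size s = n) /\
  forall s, generates s I -> (n <= size s)%N.

Definition regular_sequence (s : seq A) : Prop :=
  (forall i, (i < size s)%N ->
     forall a, ideal_gen (take i s) (s`_i * a) -> ideal_gen (take i s) a)
  /\ ~ ideal_gen s 1.

Definition maximal_ideal (M : idealr A) : Prop :=
  forall J : idealr A, {subset M <= J} -> J =i M.

Definition strict_sub (P Q : prime_idealr A) : Prop :=
  {subset P <= Q} /\ ~ {subset Q <= P}.

Definition is_codim (M : idealr A) (n : nat) : Prop :=
  is_max (fun k => exists p : nat -> prime_idealr A,
    (forall i, (i < k)%N -> strict_sub (p i) (p i.+1)) /\ p k =i M) n.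

Definition is_depth (M : idealr A) (n : nat) : Prop :=
  is_max (fun k => exists s : seq A,
    [/\ size s = k, {subset s <= M} & regular_sequence s]) n.

(* For M maximal, depth (M, A) and codim M are the depth and the dimension of
   the local ring A_M. *)
Definition cohen_macaulay : Prop :=
  noetherian /\
  forall M : idealr A, maximal_ideal M ->
    exists n, is_depth M n /\ is_codim M n.

(* P = (I : f) *)
Definition associated_prime (I : idealr A) (P : prime_idealr A) : Prop :=
  exists f, forall g, g \in P <-> g * f \in I.

Definition dvdr (a b : A) : Prop := exists c, b = c * a.

End CommutativeAlgebra.

Section ProjectiveSpace.
Variables (K : closedFieldType) (n : nat).
Local Notation R := {mpoly K[n]}.

Definition homogeneous_ideal (I : idealr R) : Prop :=
  forall f d, f \in I -> pihomog mdeg d f \in I.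

Definition saturated (I : idealr R) : Prop :=
  forall f : R, (forall i : 'I_n, exists k, 'X_i ^+ k * f \in I) -> f \in I.

(* Scheme-theoretic points of the projective space Proj R. *)
Definition is_point (P : prime_idealr R) : Prop :=
  homogeneous_ideal P /\ exists i : 'I_n, 'X_i \notin P.

(* Dimension of the closure of the point P, whose irreducible closed subsets
   are the closures of the points containing P. *)
Definition is_dim_closure (P : prime_idealr R) (d : nat) : Prop :=
  is_max (fun k => exists p : nat -> prime_idealr R,
    [/\ p 0%N =i P, forall i, (i <= k)%N -> is_point (p i)
      & forall i, (i < k)%N -> strict_sub (p i) (p i.+1)]) d.

(* A closed subscheme C of Proj R is given by its saturated homogeneous ideal
   I. The components of C, isolated or embedded, are the closures of the points
   associated to I, and C is pure one-dimensional and locally Cohen-Macaulay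
   when all of them have dimension one. *)
Definition is_curve (I : idealr R) : Prop :=
  [/\ homogeneous_ideal I, saturated I
    & forall P, associated_prime I P -> is_dim_closure P 1].

Definition arithmetically_cohen_macaulay (I : idealr R) : Prop :=
  cohen_macaulay {ideal_quot I}.

(* Two linear forms define the same plane exactly when they are proportional;
   the union of two distinct planes has the product as equation. *)
Definition reducible_reduced_quadric (q : R) : Prop :=
  exists l l' : R,
    [/\ l \is 1.-homog, l != 0, l' \is 1.-homog, l' != 0
      & (forall c : K, l' != c *: l) /\ q = l * l'].

Definition change_coord (M : 'M[K]_n) (f : R) : R :=
  f \mPo [tuple \sum_(j < n) M i j *: 'X_j | i < n].

End ProjectiveSpace.

Section Coordinates.
Variable K : closedFieldType.

Definition x : {mpoly K[4]} := 'X_(inord 0).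
Definition y : {mpoly K[4]} := 'X_(inord 1).

(* h \in K[z, t] *)
Definition free_of_xy (h : {mpoly K[4]}) : Prop :=
  forall m, m \in msupp h -> m (inord 0) = 0%N /\ m (inord 1) = 0%N.

End Coordinates.
Arguments x {K}.
Arguments y {K}.

(* Main.v *)
Require Import Defs.
From HB Require Import structures.
From mathcomp Require Import all_boot all_order all_algebra.
From mathcomp.multinomials Require Import mpoly.
From mathcomp.classical Require Import boolp.
From mathcomp Require Import zify ring.
Set Implicit Arguments.
Unset Strict Implicit.
Unset Printing Implicit Defensive.
Import Order.Theory GRing.Theory.
Local Open Scope ring_scope.

(** Choose coordinates in which the quadric is xy = 0. As the curve is unmixed,
    the ideals I : x and I : y are the ideals (y, P) and (x, S) of plane curves,
    with P in K[x,z,t] and S in K[y,z,t] ([pure_plane_principal]): in the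
    coordinate ring of a plane an unmixed ideal of codimension one is principal.
    Write P0 and S0 for the restrictions of P and S to the axis x = y = 0.
    Modulo xy, xP and yS an element of I is the gluing S a + P b - S0 a of a
    multiple of S on the plane x = 0 and a multiple of P on the plane y = 0, with
    a, b in K[z,t] and S0 a = P0 b ([glue_decomposition]). The pairs (a, b) that
    occur form a module over K[z,t] which is saturated, by purity along the axis,
    and has rank at most one ([glueable_proportional]). Over the algebraically
    closed K binary forms split into linear factors ([linear_factor]), hence this
    module is zero or generated by one pair of coprime forms (F, G).

    If the module is zero, or if F or G is constant, three equations suffice.
    Then also, up to exchanging the planes, I : x = (y, P) and I + (x) = (x, S')
    for some equation S' in the plane x = 0, so that R/I is an extension of two
    plane curves. At every closed point of the cone two general linear
    polynomials form a regular sequence on both of them, hence on R/I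
    ([residual_cohen_macaulay]). Since R/I has dimension two, it is
    Cohen-Macaulay.

    In the remaining case F and G are coprime of positive degree, S0 F = P0 G
    gives P0 = h F and S0 = h G, and with P = xA + hF and S = yB + hG the
    generators are those of the theorem ([classification], [rao_form]). Their
    syzygies have no constant terms, so four generators are needed
    ([rao_generators_ge]). Moreover the ring of global functions of the curve
    contains an element e with xe = 0, ye = yh, Fe = P and Ge = -yB, whose class
    modulo R/I has annihilator (x, y, F, G). A multiple se with s in the socle of
    R/(x, y, F, G) shows that the depth at the vertex is at most one
    ([rao_depth]), whereas the codimension of the vertex is two.

    The commutative algebra behind this is elementary. Hilbert's basis theorem
    follows from Dickson's lemma. The algebraic dependence of n+1 elements of
    K[n], read off from the term that is lexicographically lowest, bounds both
    chains of primes and regular sequences ([chain_unit]). A regular sequence of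
    length two yields a chain of primes of length two
    ([prime_avoiding_regular]), and maximal ideals are points by Zariski's lemma
    ([nullstellensatz]). *)

(** * Ideals and primes as predicates *)

Section Ideals.
Variable A : comNzRingType.
Implicit Types (J : A -> Prop) (a b c f g u v : A).

(** Improper ideals are included, and membership need not be Boolean: colon
    ideals, sums and preimages can then be formed freely. *)
Definition is_ideal J : Prop :=
  [/\ J 0, forall a b, J a -> J b -> J (a + b) & forall c a, J a -> J (c * a)].

Definition is_prime J : Prop :=
  [/\ is_ideal J, ~ J 1 & forall a b, J (a * b) -> J a \/ J b].

Definition regular_mod J a : Prop := forall u, J (a * u) -> J u.

Lemma ideal0 J : is_ideal J -> J 0. Proof. by case. Qed.

Lemma idealD J a b : is_ideal J -> J a -> J b -> J (a + b).
Proof. by case=> _ h _; apply: h. Qed.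

Lemma ideal_mull J a b : is_ideal J -> J b -> J (a * b).
Proof. by case=> _ _; apply. Qed.

Lemma ideal_mulr J a b : is_ideal J -> J a -> J (a * b).
Proof. by rewrite mulrC; apply: ideal_mull. Qed.

Lemma idealN J a : is_ideal J -> J a -> J (- a).
Proof. by move=> iJ; rewrite -mulN1r; apply: ideal_mull. Qed.

Lemma idealB J a b : is_ideal J -> J a -> J b -> J (a - b).
Proof. by move=> iJ Ja Jb; apply: idealD => //; apply: idealN. Qed.

Lemma ideal_congr J a b : is_ideal J -> J (a - b) -> J b -> J a.
Proof. by move=> iJ Jab Jb; rewrite -(subrK b a); apply: idealD. Qed.

Lemma ideal_sum J (T : Type) (r : seq T) (Q : pred T) (F : T -> A) :
  is_ideal J -> (forall i, Q i -> J (F i)) -> J (\sum_(i <- r | Q i) F i).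
Proof.
move=> iJ JF; apply: (big_ind J) => // [|a b]; [exact: ideal0 | exact: idealD].
Qed.

Lemma ideal_idealr (I : idealr A) : is_ideal (fun f => f \in I).
Proof.
split=> [|a b|c a]; [exact: rpred0 | exact: rpredD | exact: idealMr].
Qed.

Lemma is_prime_idealr (P : prime_idealr A) : is_prime (fun f => f \in P).
Proof.
split=> [||a b]; [exact: ideal_idealr | by rewrite idealr1|].
by rewrite prime_idealrM => /orP.
Qed.

Lemma ideal_gen_nil f : ideal_gen [::] f <-> f = 0.
Proof.
split=> [[c ->]|->]; first by rewrite big_ord0.
by exists (fun=> 0); rewrite big_ord0.
Qed.

Lemma ideal_gen_cons a s f :
  ideal_gen (a :: s) f <-> exists c g, ideal_gen s g /\ f = c * a + g.
Proof.
split=> [[c ->]|[c [g [[d ->] ->]]]].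
  rewrite /= big_ord_recl /=; exists (c 0%N).
  by eexists; split; last reflexivity; exists (fun i => c i.+1).
exists (fun i => if i is i'.+1 then d i' else c).
by rewrite /= big_ord_recl.
Qed.

Lemma is_ideal_gen s : is_ideal (ideal_gen s).
Proof.
elim: s => [|a s [h0 hD hM]].
  split=> [|f g|c f] /=; first exact/ideal_gen_nil.
    by move=> /ideal_gen_nil-> /ideal_gen_nil->; apply/ideal_gen_nil; rewrite addr0.
  by move=> /ideal_gen_nil->; apply/ideal_gen_nil; rewrite mulr0.
split=> [|f g|c f].
- by apply/ideal_gen_cons; exists 0, 0; rewrite mul0r addr0.
- move=> /ideal_gen_cons[c [f' [sf ->]]] /ideal_gen_cons[d [g' [sg ->]]].
  apply/ideal_gen_cons; exists (c + d), (f' + g'); split; first exact: hD.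
  by rewrite mulrDl addrACA.
- move=> /ideal_gen_cons[d [f' [sf ->]]]; apply/ideal_gen_cons.
  by exists (c * d), (c * f'); split; [exact: hM | rewrite mulrDr mulrA].
Qed.

Lemma mem_ideal_gen s a : a \in s -> ideal_gen s a.
Proof.
elim: s => // b s IH; rewrite inE => /orP[/eqP->|/IH h]; apply/ideal_gen_cons.
  exists 1, 0; split; [exact: (ideal0 (is_ideal_gen _)) | by rewrite mul1r addr0].
by exists 0, a; rewrite mul0r add0r.
Qed.

Lemma ideal_gen_sub J s f :
  is_ideal J -> (forall a, a \in s -> J a) -> ideal_gen s f -> J f.
Proof.
move=> iJ; elim: s f => [f _ /ideal_gen_nil->|a s IH f Js]; first exact: ideal0.
move=> /ideal_gen_cons[c [g [/IH sg ->]]]; apply: idealD => //.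
  by apply: ideal_mull => //; apply: Js; rewrite mem_head.
by apply: sg => b bs; apply: Js; rewrite inE bs orbT.
Qed.

Lemma ideal_gen_sub_seq s s' f :
  {subset s <= s'} -> ideal_gen s f -> ideal_gen s' f.
Proof.
by move=> ss; apply: ideal_gen_sub (is_ideal_gen _) _ => a /ss/mem_ideal_gen.
Qed.

(** Classical reasoning provides the Boolean membership that the bundled ideals
    require. *)
Lemma idealr_of J : is_ideal J -> ~ J 1 ->
  exists I : idealr A, forall f, f \in I <-> J f.
Proof.
move=> iJ J1; pose S : pred A := fun f => `[< J f >].
have clS : idealr_closed S.
  split=> [||a u v]; rewrite ?/S ?inE; first by apply/asboolP; exact: ideal0.
    exact/asboolP.
  move=> /asboolP Ju /asboolP Jv; apply/asboolP; apply: idealD => //; exact: ideal_mull.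
pose IS := isIdealr.Build A S clS; pose I : idealr A := HB.pack S IS.
by exists I => f; split=> [/asboolP|h]; last apply/asboolP.
Qed.

Lemma prime_idealr_of J : is_prime J ->
  exists P : prime_idealr A, forall f, f \in P <-> J f.
Proof.
case=> iJ J1 Jp; pose S : pred A := fun f => `[< J f >].
have clS : idealr_closed S.
  split=> [||a u v]; rewrite ?/S ?inE; first by apply/asboolP; exact: ideal0.
    exact/asboolP.
  move=> /asboolP Ju /asboolP Jv; apply/asboolP; apply: idealD => //; exact: ideal_mull.
have prS : prime_idealr_closed S.
  by move=> u v /asboolP/Jp[h|h]; apply/orP; [left|right]; apply/asboolP.
pose IS := isIdealr.Build A S clS; pose PS := isPrimeIdealrClosed.Build A S prS.
pose P : prime_idealr A := HB.pack S IS PS.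
by exists P => f; split=> [/asboolP|h]; last apply/asboolP.
Qed.

Lemma is_ideal_colon J a : is_ideal J -> is_ideal (fun u => J (a * u)).
Proof.
move=> iJ; split=> [|u v|c u]; first by rewrite mulr0; apply: ideal0.
  by rewrite mulrDr; apply: idealD.
by rewrite mulrCA; apply: ideal_mull.
Qed.

Definition adjoin J a : A -> Prop := fun f => exists j c, J j /\ f = j + c * a.

Lemma is_ideal_adjoin J a : is_ideal J -> is_ideal (adjoin J a).
Proof.
move=> iJ; split=> [|f g|c f].
- by exists 0, 0; rewrite mul0r addr0; split=> //; apply: ideal0.
- move=> [j [c [Jj ->]]] [k [d [Jk ->]]]; exists (j + k), (c + d).
  by split; [exact: idealD | rewrite mulrDl addrACA].
- move=> [j [d [Jj ->]]]; exists (c * j), (c * d).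
  by split; [exact: ideal_mull | rewrite mulrDr mulrA].
Qed.

Lemma sub_adjoin J a f : J f -> adjoin J a f.
Proof. by move=> Jf; exists f, 0; rewrite mul0r addr0. Qed.

Lemma mem_adjoin J a : is_ideal J -> adjoin J a a.
Proof. by move=> iJ; exists 0, 1; rewrite mul1r add0r; split=> //; exact: ideal0. Qed.

Lemma adjoin_sub J J' a f : is_ideal J' -> (forall g, J g -> J' g) -> J' a ->
  adjoin J a f -> J' f.
Proof.
by move=> iJ' JJ' Ja [j [c [/JJ' Jj ->]]]; apply: idealD => //; apply: ideal_mull.
Qed.

Definition noeth : Prop :=
  forall J, is_ideal J -> exists s, forall f, J f <-> ideal_gen s f.

Section Noeth.
Hypothesis nA : noeth.

(** The union of a strictly increasing sequence would be finitely generated. *)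
Lemma noeth_max (Fam : (A -> Prop) -> Prop) :
    (forall J, Fam J -> is_ideal J) -> (exists J, Fam J) ->
  exists2 J, Fam J &
    forall J', Fam J' -> (forall f, J f -> J' f) -> forall f, J' f -> J f.
Proof.
move=> iF [J0 FJ0]; apply: contrapT => nomax.
pose T := {J | Fam J}.
have step (J : T) : exists J' : T,
    (forall f, sval J f -> sval J' f) /\ exists f, sval J' f /\ ~ sval J f.
  case: J => J FJ /=; apply: contrapT => noJ'; apply: nomax; exists J => //.
  move=> J' FJ' JJ' f J'f; apply: contrapT => Jf; apply: noJ'.
  by exists (exist _ J' FJ'); split=> //; exists f.
have [nxt nxtP] := choice step.
pose c k := iter k nxt (exist _ J0 FJ0).
have cS k f : sval (c k) f -> sval (c k.+1) f by move=> h; apply: (nxtP (c k)).1.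
have cle k l f : (k <= l)%N -> sval (c k) f -> sval (c l) f.
  by move=> /subnK<-; elim: (l - k)%N => // d IH /IH h; apply: cS.
have ic k : is_ideal (sval (c k)) by apply: iF; case: (c k).
pose U f := exists k, sval (c k) f.
have iU : is_ideal U.
  split=> [|a b [k ak] [l bl]|a b [k bk]].
  - by exists 0%N; apply: ideal0.
  - exists (maxn k l); apply: idealD => //.
      by apply: cle ak; rewrite leq_maxl.
    by apply: cle bl; rewrite leq_maxr.
  - by exists k; apply: ideal_mull.
have [s sU] := nA iU.
have [N sN] : exists N, forall a, a \in s -> sval (c N) a.
  have : forall a, a \in s -> U a by move=> a /mem_ideal_gen/sU.
  elim: s {sU} => [_|a s IH sU]; first by exists 0%N.
  have [|N sN] := IH; first by move=> b bs; apply: sU; rewrite inE bs orbT.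
  have [k ak] := sU a (mem_head _ _).
  exists (maxn k N) => b; rewrite inE => /orP[/eqP->|/sN bN].
    by apply: cle ak; rewrite leq_maxl.
  by apply: cle bN; rewrite leq_maxr.
have [_ [f [fS fN]]] := nxtP (c N).
apply: fN; apply: ideal_gen_sub (ic N) sN _; apply/sU; by exists N.+1.
Qed.

(** An ideal that is maximal among those avoiding a multiplicative set is
    prime. *)
Lemma prime_avoiding J (S : A -> Prop) :
    is_ideal J -> S 1 -> (forall a b, S a -> S b -> S (a * b)) ->
    (forall a, S a -> ~ J a) ->
  exists P, [/\ is_prime P, forall f, J f -> P f & forall a, S a -> ~ P a].
Proof.
move=> iJ S1 SM JS.
pose Fam P := [/\ is_ideal P, forall f, J f -> P f & forall a, S a -> ~ P a].
have [| |P [iP JP PS] Pmax] := noeth_max (Fam := Fam).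
- by move=> P [].
- by exists J.
exists P; split=> //; split=> //; first exact: PS.
have meetS a : ~ P a -> exists s j c, [/\ S s, P j & s = j + c * a].
  move=> Pa; apply: contrapT => noS; apply: Pa.
  apply: (Pmax (adjoin P a)); last exact: mem_adjoin.
    split; [exact: is_ideal_adjoin | by move=> f /JP; exact: sub_adjoin |].
    move=> s Ss [j [c [Pj e]]]; apply: noS; by exists s, j, c.
  by move=> f; apply: sub_adjoin.
move=> a b Pab; apply: contrapT => /not_orP[/meetS[s [j [c [Ss Pj es]]]]].
move=> /meetS[s' [j' [c' [Ss' Pj' es']]]].
apply: (PS (s * s')); first exact: SM.
rewrite es es' mulrDl; apply: idealD => //; first exact: ideal_mulr.
rewrite mulrDr; apply: idealD => //; first exact: ideal_mull.
by rewrite mulrACA; apply: ideal_mull.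
Qed.

(** A prime minimal over J consists of zero divisors modulo J; hence below a
    prime containing J there is one avoiding a given regular element. *)
Lemma prime_avoiding_regular J Q a :
    is_ideal J -> is_prime Q -> (forall f, J f -> Q f) -> regular_mod J a ->
  exists P, [/\ is_prime P, forall f, J f -> P f, forall f, P f -> Q f & ~ P a].
Proof.
move=> iJ [iQ Q1 Qp] JQ ra.
pose S f := exists k s, ~ Q s /\ f = a ^+ k * s.
have [||| P [pP JP PS]] := prime_avoiding iJ (S := S).
- by exists 0%N, 1; rewrite expr0 mulr1.
- move=> _ _ [k [s [Qs ->]]] [l [s' [Qs' ->]]]; exists (k + l)%N, (s * s').
  by split; [move=> /Qp[] | rewrite exprD mulrACA].
- move=> _ [k [s [Qs ->]]] Jas; apply/Qs/JQ.
  by elim: k Jas => [|k IH]; rewrite ?expr0 ?mul1r // exprS -mulrA => /ra.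
exists P; split=> //.
  move=> f Pf; apply: contrapT => Qf; apply: (PS f) => //.
  by exists 0%N, f; rewrite expr0 mul1r.
by move=> Pa; apply: (PS a) => //; exists 1%N, 1; rewrite expr1 mulr1.
Qed.

(** A maximal element among the annihilators of the multiples of u is prime. *)
Lemma associated_prime_exists J u : is_ideal J -> ~ J u ->
  exists v, is_prime (fun g => J (g * v)) /\ forall g, J (g * u) -> J (g * v).
Proof.
move=> iJ Ju; pose Fam P := exists w, ~ J (w * u) /\ P = (fun g => J (g * (w * u))).
have icolon v : is_ideal (fun g => J (g * v)).
  have [h0 hD hM] := is_ideal_colon v iJ.
  split=> [|a b|c a]; rewrite ?[_ * v]mulrC //; [exact: hD | exact: hM].
have [||_ [w [Jw ->]] wmax] := noeth_max (Fam := Fam).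
- by move=> _ [w [_ ->]]; apply: icolon.
- by exists (fun g => J (g * (1 * u))), 1; rewrite mul1r.
exists (w * u); split; last by move=> g Jg; rewrite mulrCA; apply: ideal_mull.
split=> //; first by rewrite mul1r.
move=> a b Jab; apply: contrapT => /not_orP[na nb]; apply: na.
apply: (wmax (fun g => J (g * (b * w * u)))).
- by exists (b * w); rewrite -mulrA.
- by move=> f Jf; rewrite -mulrA mulrCA; apply: ideal_mull.
- by rewrite -mulrA mulrA.
Qed.

End Noeth.

Lemma noetherianP : noeth -> noetherian A.
Proof. by move=> nA I; apply: (nA (fun f => f \in I)); apply: ideal_idealr. Qed.

End Ideals.

Lemma noeth_surj (A B : comNzRingType) (p : {rmorphism A -> B}) :
  (forall b, exists a, p a = b) -> noeth A -> noeth B.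
Proof.
move=> surj nA J iJ.
have iJ' : is_ideal (fun a => J (p a)).
  split=> [|a b|c a]; rewrite ?rmorph0 ?rmorphD ?rmorphM.
  - exact: ideal0.
  - exact: idealD.
  - exact: ideal_mull.
have [s sP] := nA _ iJ'; exists (map p s) => f; split=> [Jf|].
  have [a ea] := surj f; move: Jf; rewrite -ea => /sP {ea}.
  elim: s a {sP} => [|b s IH] a.
    by move=> /ideal_gen_nil->; rewrite rmorph0; apply/ideal_gen_nil.
  move=> /ideal_gen_cons[c [g [/IH sg ->]]]; rewrite rmorphD rmorphM.
  by apply/ideal_gen_cons; exists (p c), (p g).
apply: ideal_gen_sub => // _ /mapP[a /mem_ideal_gen/sP ? ->] //.
Qed.

Lemma is_prime_ker (A : comNzRingType) (D : idomainType) (p : {rmorphism A -> D}) :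
  is_prime (fun a => p a = 0).
Proof.
split=> [||a b]; first split=> [|a b|c a].
- exact: rmorph0.
- by rewrite rmorphD => -> ->; rewrite addr0.
- by rewrite rmorphM => ->; rewrite mulr0.
- by rewrite rmorph1; apply/eqP; rewrite oner_eq0.
- by rewrite rmorphM => /eqP; rewrite mulf_eq0 => /orP[] /eqP; [left|right].
Qed.

Lemma ideal_quot_morphism (A : comNzRingType) (M : idealr A) :
  exists r : {rmorphism A -> {ideal_quot M}},
    (forall b, exists a, r a = b) /\ forall a, a \in M <-> r a = 0.
Proof.
exists (\pi_({ideal_quot M}))%qT; split=> [b|a]; first by exists (repr b); rewrite /= reprK.
have -> : (a \in M) = ((\pi_({ideal_quot M}))%qT a == 0 :> {ideal_quot M}).
  by rewrite -[a in LHS]subr0 Quotient.idealrBE /= rmorph0.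
by split=> /eqP.
Qed.

(** * Hilbert's basis theorem *)

(** Choose successively later places at which u is minimal among all later
    values. *)
Lemma nondecreasing_choice (u : nat -> nat) :
  exists g : nat -> nat, (forall k, g k < g k.+1)%N /\
    (forall k, u (g k) <= u (g k.+1))%N.
Proof.
have minP N : exists i, (N <= i)%N /\ forall j, (N <= j)%N -> (u i <= u j)%N.
  have ex : exists v, `[< exists2 i, (N <= i)%N & u i = v >].
    by exists (u N); apply/asboolP; exists N.
  case: (ex_minnP ex) => _ /asboolP[i Ni <-] imin; exists i; split=> // j Nj.
  by apply: imin; apply/asboolP; exists j.
have [mu muP] := choice minP.
pose g k := iter k (fun i => mu i.+1) (mu 0%N).
have lb k : exists2 N, g k = mu N & (forall j, (g k <= j)%N -> (N <= j)%N).
  case: k => [|k]; [exists 0%N | exists (g k).+1] => // j.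
  by apply: leq_trans; exact: (muP _).1.
exists g; split=> k; first exact: (muP (g k).+1).1.
have [N eN NP] := lb k; rewrite {1}eN; apply: (muP N).2; apply: NP.
by rewrite ltnW //; exact: (muP (g k).+1).1.
Qed.

(** Dickson's lemma, through subsequences that are monotone in more and more
    coordinates. *)
Lemma dickson_sequence n (m : nat -> 'X_{1..n}) :
  exists i j, (i < j)%N /\ (m i <= m j)%MM.
Proof.
have mono_lt g : (forall k, g k < g k.+1)%N -> {homo g : i j / (i < j)%N}.
  by move=> gS i j; apply: (homo_ltn ltn_trans).
have mono_le u : (forall k, u k <= u k.+1)%N -> {homo u : i j / (i <= j)%N}.
  by move=> uS i j; apply: (homo_leq leqnn leq_trans).
suff H l : (l <= n)%N -> exists g : nat -> nat, (forall k, g k < g k.+1)%N /\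
    forall i : 'I_n, (i < l)%N -> forall k, (m (g k) i <= m (g k.+1) i)%N.
  have [g [gS gP]] := H n (leqnn n).
  by exists (g 0%N), (g 1%N); split=> //; apply/mnm_lepP => i; apply: gP.
elim: l => [|l IH] ln; first by exists id.
have [g [gS gP]] := IH (ltnW ln).
have [h [hS hP]] := nondecreasing_choice (fun k => m (g k) (Ordinal ln)).
exists (g \o h); split=> [k|i] /=; first by apply: mono_lt.
rewrite ltnS leq_eqVlt => /orP[/eqP il k|il k].
  by rewrite (_ : i = Ordinal ln) //; apply/val_inj.
by apply: (mono_le (fun k => m (g k) i)); [exact: gP | apply: ltnW].
Qed.

Lemma dickson n (S : 'X_{1..n} -> Prop) :
  exists s : seq 'X_{1..n}, (forall m, m \in s -> S m) /\
    forall m, S m -> exists2 m', m' \in s & (m' <= m)%MM.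
Proof.
apply: contrapT => nofin.
have step (s : {s : seq 'X_{1..n} | forall m, m \in s -> S m}) :
    exists m, S m /\ forall m', m' \in sval s -> ~~ (m' <= m)%MM.
  case: s => s sS /=; apply: contrapT => nom; apply: nofin; exists s; split=> //.
  move=> m Sm; apply: contrapT => nom'; apply: nom; exists m; split=> // m' m's.
  by apply/negP => le; apply: nom'; exists m'.
have [nxt nxtP] := choice step.
have addP s : forall m, m \in nxt s :: sval s -> S m.
  by move=> m; rewrite inE => /orP[/eqP->|]; [case: (nxtP s) | case: s => s /= h /h].
have nilP : forall m, m \in [::] -> S m by [].
pose c k := iter k (fun s => exist _ (nxt s :: sval s) (addP s)) (exist _ [::] nilP).
have [i [j [ij le]]] := dickson_sequence (fun k => nxt (c k)).
suff mem : nxt (c i) \in sval (c j) by have := (nxtP (c j)).2 _ mem; rewrite le.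
elim: j ij {le} => // j IH; rewrite ltnS leq_eqVlt => /orP[/eqP->|/IH h].
  by rewrite /= mem_head.
by rewrite /= inE h orbT.
Qed.

(** By Dickson's lemma finitely many elements suffice to cancel the leading term
    of every element of J, and the order on monomials is well founded. *)
Theorem hilbert_basis (K : fieldType) n : noeth {mpoly K[n]}.
Proof.
move=> J iJ.
have [s [sS sP]] := dickson (fun m => exists f : {mpoly K[n]},
                               [/\ J f, f != 0 & mlead f = m]).
have [F FP] := choice (P := fun m (f : {mpoly K[n]}) =>
    m \in s -> [/\ J f, f != 0 & mlead f = m])
  (fun m => match pselect (m \in s) with
   | left h => let: ex_intro f fP := sS m h in ex_intro _ f (fun _ => fP)
   | right h => ex_intro _ 0 (fun h' => False_ind _ (h h')) end).
exists (map F s) => f; split; last first.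
  by apply: ideal_gen_sub => // _ /mapP[m /FP[? _ _] ->].
move em : (mlead f) => m; elim/(well_founded_induction (@ltom_wf n)): m f em.
move=> m IH f fm Jf.
have [->|f0] := eqVneq f 0; first exact: (ideal0 (is_ideal_gen _)).
have [m' m's le] := sP m (ex_intro _ f (And3 Jf f0 fm)).
have [Jg g0 gm] := FP m' m's; set g := F m' in Jg g0 gm.
have lg0 : mleadc g != 0 by rewrite mleadc_eq0.
have lf0 : mleadc f != 0 by rewrite mleadc_eq0.
pose c := mleadc f / mleadc g; pose h := (c *: 'X_[m - m']) * g.
have c0 : c != 0 by rewrite mulf_neq0 // invr_eq0.
have X0 : 'X_[m - m'] != 0 :> {mpoly K[n]}.
  by rewrite -msupp_eq0 msuppX.
have hm : mlead h = m.
  by rewrite mleadM ?scaler_eq0 ?negb_or ?c0 // mleadZ // mleadXm gm submK.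
have hc : h@_m = f@_m.
  rewrite /h -scalerAl mcoeffZ [_ * g]mulrC.
  have e : m = ((m - m') + m')%MM by rewrite submK.
  by rewrite [X in (g * _)@_X]e mcoeffMX /c fm -gm divfK.
have gh : ideal_gen (map F s) h.
  by apply: ideal_mull (is_ideal_gen _) _; apply/mem_ideal_gen/map_f.
have Jh : J h by apply: ideal_mull.
apply: (ideal_congr (is_ideal_gen _) _ gh).
have [->|fh0] := eqVneq (f - h) 0; first exact: (ideal0 (is_ideal_gen _)).
apply: (IH (mlead (f - h)) _ (f - h)) => //; last exact: idealB.
have : (mlead (f - h) <= m)%O.
  by apply: le_trans (mleadB_le _ _) _; rewrite fm hm joinxx.
rewrite le_eqVlt => /orP[/eqP e|//].
by move: fh0; rewrite -mleadc_eq0 e mcoeffB hc subrr eqxx.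
Qed.

(** * Algebraic dependence and the dimension of K[n] *)

Section AlgebraicDependence.
Variable K : fieldType.

Lemma degM_le n (p q : {mpoly K[n]}) :
  ((msize (p * q)).-1 <= (msize p).-1 + (msize q).-1)%N.
Proof.
have [->|p0] := eqVneq p 0; first by rewrite mul0r mmeasure0.
have [->|q0] := eqVneq q 0; first by rewrite mulr0 mmeasure0.
by rewrite msizeM // (mpolySpred _ p0) (mpolySpred _ q0) /=; lia.
Qed.

Lemma degX_le n (p : {mpoly K[n]}) k :
  ((msize (p ^+ k)).-1 <= k * (msize p).-1)%N.
Proof.
elim: k => [|k IH]; first by rewrite expr0 msize1.
by rewrite exprS mulSn; apply: leq_trans (degM_le _ _) _; rewrite leq_add2l.
Qed.

Lemma deg_prod_le n m (F : 'I_m -> {mpoly K[n]}) :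
  ((msize (\prod_i F i)).-1 <= \sum_i (msize (F i)).-1)%N.
Proof.
apply: (big_ind2 (fun (p : {mpoly K[n]}) e => (msize p).-1 <= e)%N) => //.
  by rewrite msize1.
move=> p e q e' pe qe; apply: leq_trans (degM_le _ _) _; exact: leq_add.
Qed.

Lemma left_kernel_exists m n (A : 'M[K]_(m, n)) : (n < m)%N ->
  exists v : 'rV_m, v != 0 /\ v *m A = 0.
Proof.
move=> nm; have /rowV0Pn[v /sub_kermxP vA v0] : kermx A != 0.
  rewrite -mxrank_eq0 mxrank_ker subn_eq0 -ltnNge.
  by apply: leq_ltn_trans nm; apply: rank_leq_col.
by exists v.
Qed.

(** The monomials of exponents less than d in n+1 elements of degree at most D
    are more numerous, for d large, than the monomials of the degrees that they
    reach. *)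
Theorem algebraic_dependence n (s : n.+1.-tuple {mpoly K[n]}) :
  exists Q : {mpoly K[n.+1]}, Q != 0 /\ Q \mPo s = 0.
Proof.
pose D := (\max_i (msize (tnth s i)).-1)%N; pose C := (n.+1 * D).+1.
pose d := (C ^ n).+1; pose E := (n.+1 * (d * D))%N.
pose mon (t : {ffun 'I_n.+1 -> 'I_d}) := [multinom (t i : nat) | i < n.+1].
pose mon' (t : {ffun 'I_n -> 'I_E.+1}) := [multinom (t i : nat) | i < n].
pose P t := 'X_[mon t] \mPo s.
have degP t : ((msize (P t)).-1 <= E)%N.
  rewrite /P comp_mpolyX; apply: leq_trans (deg_prod_le _) _.
  have -> : E = (\sum_(i < n.+1) d * D)%N by rewrite sum_nat_const card_ord.
  apply: leq_sum => i _.
  apply: leq_trans (degX_le _ _) _; rewrite mnmE; apply: leq_mul.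
    exact/ltnW/ltn_ord.
  exact: (leq_bigmax (F := fun i => (msize (tnth s i)).-1)).
pose A := \matrix_(i < #|{ffun 'I_n.+1 -> 'I_d}|, j < #|{ffun 'I_n -> 'I_E.+1}|)
  (P (enum_val i))@_(mon' (enum_val j)).
(* d ^ n.+1 > (d * C) ^ n >= E.+1 ^ n, because d > C ^ n. *)
have [|v [v0 vA]] := @left_kernel_exists _ _ A.
  rewrite !card_ffun !card_ord expnS -/d.
  apply: (@leq_ltn_trans ((d * C) ^ n)).
    case: (n) => [|k]; first by rewrite !expn0.
    rewrite leq_exp2r // /E /C mulnS mulnCA; lia.
  by rewrite expnMn [X in (_ < X)%N]mulnC ltn_pmul2l // expn_gt0.
have mon_inj : injective mon.
  move=> t t' /mnmP e; apply/ffunP => i; apply/val_inj.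
  by have := e i; rewrite !mnmE.
pose Q := \sum_i v 0 i *: 'X_[mon (enum_val i)] : {mpoly K[n.+1]}.
have QE i : Q@_(mon (enum_val i)) = v 0 i.
  rewrite raddf_sum /= (bigD1 i) //= mcoeffZ mcoeffX eqxx mulr1 big1 ?addr0 //.
  move=> j ji; rewrite mcoeffZ mcoeffX (inj_eq mon_inj) (inj_eq enum_val_inj).
  by rewrite (negPf ji) mulr0.
exists Q; split.
  apply: contra_neq v0 => Q0; apply/rowP => i.
  by rewrite -QE Q0 mcoeff0 mxE.
have QsE : Q \mPo s = \sum_i v 0 i *: P (enum_val i).
  by rewrite raddf_sum; apply: eq_bigr => i _; rewrite /= comp_mpolyZ.
apply/mpolyP => m; rewrite mcoeff0.
have [/forallP mE|] := boolP [forall i, m i < E.+1]%N.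
  pose t := [ffun i => Ordinal (mE i)]; have -> : m = mon' t.
    by apply/mnmP => i; rewrite mnmE ffunE.
  move/rowP/(_ (enum_rank t)): vA; rewrite !mxE => <-.
  rewrite QsE raddf_sum /=; apply: eq_bigr => i _.
  by rewrite !mxE enum_rankK mcoeffZ.
rewrite negb_forall => /existsP[i]; rewrite -leqNgt => Em.
rewrite QsE raddf_sum big1 // => j _ /=; rewrite mcoeffZ memN_msupp_eq0 ?mulr0 //.
apply: msize_mdeg_ge; apply: leq_trans (leqSpred _) _.
apply: leq_ltn_trans (degP _) _; apply: leq_trans Em _.
by rewrite mdegE (bigD1 i) //= leq_addr.
Qed.

End AlgebraicDependence.

Section Elimination.
Variables (K : fieldType) (k : nat) (R : comNzRingType).
Variable (ev : {rmorphism {mpoly K[k]} -> R}).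
Implicit Types (Q : {mpoly K[k]}) (J : R -> Prop).

Definition from_var (r : nat) Q : Prop :=
  forall m, m \in msupp Q -> forall i : 'I_k, (i < r)%N -> m i = 0%N.

(** Keep the terms with the least exponent e in the variable j, and divide them
    by its e-th power: the value of the discarded terms is a multiple of the
    (e+1)-st power. *)
Lemma eliminate_variable J J' (j : 'I_k) Q :
    is_ideal J' -> (forall f, J f -> J' f) -> J' (ev 'X_j) ->
    regular_mod J (ev 'X_j) ->
    Q != 0 -> from_var j Q -> J (ev Q) ->
  exists Q', [/\ Q' != 0, from_var j.+1 Q' & J' (ev Q')].
Proof.
move=> iJ' JJ' Js rs Q0 fQ JQ.
have ex : exists e, has (fun m : 'X_{1..k} => m j == e) (msupp Q).
  have : mlead Q \in msupp Q by apply: mlead_supp.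
  by exists (mlead Q j); apply/hasP; exists (mlead Q).
case: (ex_minnP ex) => e /hasP[m0 m0Q /eqP m0e] emin.
have leQ m : m \in msupp Q -> (e <= m j)%N.
  by move=> mQ; apply: emin; apply/hasP; exists m.
pose red (m : 'X_{1..k}) := (m - U_(j) *+ e)%MM.
have redK (m : 'X_{1..k}) : (e <= m j)%N -> m = (red m + U_(j) *+ e)%MM.
  move=> em; rewrite submK //; apply/mnm_lepP => i; rewrite mulmnE mnm1E.
  by case: eqP => [<-|]; rewrite ?mul1n ?mul0n.
pose Q' := \sum_(m <- msupp Q | m j == e) Q@_m *: 'X_[red m].
pose Q'' := \sum_(m <- msupp Q | m j != e)
   Q@_m *: 'X_[(m - U_(j) *+ e.+1)%MM] : {mpoly K[k]}.
have QE : Q = 'X_j ^+ e * (Q' + 'X_j * Q'').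
  rewrite {1}[Q]mpolyE (bigID (fun m : 'X_{1..k} => m j == e)) /= mulrDr.
  rewrite mulrA -exprSr; congr (_ + _).
    rewrite /Q' mulr_sumr big_seq_cond [RHS]big_seq_cond; apply: eq_bigr => m /andP[mQ me].
    by rewrite -scalerAr mpolyXn -mpolyXD addmC -redK // leQ.
  rewrite /Q'' mulr_sumr big_seq_cond [RHS]big_seq_cond; apply: eq_bigr => m /andP[mQ me].
  rewrite -scalerAr mpolyXn -mpolyXD addmC submK //; apply/mnm_lepP => i.
  rewrite mulmnE mnm1E; case: eqP => [<-|]; rewrite ?mul1n ?mul0n //.
  by rewrite ltn_neqAle eq_sym me leQ.
exists Q'; split.
- have : Q'@_(red m0) = Q@_m0.
    rewrite raddf_sum /= big_mkcond (bigD1_seq m0) ?msupp_uniq //= m0e eqxx.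
    rewrite mcoeffZ mcoeffX eqxx mulr1 big1 ?addr0 // => m mm0.
    case: ifP => // /eqP me; rewrite mcoeffZ mcoeffX.
    case: eqP => [er|]; last by rewrite mulr0.
    by case/eqP: mm0; rewrite (redK m) ?me // (redK m0) ?m0e // er.
  move=> e0; apply: contraTneq m0Q => Q'0; rewrite -mcoeff_eq0.
  by rewrite -e0 Q'0 mcoeff0.
- move=> m; rewrite mcoeff_msupp => Q'm i ij; apply: contraTeq Q'm => mi.
  rewrite negbK raddf_sum /= big_seq_cond big1 // => m' /andP[m'Q /eqP m'e].
  rewrite mcoeffZ mcoeffX; case: eqP => [em|]; last by rewrite mulr0.
  case/eqP: mi; rewrite -em mnmBE mulmnE mnm1E.
  case: eqVneq ij => [<- _|ji ij]; first by rewrite m'e mul1n subnn.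
  by rewrite (fQ _ m'Q) // ltn_neqAle -ltnS ij andbT eq_sym.
- have : J (ev (Q' + 'X_j * Q'')).
    move: JQ; rewrite QE rmorphM rmorphXn; elim: (e) => [|d IH].
      by rewrite expr0 mul1r.
    by rewrite exprS -mulrA => /rs.
  rewrite rmorphD rmorphM /= => /JJ' h.
  by have := idealB iJ' h (ideal_mulr (ev Q'') iJ' Js); rewrite addrK.
Qed.

(** Eliminating the variables one after the other from a relation leaves a
    nonzero constant in the last ideal. *)
Lemma relation_unit (J : nat -> R -> Prop) r Q :
    (r <= k)%N -> (forall i, is_ideal (J i)) ->
    (forall i : 'I_k, (r <= i)%N -> [/\ forall f, J i f -> J i.+1 f,
       J i.+1 (ev 'X_i) & regular_mod (J i) (ev 'X_i)]) ->
    Q != 0 -> from_var r Q -> J r (ev Q) ->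
  J k 1.
Proof.
move=> rk iJ; rewrite -(subKn rk); move: (k - r)%N (leq_subr r k) => d.
elim: d Q => [|d IH] Q dk step Q0 fQ JQ.
  move: fQ JQ; rewrite subn0 => fQ JQ.
  have QC : Q = (Q@_0)%:MP.
    apply/mpolyP => m; rewrite mcoeffC.
    have [->|m0] := eqVneq m 0%MM; first by rewrite mulr1.
    rewrite mulr0; apply/eqP; rewrite mcoeff_eq0; apply: contra m0 => mQ.
    by apply/eqP/mnmP => i; rewrite mnm0E; apply: (fQ m).
  have c0 : Q@_0 != 0 by rewrite -(mpolyC_eq0 k) -QC.
  have -> : 1 = ev (Q@_0)^-1%:MP * ev Q.
    by rewrite -rmorphM {2}QC -mpolyCM mulVf // rmorph1.
  exact: ideal_mull.
have lt : (k - d.+1 < k)%N by lia.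
have [sub mem reg] := step (Ordinal lt) (leqnn _).
have [Q' [Q'0 fQ' JQ']] := eliminate_variable (iJ _) sub mem reg Q0 fQ JQ.
rewrite /= (_ : (k - d.+1).+1 = k - d)%N in fQ' JQ'; last by lia.
apply: (IH Q') => //; first exact: ltnW.
by move=> i di; apply: step; lia.
Qed.

End Elimination.

(** The relation between n+1 elements of K[n] bounds at once the lengths of
    chains of primes, by taking in each prime an element outside the previous
    one, and those of regular sequences. *)
Theorem chain_unit (K : fieldType) n (s : n.+1.-tuple {mpoly K[n]})
    (J : nat -> {mpoly K[n]} -> Prop) :
    (forall i, is_ideal (J i)) ->
    (forall i : 'I_n.+1, [/\ forall f, J i f -> J i.+1 f,
       J i.+1 (tnth s i) & regular_mod (J i) (tnth s i)]) ->
  J n.+1 1.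
Proof.
move=> iJ step; have [Q [Q0 Qs]] := algebraic_dependence s.
apply: (relation_unit (ev := comp_mpoly s) (r := 0%N) (Q := Q)) => //.
- by move=> i _; rewrite /= comp_mpolyXU -tnth_nth.
- by rewrite /= Qs; apply: ideal0.
Qed.

(** * The Nullstellensatz *)

Lemma digits_inj n N (u v : 'I_n -> nat) :
  (forall i, u i < N)%N -> (forall i, v i < N)%N ->
  (\sum_i u i * N ^ i)%N = (\sum_i v i * N ^ i)%N -> u =1 v.
Proof.
elim: n u v => [|n IH] u v uN vN; first by move=> _ [].
have shift (w : 'I_n.+1 -> nat) :
    (\sum_i w i * N ^ i = \sum_(i < n) w (lift ord0 i) * N ^ i * N + w ord0)%N.
  rewrite big_ord_recl expn0 muln1 addnC; congr (_ + _)%N; apply: eq_bigr => i _.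
  by rewrite lift0 expnSr mulnA.
rewrite !shift -!big_distrl /= => e.
have N0 : (0 < N)%N by apply: leq_ltn_trans (uN ord0).
have e0 : u ord0 = v ord0.
  by move/(congr1 (modn^~ N)): e; rewrite !modnMDl !modn_small.
have es : forall i, u (lift ord0 i) = v (lift ord0 i).
  move/(congr1 (divn^~ N)): e; rewrite !divnMDl // !divn_small // !addn0.
  exact: IH.
by move=> i; case: (unliftP ord0 i) => [j|] ->.
Qed.

Lemma mpoly_morph_ext (K : nzRingType) n (A : nzRingType)
    (f g : {rmorphism {mpoly K[n]} -> A}) :
  (forall c, f c%:MP = g c%:MP) -> (forall i, f 'X_i = g 'X_i) -> f =1 g.
Proof.
move=> fgC fgX; apply: mpolyind => [|c m p _ _ IH]; first by rewrite !rmorph0.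
rewrite !rmorphD IH -mul_mpolyC !rmorphM fgC mpolyXE_id !rmorph_prod.
by congr (_ * _ + _); apply: eq_bigr => i _; rewrite !rmorphXn fgX.
Qed.

Section Nullstellensatz.
Variable K : closedFieldType.

Lemma poly_nonroot (p : {poly K}) : p != 0 -> exists c, p.[c] != 0.
Proof.
move=> p0; have [sp|sp] := leqP (size p) 1.
  by exists 0; rewrite (size1_polyC sp) hornerC -polyC_eq0 -size1_polyC.
have : size (p - 1) != 1%N.
  by rewrite size_polyDl ?size_polyN ?size_poly1 // neq_ltn sp orbT.
move=> /closed_rootP[c]; rewrite /root !hornerE subr_eq0 => /eqP pc.
by exists c; rewrite pc oner_eq0.
Qed.

(** Evaluate at the powers of t whose exponents are the powers of a base larger
    than the degree: distinct monomials become distinct powers of t. *)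
Lemma mpoly_nonzero_value n (f : {mpoly K[n]}) :
  f != 0 -> exists v, f.@[v] != 0.
Proof.
move=> f0; pose N := msize f.
pose e (m : 'X_{1..n}) := (\sum_i m i * N ^ i)%N.
have lt_N m : m \in msupp f -> forall i, (m i < N)%N.
  move=> /msize_mdeg_lt; rewrite mdegE => h i; apply: leq_ltn_trans h.
  by rewrite (bigD1 i) //= leq_addr.
pose q : {poly K} := \sum_(m <- msupp f) f@_m *: 'X^(e m).
have [|t qt] := @poly_nonroot q; last first.
  exists (fun i => t ^+ (N ^ i)); move: qt; rewrite mevalE /q horner_sum.
  rewrite (eq_bigr (fun m => f@_m * \prod_(i < n) t ^+ (N ^ i) ^+ m i)) // => m _.
  rewrite hornerZ hornerXn /e; congr (_ * _).
  by rewrite expr_sum; apply: eq_bigr => i _; rewrite -exprM mulnC.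
have lf : mlead f \in msupp f by apply: mlead_supp.
apply: contraNneq f0 => /(congr1 (coefp (e (mlead f)))).
rewrite /= coef0 -mleadc_eq0 => <-; apply/eqP.
rewrite /q coef_sum (bigD1_seq (mlead f)) ?msupp_uniq //=.
rewrite coefZ coefXn eqxx mulr1 big_seq_cond big1 ?addr0 //.
move=> m /andP[mf ml]; rewrite coefZ coefXn; case: eqP => [em|]; last first.
  by rewrite mulr0.
case/eqP: ml; apply/mnmP => i; apply: esym.
by apply: (@digits_inj n N); [apply: lt_N | apply: lt_N | exact: em].
Qed.

Section Zariski.
Variables (L : comNzRingType) (io : {rmorphism K -> L}).
Hypothesis Lfield : forall a : L, a <> 0 -> exists b, a * b = 1.

Lemma no_zero_divisors (a b : L) : a * b = 0 -> a = 0 \/ b = 0.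
Proof.
move=> ab; have [a0|] := pselect (a = 0); first by left.
move=> /Lfield[c ac]; right; rewrite -[b]mul1r -ac mulrAC ab mul0r.
by [].
Qed.

Definition subalg n (s : 'I_n -> L) (b : L) : Prop :=
  exists Q : {mpoly K[n]}, mmap io s Q = b.

(** Along a line a + b X the highest power of X only depends on the direction b.
    So a polynomial becomes monic in X, up to a scalar, along every line whose
    direction avoids the zeros of its leading form. *)
Lemma coef_line n (A : comNzRingType) (a b : 'I_n -> A) (m : 'X_{1..n}) :
  let p := mmap1 (fun i => (a i)%:P + (b i)%:P * 'X) m in
  (size p <= (mdeg m).+1)%N /\ p`_(mdeg m) = mmap1 b m.
Proof.
move=> /=; pose lin (p : {poly A}) d c := (size p <= d.+1)%N /\ p`_d = c.
have linM p q d e c c' : lin p d c -> lin q e c' -> lin (p * q) (d + e)%N (c * c').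
  move=> [sp <-] [sq <-]; split.
    by apply: leq_trans (size_polyMleq _ _) _; lia.
  have lt : (d < (d + e).+1)%N by lia.
  rewrite coefM (bigD1 (Ordinal lt)) //= addKn big1 ?addr0 // => i.
  rewrite -val_eqE /= => id.
  have [di|di] := ltnP d i.
    by rewrite nth_default ?mul0r //; apply: leq_trans sp _.
  rewrite [q`__]nth_default ?mulr0 //; apply: leq_trans sq _.
  have := ltn_ord i; lia.
rewrite /mmap1 mdegE -/(lin _ _ _).
apply: (big_ind3 lin) => [|p d c q e c'|i _].
- by split; rewrite ?size_poly1 // coefC eqxx.
- exact: linM.
- elim: (m i) => [|k IH]; first by split; rewrite ?expr0 ?size_poly1 // coefC eqxx.
  rewrite !exprS -add1n; apply: linM IH; split.
    apply: leq_trans (size_polyD _ _) _; rewrite geq_max; apply/andP; split.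
      by apply: leq_trans (size_polyC_leq1 _) _.
    apply: leq_trans (size_polyMleq _ _) _; rewrite size_polyX addn2 /=.
    by rewrite ltnS size_polyC_leq1.
  by rewrite coefD coefC coefMX coefC add0r.
Qed.

Lemma mmap_line n (A : comNzRingType) (g : {rmorphism K -> A}) (a b : 'I_n -> A)
    (Q : {mpoly K[n]}) (D := (msize Q).-1) :
  let W := mmap (polyC \o g) (fun i => (a i)%:P + (b i)%:P * 'X) Q in
  (size W <= D.+1)%N /\ W`_D = mmap g b (pihomog mdeg D Q).
Proof.
have le m : m \in msupp Q -> (mdeg m <= D)%N.
  by move=> /msize_mdeg_lt; rewrite /D; case: (msize Q).
have line := coef_line a b; split.
  rewrite /mmap big_seq_cond; apply: (big_ind (fun p : {poly A} => size p <= D.+1)%N).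
  - by rewrite size_poly0.
  - by move=> p q sp sq; rewrite (leq_trans (size_polyD _ _)) // geq_max sp.
  - move=> m /andP[/le mD _]; rewrite /= mul_polyC.
    apply: leq_trans (size_scale_leq _ _) _; exact: leq_trans (line m).1 _.
rewrite coef_sum pihomogE rmorph_sum /= [RHS]big_mkcond /=.
rewrite big_seq [RHS]big_seq; apply: eq_bigr => m /le mD.
rewrite mul_polyC coefZ; case: eqP => [<-|/eqP nD].
  by rewrite (line m).2 mmapZ mmapX.
rewrite nth_default ?mulr0 //; apply: leq_trans (line m).1 _.
by rewrite ltn_neqAle nD.
Qed.

Lemma subalg_trans n m (s : 'I_n -> L) (s' : 'I_m -> L) b :
  (forall j, subalg s (s' j)) -> subalg s' b -> subalg s b.
Proof.
move=> /choice[q qs] [B <-]; exists (mmap (@mpolyC n K) q B).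
have := @mpoly_morph_ext K m L (mmap io s \o mmap (@mpolyC n K) q) (mmap io s').
by apply=> [c|j] /=; rewrite ?mmapC // !mmapX !mmap1U qs.
Qed.

Lemma integral_mmap n m (s : 'I_n -> L) (s' : 'I_m -> L) Q :
  (forall i, integralOver (mmap io s') (s i)) ->
  integralOver (mmap io s') (mmap io s Q).
Proof.
move=> int; rewrite /mmap; apply: (big_ind (integralOver (mmap io s'))).
- exact: integral0.
- by move=> *; apply: integral_add.
move=> k _; apply: integral_mul.
  rewrite -(mmapC s' io); exact: (integral_id (mmap io s')).
rewrite /mmap1; apply: (big_ind (integralOver (mmap io s'))).
- exact: integral1.
- by move=> *; apply: integral_mul.
move=> i _; elim: (k i) => [|d IH]; first exact: integral1.
by rewrite exprS; apply: integral_mul.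
Qed.

(** Multiply an integral equation of b', of degree d+1, by the d-th power of b. *)
Lemma integral_inverse n (s : 'I_n -> L) b b' :
  subalg s b -> b * b' = 1 -> integralOver (mmap io s) b' -> subalg s b'.
Proof.
move=> [B eB] bb' [p p_mon /eqP]; rewrite horner_coef size_map_poly_id0; last first.
  by rewrite (monicP p_mon) rmorph1 oner_eq0.
have sp : size p = (size p).-1.+1 by rewrite (polySpred (monic_neq0 p_mon)).
rewrite {}sp; move ed : (size p).-1 => d.
have lc : p`_d = 1 by rewrite -ed -lead_coefE (monicP p_mon).
rewrite big_ord_recr /= !coef_map /= lc rmorph1 mul1r {ed lc} => e.
have bK k j : (j <= k)%N -> b' ^+ j * b ^+ k = b ^+ (k - j).
  by move=> /subnK{1}<-; rewrite exprD mulrCA -exprMn mulrC [b' * b]mulrC bb' expr1n mul1r.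
case: d e => [|d] e.
  by move: e; rewrite big_ord0 add0r expr0 => e; exists 0; rewrite rmorph0;
     rewrite -[b']mul1r e mul0r.
exists (- \sum_(i < d.+1) p`_i * B ^+ (d - i)).
have := congr1 ( *%R^~ (b ^+ d)) e.
rewrite mul0r mulrDl mulr_suml exprS -mulrA bK // subnn expr0 mulr1 => {}e.
rewrite rmorphN rmorph_sum; apply/eqP; rewrite eq_sym -addr_eq0 addrC.
apply/eqP; rewrite -[RHS]e; congr (_ + _).
apply: eq_bigr => i _; have := ltn_ord i; rewrite ltnS => id.
by rewrite coef_map -mulrA bK //= rmorphM rmorphXn /= eB.
Qed.

Lemma root_in_base (p : {poly K}) u : p \is monic ->
  root (map_poly io p) u -> exists c, u = io c.
Proof.
move=> p_mon; have [r ->] := closed_field_poly_normal p.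
rewrite (monicP p_mon) scale1r => /eqP; rewrite rmorph_prod horner_prod.
elim: r => [|c r IH].
  by rewrite big_nil => h; move: (oner_neq0 L); rewrite h eqxx.
rewrite big_cons /= => /no_zero_divisors[|/IH//].
by rewrite map_polyXsubC !hornerE => /eqP; rewrite subr_eq0 => /eqP; exists c.
Qed.

(** Zariski's lemma. If the generators satisfy a relation, then after a linear
    change of generators one of them is integral over the algebra generated by
    the others, which is then again a field; without a relation the algebra is a
    polynomial ring, where the variables are not invertible. *)
Theorem zariski_lemma n (s : 'I_n -> L) :
    (forall b, subalg s b -> b <> 0 -> exists b', subalg s b' /\ b * b' = 1) ->
  forall i, exists c, s i = io c.
Proof.
elim: n s => [|n IH] s sfield; first by case.
have [inj|] := pselect (forall Q, mmap io s Q = 0 -> Q = 0).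
  have s0 : s ord0 = mmap io s 'X_ord0 by rewrite mmapX mmap1U.
  have [||_ [[Q <-] e]] := sfield (s ord0).
  - by exists 'X_ord0.
  - rewrite s0 => /inj X0; move: (oner_neq0 K).
    have := congr1 (meval (fun=> 1)) X0; rewrite mevalXU meval0 => ->.
    by rewrite eqxx.
  have /inj/eqP : mmap io s ('X_ord0 * Q - 1) = 0.
    by rewrite rmorphB rmorphM /= -s0 e rmorph1 subrr.
  rewrite subr_eq0 => /eqP/(congr1 (meval (fun=> 0))).
  rewrite mevalM mevalXU mul0r meval1 => /esym/eqP.
  by rewrite (negPf (oner_neq0 K)).
move=> /existsNP[Q /not_implyP[sQ /eqP Q0]].
pose D := (msize Q).-1; pose QD := pihomog mdeg D Q.
have QD0 : QD != 0.
  rewrite -[QD]/(pihomog mdeg D Q) pihomogE.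
  have : QD@_(mlead Q) = mleadc Q.
    rewrite /QD pihomogE raddf_sum /= big_mkcond (bigD1_seq (mlead Q)) ?msupp_uniq ?mlead_supp //=.
    rewrite -[D]/(_.-1) -(mlead_deg Q0) /= eqxx mcoeffZ mcoeffX eqxx mulr1.
    rewrite big1 ?addr0 // => m mQ; case: ifP => // _; rewrite mcoeffZ mcoeffX.
    by rewrite (negPf mQ) mulr0.
  rewrite -pihomogE -/QD => e; apply: contraNneq Q0 => QD0.
  by rewrite -mleadc_eq0 -e QD0 mcoeff0.
have [p] : exists p, (QD * 'X_ord0).@[p] != 0.
  apply: mpoly_nonzero_value; rewrite mulf_neq0 //.
  by rewrite -msupp_eq0 msuppX.
rewrite mevalM mevalXU mulf_eq0 negb_or => /andP[QDp p0].
(* The new generators satisfy s i = s' + io (p i) * u, so that the relation Q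
   becomes an equation for u of degree D and leading coefficient QD.@[p]. *)
pose u := s ord0 * io (p ord0)^-1.
pose s' (j : 'I_n) := s (lift ord0 j) - io (p (lift ord0 j)) * u.
pose a i : {mpoly K[n]} := if unlift ord0 i is Some j then 'X_j else 0.
have sE i : s i = mmap io s' (a i) + io (p i) * u.
  rewrite /a; case: unliftP => [j|] ->; first by rewrite mmapX mmap1U subrK.
  by rewrite rmorph0 add0r /u mulrCA -rmorphM divff // rmorph1 mulr1.
pose pC (i : 'I_n.+1) : {mpoly K[n]} := (p i)%:MP.
pose W := mmap (polyC \o @mpolyC n K) (fun i => (a i)%:P + (pC i)%:P * 'X) Q.
have [sW WD] := mmap_line (@mpolyC n K) a pC Q; rewrite -/W -/D -/QD in sW WD.
have {}WD : W`_D = (QD.@[p])%:MP.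
  rewrite WD.
  have := @mpoly_morph_ext K n.+1 _ (mmap (@mpolyC n K) pC) (@mpolyC n K \o meval p).
  by apply=> [c|i] /=; rewrite ?mmapC ?mevalC // mmapX mmap1U mevalXU.
pose V := (QD.@[p])^-1%:MP *: W.
have V_mon : V \is monic.
  have VD : V`_D = 1 by rewrite coefZ WD -mpolyCM mulVf // mpolyC1.
  have sV : size V = D.+1.
    apply/eqP; rewrite eqn_leq (leq_trans (size_scale_leq _ _)) //=.
    by apply: contraT; rewrite -leqNgt => /leq_sizeP/(_ D (leqnn _))/eqP; rewrite VD oner_eq0.
  by rewrite monicE lead_coefE sV VD.
have Vu : root (map_poly (mmap io s') V) u.
  have Wu : (map_poly (mmap io s') W).[u] = mmap io s Q.
    pose lin i := (a i)%:P + (pC i)%:P * 'X.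
    have := @mpoly_morph_ext K n.+1 L
      (horner_eval u \o (map_poly (mmap io s') \o mmap (polyC \o @mpolyC n K) lin))
      (mmap io s).
    apply=> [c|i] /=; rewrite /horner_eval.
      by rewrite !mmapC /= map_polyC hornerC /= mmapC.
    rewrite !mmapX !mmap1U /lin rmorphD rmorphM /= !map_polyC map_polyX !hornerE /=.
    by rewrite mmapC -mulrA -/u -sE.
  by rewrite /root map_polyZ hornerZ Wu sQ mulr0.
have intu : integralOver (mmap io s') u by exists V.
have ints i : integralOver (mmap io s') (s i).
  rewrite sE; apply: integral_add; first exact: integral_id.
  apply: integral_mul intu; rewrite -(mmapC s' io); exact: integral_id.
have /choice[c sc] : forall j, exists c, s' j = io c.
  apply: IH => b s'b b0.
  have sb : subalg s b.
    apply: subalg_trans s'b => j; rewrite /s' /u.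
    exists ('X_(lift ord0 j) - (p (lift ord0 j))%:MP * ('X_ord0 * (p ord0)^-1%:MP)).
    by rewrite rmorphB !rmorphM /= !mmapX !mmap1U !mmapC.
  have [b' [[B' eB'] bb']] := sfield b sb b0.
  exists b'; split=> //; apply: integral_inverse s'b bb' _.
  by rewrite -eB'; apply: integral_mmap.
have [||d ud] := @root_in_base (map_poly (meval c) V) u.
- by rewrite monic_map.
- rewrite -map_poly_comp; move: Vu; congr (is_true (root _ _)).
  apply: eq_map_poly => B /=.
  have := @mpoly_morph_ext K n L (mmap io s') (io \o meval c).
  by apply=> [e|j] /=; rewrite ?mmapC ?mevalC // mmapX mmap1U mevalXU.
move=> i; rewrite sE /a; case: unliftP => [j|] _.
  by rewrite mmapX mmap1U sc ud; exists (c j + p i * d); rewrite rmorphD rmorphM.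
by rewrite rmorph0 add0r ud; exists (p i * d); rewrite rmorphM.
Qed.

End Zariski.
(** The residue field of a maximal ideal is generated by the variables, hence is
    the base field. *)
Theorem nullstellensatz n (A : comNzRingType) (p : {rmorphism {mpoly K[n]} -> A})
    (M : idealr A) :
    (forall a, exists f, p f = a) -> maximal_ideal M ->
  exists v, forall f, p f \in M <-> f.@[v] = 0.
Proof.
move=> surj maxM; have [r [rsurj rE]] := ideal_quot_morphism M.
pose L : comNzRingType := {ideal_quot M}.
have Lfield (b : L) : b <> 0 -> exists b', b * b' = 1.
  have [a <-] := rsurj b => ra0; apply: contrapT => noinv.
  have iM := ideal_idealr M.
  have [|I IP] := idealr_of (is_ideal_adjoin a iM).
    move=> [m [c [mM e]]]; apply: noinv; exists (r c).
    have rm := (rE m).1 mM.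
    by have := congr1 r e; rewrite rmorph1 rmorphD rmorphM rm add0r mulrC.
  have aI : a \in I by apply/IP/mem_adjoin.
  apply: ra0; apply/rE; rewrite -(maxM I) // => m mM.
  exact/IP/sub_adjoin.
pose io : {rmorphism K -> L} := r \o (p \o @mpolyC n K).
have ev (f : {mpoly K[n]}) : mmap io (fun i => r (p 'X_i)) f = r (p f).
  have := @mpoly_morph_ext K n L (mmap io (fun i => r (p 'X_i))) (r \o p) _ _ f.
  by apply=> [c|i] /=; rewrite ?mmapC // mmapX mmap1U.
have /choice[v vP] : forall i, exists c, r (p 'X_i) = io c.
  apply: (zariski_lemma Lfield (s := fun i => r (p 'X_i))) => b _ /Lfield[b' bb'].
  exists b'; split=> //; have [a ra] := rsurj b'; have [f pf] := surj a.
  by exists f; rewrite ev pf.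
exists v => f.
have rf : r (p f) = io f.@[v].
  have := @mpoly_morph_ext K n L (r \o p) (io \o meval v) _ _ f.
  by apply=> [c|i] /=; rewrite ?mevalC // mevalXU vP.
split=> [/rE|f0]; last by apply/rE; rewrite rf f0 rmorph0.
rewrite rf => io0; apply/eqP; apply: contraT => f0.
have := congr1 io (mulfV f0); rewrite rmorph1 rmorphM [io _]io0 mul0r => e.
by move: (oner_neq0 L); rewrite -e eqxx.
Qed.

End Nullstellensatz.

(** * Substitutions, homogeneity and binary forms *)

(** Substitution is locked to keep conversion from unfolding it when two
    substitutions are compared. *)
HB.lock Definition sub (K : fieldType) (n : nat) (s : 'I_n -> {mpoly K[n]}) :
  {rmorphism {mpoly K[n]} -> {mpoly K[n]}} := mmap (@mpolyC n K) s.

Section Substitution.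
Variables (K : fieldType) (n : nat).
Local Notation R := {mpoly K[n]}.
Implicit Types (f g h : R) (m : 'X_{1..n}) (s : 'I_n -> R).

Definition homogeneous_set (J : R -> Prop) : Prop :=
  forall d f, J f -> J (pihomog mdeg d f).

Lemma mmapU (A : comNzRingType) (io : {rmorphism K -> A}) (s : 'I_n -> A) i :
  mmap io s 'X_i = s i.
Proof. by rewrite mmapX mmap1U. Qed.

Lemma mpolyX_neq0 m : 'X_[m] != 0 :> R.
Proof. by rewrite -msupp_eq0 msuppX. Qed.

(** The elements on which two morphisms agree modulo J form a subring. *)
Lemma morph_congruence (A : comNzRingType) (J : A -> Prop)
    (p q : {rmorphism R -> A}) : is_ideal J ->
    (forall c, p c%:MP = q c%:MP) -> (forall i, J (p 'X_i - q 'X_i)) ->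
  forall f, J (p f - q f).
Proof.
move=> iJ pqC pqX.
have JM a b a' b' : J (a - a') -> J (b - b') -> J (a * b - a' * b').
  move=> Ja Jb; have -> : a * b - a' * b' = (a - a') * b + a' * (b - b') by ring.
  by apply: idealD => //; [apply: ideal_mulr | apply: ideal_mull].
apply: mpolyind => [|c m f _ _ IH]; first by rewrite !rmorph0 subr0; apply: ideal0.
rewrite -mul_mpolyC !rmorphD !rmorphM pqC opprD addrACA; apply: idealD => //.
apply: (JM); first by rewrite subrr; apply: ideal0.
rewrite mpolyXE_id !rmorph_prod.
apply: (big_ind2 (fun a b => J (a - b))) => [||i _].
- by rewrite subrr; apply: ideal0.
- by move=> a a' b b'; apply: JM.
rewrite !rmorphXn; elim: (m i) => [|k IHk]; first by rewrite subrr; apply: ideal0.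
by rewrite !exprS; apply: JM.
Qed.

Lemma subU s i : sub s 'X_i = s i. Proof. rewrite sub.unlock; exact: mmapU. Qed.

Lemma subC s c : sub s c%:MP = c%:MP. Proof. rewrite sub.unlock; exact: mmapC. Qed.

Lemma subZ s c f : sub s (c *: f) = c *: sub s f.
Proof. by rewrite -!mul_mpolyC rmorphM subC. Qed.

Lemma sub_mod s (J : R -> Prop) :
  is_ideal J -> (forall i, J ('X_i - s i)) -> forall f, J (f - sub s f).
Proof.
move=> iJ Js; apply: (morph_congruence (p := idfun) (q := sub s)) => // [c|i].
  by rewrite subC.
by rewrite subU; apply: Js.
Qed.

Lemma sub_ext (p q : {rmorphism R -> R}) :
  (forall c, p c%:MP = c%:MP) -> (forall c, q c%:MP = c%:MP) ->
  (forall i, p 'X_i = q 'X_i) -> p =1 q.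
Proof. by move=> pC qC; apply: mpoly_morph_ext => c; rewrite pC qC. Qed.

Lemma is_ideal_multiples f : is_ideal (fun g => exists h, g = f * h).
Proof.
split=> [|_ _ [h ->] [h' ->]|c _ [h ->]].
- by exists 0; rewrite mulr0.
- by exists (h + h'); rewrite mulrDr.
- by exists (c * h); rewrite mulrCA.
Qed.

Definition kill (i : 'I_n) : {rmorphism R -> R} :=
  sub (fun j => if j == i then 0 else 'X_j).

Lemma killC i c : kill i c%:MP = c%:MP. Proof. exact: subC. Qed.

Lemma killU i j : kill i 'X_j = if j == i then 0 else 'X_j. Proof. exact: subU. Qed.

Lemma killUi i : kill i 'X_i = 0. Proof. by rewrite killU eqxx. Qed.

Lemma killUj i j : j != i -> kill i 'X_j = 'X_j.
Proof. by rewrite killU => /negPf->. Qed.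

Lemma killX i m : kill i 'X_[m] = if m i == 0%N then 'X_[m] else 0.
Proof.
rewrite [X in kill i X]mpolyXE_id rmorph_prod; case: eqP => [mi|/eqP mi].
  rewrite [RHS]mpolyXE_id; apply: eq_bigr => j _; rewrite rmorphXn killU.
  by case: eqP => [->|//]; rewrite mi !expr0.
by rewrite (bigD1 i) //= rmorphXn killUi expr0n (negPf mi) mul0r.
Qed.

Lemma kill_coeff i f m : (kill i f)@_m = if m i == 0%N then f@_m else 0.
Proof.
have -> : kill i f = \sum_(m' <- msupp f) f@_m' *: (if m' i == 0%N then 'X_[m'] else 0).
  rewrite {1}[f]mpolyE rmorph_sum /=; apply: eq_bigr => m' _.
  by rewrite -/(kill i _) /kill subZ -/(kill i) killX.
rewrite raddf_sum /= (eq_bigr (fun m' => (if m i == 0%N then f@_m' else 0) * (m' == m)%:R)).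
  case: eqP => _; last by rewrite big1 // => m' _; rewrite mul0r.
  have [mf|mf] := boolP (m \in msupp f).
    rewrite (bigD1_seq m) ?msupp_uniq //= eqxx mulr1 big1 ?addr0 // => m' /negPf->.
    by rewrite mulr0.
  rewrite big_seq big1 ?memN_msupp_eq0 // => m' m'f.
  by case: eqP => [e|]; [rewrite -e m'f in mf | rewrite mulr0].
move=> m' _; rewrite mcoeffZ; case: (m' =P m) => [->|/eqP ne].
  by case: eqP => _; rewrite ?mcoeffX ?eqxx ?mcoeff0 ?mulr1 ?mulr0.
case: (m' i == 0%N); rewrite ?mcoeffX ?(negPf ne) ?mcoeff0 ?mulr0 //.
Qed.

Lemma kill_fixP i f : kill i f = f <-> forall m, m \in msupp f -> m i = 0%N.
Proof.
split=> [e m|h].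
  rewrite mcoeff_msupp -e kill_coeff => fm; apply/eqP.
  by apply: contraNT fm => /negPf->.
apply/mpolyP => m; rewrite kill_coeff; case: eqP => // mi; apply: esym.
by apply: memN_msupp_eq0; apply/negP => /h.
Qed.

Lemma kill_diff i f : exists g, f = kill i f + 'X_i * g.
Proof.
have [|g e] := sub_mod (s := fun j => if j == i then 0 else 'X_j)
                       (is_ideal_multiples 'X_i) _ f.
  move=> j; case: eqP => [->|_]; first by exists 1; rewrite subr0 mulr1.
  by exists 0; rewrite subrr mulr0.
by exists g; rewrite -e addrC subrK.
Qed.

Lemma killK i f : kill i (kill i f) = kill i f.
Proof.
apply/mpolyP => m; rewrite (kill_coeff i (kill i f)) (kill_coeff i f).
by case: (m i == 0%N).
Qed.

Lemma kill_comm i j f : kill i (kill j f) = kill j (kill i f).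
Proof. apply/mpolyP => m.
rewrite (kill_coeff i (kill j f) m) (kill_coeff j f m).
rewrite (kill_coeff j (kill i f) m) (kill_coeff i f m).
by case: (m i == 0%N); case: (m j == 0%N). Qed.

Lemma kill0P i f : kill i f = 0 <-> exists g, f = 'X_i * g.
Proof.
split=> [e|[g ->]]; last by rewrite rmorphM killUi mul0r.
by have [g ->] := kill_diff i f; exists g; rewrite e add0r.
Qed.

Lemma dhomogX1 i : ('X_i : R) \is 1.-homog.
Proof. by rewrite dhomogX /= mdeg1. Qed.

Lemma dhomog_sub s d f : (forall i, s i \is 1.-homog) ->
  f \is d.-homog -> sub s f \is d.-homog.
Proof.
move=> s1 /dhomogP fd; rewrite sub.unlock /= /mmap big_seq; apply: rpred_sum => m /fd md.
rewrite mul_mpolyC; apply: dhomogZ; have {md}<- : mdeg m = d by []; rewrite /mmap1 mdegE.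
apply: (big_ind2 (fun (p : R) e => p \is e.-homog)) => [||i _].
- exact: dhomog1.
- by move=> p e p' e' h h'; apply: dhomogM.
- by rewrite -[m i in X in ishomog1 X]mul1n; apply: dhomogMn.
Qed.

Lemma pihomogE_dhomog d e f : f \is e.-homog ->
  pihomog mdeg d f = if e == d then f else 0.
Proof.
move=> fe; case: eqP => [<-|/eqP ne]; first exact: pihomog_dE.
by apply: pihomog_ne0 fe; rewrite eq_sym in ne *.
Qed.

Lemma pihomog_sub s d f : (forall i, s i \is 1.-homog) ->
  pihomog mdeg d (sub s f) = sub s (pihomog mdeg d f).
Proof.
move=> s1; rewrite {1}(pihomog_partitionE (leqnn (msize f))) rmorph_sum raddf_sum /=.
have h e : pihomog mdeg d (sub s (pihomog mdeg e f)) =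
    if e == d then sub s (pihomog mdeg d f) else 0.
  rewrite (pihomogE_dhomog d (dhomog_sub s1 (pihomogP mdeg e f))).
  by case: eqP => [->|].
rewrite (eq_bigr (fun e : 'I_ _ => if (e : nat) == d then sub s (pihomog mdeg d f) else 0));
  last by move=> e _; apply: h.
rewrite -big_mkcond /=; have [df|df] := ltnP d (msize f).
  by rewrite (big_pred1 (Ordinal df)) // => e; rewrite -val_eqE.
rewrite big1 => [|e /eqP ed]; last by have := ltn_ord e; rewrite ed ltnNge df.
rewrite [X in sub s X](_ : _ = 0) ?rmorph0 //.
rewrite pihomogE big_seq_cond big1 // => m /andP[/msize_mdeg_lt mf /eqP md].
by move: mf; rewrite /= md ltnNge df.
Qed.

Lemma pihomog_kill i d f : pihomog mdeg d (kill i f) = kill i (pihomog mdeg d f).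
Proof. by apply: pihomog_sub => j; case: eqP; rewrite ?dhomog0 ?dhomogX1. Qed.

Lemma dhomog_kill i d f : f \is d.-homog -> kill i f \is d.-homog.
Proof. by apply: dhomog_sub => j; case: eqP; rewrite ?dhomog0 ?dhomogX1. Qed.

Lemma pihomogMl e k f g : f \is e.-homog ->
  pihomog mdeg (e + k) (f * g) = f * pihomog mdeg k g.
Proof.
move=> fe; rewrite {1}(pihomog_partitionE (leqnn (msize g))) mulr_sumr raddf_sum /=.
have h d : pihomog mdeg (e + k) (f * pihomog mdeg d g) =
    if d == k then f * pihomog mdeg k g else 0.
  rewrite (pihomogE_dhomog _ (dhomogM fe (pihomogP mdeg d g))) eqn_add2l.
  by case: eqP => [->|].
rewrite (eq_bigr (fun d : 'I_ _ => if (d : nat) == k then f * pihomog mdeg k g else 0));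
  last by move=> d _; apply: h.
rewrite -big_mkcond /=; have [df|df] := ltnP k (msize g).
  by rewrite (big_pred1 (Ordinal df)) // => d; rewrite -val_eqE.
rewrite big1 => [|d /eqP ed]; last by have := ltn_ord d; rewrite ed ltnNge df.
rewrite (_ : pihomog mdeg k g = 0) ?mulr0 //.
rewrite pihomogE big_seq_cond big1 // => m /andP[/msize_mdeg_lt mf /eqP md].
by move: mf; rewrite /= md ltnNge df.
Qed.

Lemma pihomog_neq0 f : f != 0 -> exists d, pihomog mdeg d f != 0.
Proof.
move=> f0; apply: contrapT => /forallNP h; case/eqP: f0.
rewrite (pihomog_partitionE (leqnn (msize f))) big1 // => d _.
by have /negP/negPn/eqP := h d.
Qed.

Lemma dhomog_factor e d f g : f != 0 -> g != 0 -> f \is e.-homog ->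
  f * g \is d.-homog -> (e <= d)%N /\ g \is (d - e).-homog.
Proof.
move=> f0 g0 fe fgd.
have comp k : pihomog mdeg k g != 0 -> d = (e + k)%N.
  move=> gk; apply/eqP; apply: contraNT gk => ne.
  have := pihomogMl k g fe; rewrite (pihomogE_dhomog _ fgd) (negPf ne) => /esym/eqP.
  by rewrite mulf_eq0 (negPf f0).
have [k /comp dk] := pihomog_neq0 g0; rewrite {d}dk in comp fgd *.
rewrite leq_addr addKn; split=> //.
rewrite (pihomog_partitionE (leqnn (msize g))); apply: rpred_sum => j _.
have [->|/comp/addnI->] := eqVneq (pihomog mdeg j g) 0; first exact: dhomog0.
exact: pihomogP.
Qed.

Lemma dhomog0P f : f \is 0.-homog -> exists c, f = c%:MP.
Proof.
move=> /dhomogP f0; exists f@_0; apply/mpolyP => m; rewrite mcoeffC.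
have [->|m0] := eqVneq m 0%MM; first by rewrite mulr1.
rewrite mulr0; apply: memN_msupp_eq0; apply: contra m0 => /f0 /= md.
by rewrite -mdeg_eq0 md.
Qed.

Lemma dhomog_line d f w v :  f \is d.-homog ->
  sub (fun i => v i *: w) f = f.@[v] *: w ^+ d.
Proof.
move=> /dhomogP fd; rewrite mevalE scaler_suml sub.unlock /= /mmap !big_seq.
apply: eq_bigr => m /fd md; rewrite mul_mpolyC -scalerA; congr (_ *: _).
have {md}<- : mdeg m = d by []; rewrite /mmap1 mdegE.
apply: (big_rec3 (fun p c e => p = c *: w ^+ e)) => [|i p c e _ ->].
  by rewrite expr0 scale1r.
by rewrite exprZn -scalerAl -scalerAr scalerA exprD.
Qed.

End Substitution.
Arguments kill {K n} i.
Arguments killU {K n} i j.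
Arguments killUi {K n} i.
Arguments killUj {K n i j}.

Section BinaryForms.
Variables (K : closedFieldType) (i j k l : 'I_4).
Hypothesis Uijkl : uniq [:: i; j; k; l].
Local Notation R := {mpoly K[4]}.
Implicit Types (f g : R) (o : option K).

Lemma four_variables (a : 'I_4) : [\/ a = i, a = j, a = k | a = l].
Proof.
have : a \in [:: i; j; k; l].
  have [//|] := boolP (a \in _) => na.
  have : uniq [:: a; i; j; k; l] by rewrite cons_uniq na.
  by move/card_uniqP => /= h; have := max_card (mem [:: a; i; j; k; l]); rewrite h card_ord.
by rewrite !inE => /or4P[]/eqP e; [apply: Or41|apply: Or42|apply: Or43|apply: Or44].
Qed.

Lemma distinct_variables : [/\ i != j, i != k, i != l, j != k & j != l] /\ k != l.
Proof.
move: Uijkl; rewrite /= !inE !negb_or !andbT.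
by case/and3P=> /and3P[ij ik il] /andP[jk jl] kl.
Qed.

(** The linear forms in the last two variables up to a scalar, as a pencil whose
    point at infinity is None. *)
Definition line o : R := if o is Some c then 'X_k - c *: 'X_l else 'X_l.

Definition onto_line o : {rmorphism R -> R} :=
  sub (fun a => if o is Some c then if a == k then c *: 'X_l else 'X_a
                else if a == l then 0 else 'X_a).

Definition binary f : Prop := kill i f = f /\ kill j f = f.

Lemma line_homog o : line o \is 1.-homog.
Proof.
case: o => [c|]; last exact: dhomogX1.
by apply: rpredB; [|apply: dhomogZ]; apply: dhomogX1.
Qed.

Lemma binary_line o : binary (line o).
Proof.
have [[ij ik il jk jl] kl] := distinct_variables.
by case: o => [c|]; split; rewrite /= ?rmorphB ?[kill _ (_ *: _)]subZ /= ?/kill ?subZ ?subU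
  ?(eq_sym _ i) ?(eq_sym _ j) ?(negPf ik) ?(negPf il) ?(negPf jk) ?(negPf jl).
Qed.

Lemma onto_lineC o c : onto_line o c%:MP = c%:MP. Proof. exact: subC. Qed.

Lemma onto_line_line o : onto_line o (line o) = 0.
Proof.
have [_ kl] := distinct_variables.
case: o => [c|] /=; rewrite ?rmorphB /onto_line ?subZ !subU eqxx //.
by rewrite eq_sym (negPf kl) subrr.
Qed.

Lemma onto_line0P o f : onto_line o f = 0 <-> exists g, f = line o * g.
Proof.
split=> [e|[g ->]]; last by rewrite rmorphM onto_line_line mul0r.
suff : exists g, f - onto_line o f = line o * g by rewrite e subr0.
apply: (sub_mod (is_ideal_multiples (line o))) => a.
have z : exists h : R, 0 = line o * h by exists 0; rewrite mulr0.
case: o {e z} (z) => [c|] z; case: eqP => [->|_]; rewrite ?subrr ?subr0 //.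
  by exists 1; rewrite mulr1.
by exists 1; rewrite mulr1.
Qed.

Lemma line_neq0 o : line o != 0.
Proof.
have [_ kl] := distinct_variables.
case: o => [c|] /=; last exact: mpolyX_neq0.
apply: contraTneq (mpolyX_neq0 K (U_(k))%MM) => e.
have := congr1 (kill l) e; rewrite rmorphB /kill subZ !subU eqxx (negPf kl).
by rewrite scaler0 subr0 rmorph0 => ->; rewrite eqxx.
Qed.

Lemma line_prime o f g : (exists h, f * g = line o * h) ->
  (exists h, f = line o * h) \/ (exists h, g = line o * h).
Proof.
move=> /onto_line0P; rewrite rmorphM => /eqP; rewrite mulf_eq0.
by case/orP=> /eqP/onto_line0P; [left|right].
Qed.

Lemma binary_support f m : binary f -> m \in msupp f -> m i = 0%N /\ m j = 0%N.
Proof. by case=> /kill_fixP fi /kill_fixP fj mf; rewrite fi ?fj. Qed.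

Lemma mdeg_four (m : 'X_{1..4}) : mdeg m = (m i + m j + m k + m l)%N.
Proof.
rewrite mdegE (eq_bigl (mem [:: i; j; k; l])) => [|a].
  by rewrite -big_uniq //= !big_cons big_nil addn0 !addnA.
by have [] := four_variables a => ->; rewrite !inE eqxx ?orbT.
Qed.

Lemma multinom_eq (m m' : 'X_{1..4}) :
  m i = m' i -> m j = m' j -> m k = m' k -> m l = m' l -> m = m'.
Proof. by move=> *; apply/mnmP => a; case: (four_variables a) => ->. Qed.

Lemma binaryM f g : binary f -> binary g -> binary (f * g).
Proof. by case=> fi fj [gi gj]; split; rewrite rmorphM ?fi ?gi ?fj ?gj. Qed.

Lemma binary_cofactor f g : f != 0 -> binary f -> binary (f * g) -> binary g.
Proof.
move=> f0 [fi fj] []; rewrite !rmorphM fi fj.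
by move=> /(mulfI f0) gi /(mulfI f0) gj.
Qed.

(** A binary form splits off a linear factor: if the last variable does not
    divide it, setting that variable to 1 gives a nonconstant univariate
    polynomial, which has a root. *)
Lemma linear_factor d f : binary f -> f \is d.+1.-homog -> f != 0 ->
  exists o g, [/\ f = line o * g, binary g & g \is d.-homog].
Proof.
have [[ij ik il jk jl] kl] := distinct_variables.
move=> bf fd f0; suff [o [g fg]] : exists o g, f = line o * g.
  exists o, g; split=> //.
    by apply: (@binary_cofactor (line o)); rewrite ?line_neq0 -?fg //; apply: binary_line.
  have g0 : g != 0 by apply: contraNneq f0 => g0; rewrite fg g0 mulr0.
  have [] := dhomog_factor (line_neq0 o) g0 (line_homog o) (_ : _ \is d.+1.-homog).
    by rewrite -fg.
  by rewrite subSS subn0.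
have [fl|fl] := eqVneq (kill l f) 0.
  by exists None; apply/kill0P.
have [m0] : exists m0, (kill l f)@_m0 != 0.
  apply: contrapT => /forallNP h; case/eqP: fl; apply/mpolyP => m.
  by rewrite mcoeff0; apply/eqP/negPn/negP/h.
rewrite kill_coeff; case: (m0 l =P 0%N) => [m0l fm0|_]; last by rewrite eqxx.
have m0f : m0 \in msupp f by rewrite mcoeff_msupp.
have expo m : m \in msupp f -> [/\ m i = 0, m j = 0 & m k + m l = d.+1]%N.
  move=> mf; have [mi mj] := binary_support bf mf; split=> //.
  by have := dhomogP mdeg d.+1 f fd m mf; rewrite /= mdeg_four mi mj.
pose q := mmap polyC (fun a => if a == k then 'X else if a == l then 1 else 0) f : {poly K}.
have qE : q = \sum_(m <- msupp f) f@_m *: 'X^(m k).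
  rewrite /q /mmap big_seq [RHS]big_seq; apply: eq_bigr => m /expo[mi mj _].
  rewrite mul_polyC; congr (_ *: _); rewrite /mmap1 (bigD1 k) //= eqxx big1 ?mulr1 // => a ak.
  rewrite (negPf ak); have [e|e|e|e] := four_variables a; rewrite e.
  - by rewrite mi expr0.
  - by rewrite mj expr0.
  - by rewrite e eqxx in ak.
  - by rewrite eqxx expr1n.
have q_top : q`_d.+1 = f@_m0.
  have [mi0 mj0 mkl0] := expo _ m0f.
  rewrite qE coef_sum (bigD1_seq m0) ?msupp_uniq //= coefZ coefXn.
  have m0k : m0 k = d.+1 by rewrite -mkl0 m0l addn0.
  rewrite m0k.
  rewrite eqxx mulr1 big_seq_cond big1 ?addr0 // => m /andP[/expo[mi mj mkl] mm0].
  rewrite coefZ coefXn; case: eqP => [e|]; last by rewrite mulr0.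
  have ml : m l = 0%N by apply/eqP; rewrite -(eqn_add2l (m k)) mkl -e addn0.
  by case/eqP: mm0; apply: multinom_eq; rewrite ?mi ?mj ?ml -?e ?m0k.
have : size q != 1%N.
  apply/eqP => sq; case/eqP: fm0; rewrite -q_top nth_default // sq //.
move=> /closed_rootP[c /eqP qc]; exists (Some c); apply/onto_line0P.
pose v a := if a == k then c else if a == l then 1 else 0.
have -> : onto_line (Some c) f = sub (fun a => v a *: 'X_l) f.
  rewrite -{1}bf.1 -{1}bf.2.
  apply: (sub_ext (p := onto_line (Some c) \o (kill i \o kill j)) (q := sub _)) => [e|e|a] /=.
  - by rewrite !killC onto_lineC.
  - by rewrite subC.
  rewrite subU /v; have [e|e|e|e] := four_variables a; rewrite {a}e.
  - by rewrite (killUj ij) killUi rmorph0 (negPf ik) (negPf il) scale0r.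
  - by rewrite killUi !rmorph0 (negPf jk) (negPf jl) scale0r.
  - by rewrite !killUj 1?eq_sym // eqxx /onto_line subU eqxx.
  - rewrite !killUj 1?eq_sym //.
    by rewrite (negPf kl) eqxx scale1r /onto_line subU
      eq_sym (negPf kl).
rewrite (dhomog_line _ _ fd); suff -> : f.@[v] = q.[c] by rewrite qc scale0r.
have := @mpoly_morph_ext K 4 K (meval v)
   (horner_eval c \o mmap polyC (fun a => if a == k then 'X else if a == l then 1 else 0)) _ _ f.
apply=> [e|a] /=; rewrite /horner_eval; first by rewrite mevalC mmapC hornerC.
by rewrite mevalXU mmapU /v; case: ifP => _; rewrite ?hornerX //; case: ifP => _; rewrite ?hornerC.
Qed.

(** Peel off the linear factors of F: each of them divides a, since it does not
    divide G. *)
Lemma binary_coprime d F G a b :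
    binary F -> F \is d.-homog -> (F == 0) && (G == 0) = false ->
    (forall o F' G', F = line o * F' -> G = line o * G' -> False) ->
    (F = 0 -> exists2 c, c != 0 & G = c%:MP) ->
  a * G = b * F -> exists w, a = w * F /\ b = w * G.
Proof.
elim: d F a => [|d IH] F a bF Fd FG0 nocommon Fconst e.
  have [F0|F0] := eqVneq F 0.
    have [c c0 Gc] := Fconst F0; move: e; rewrite F0 mulr0 Gc => /eqP.
    rewrite mulf_eq0 mpolyC_eq0 (negPf c0) orbF => /eqP ->.
    exists (b * c^-1%:MP); rewrite mulr0 -mulrA -mpolyCM mulVf // mulr1.
    by split.
  have [c Fc] := dhomog0P Fd; rewrite Fc mpolyC_eq0 in F0.
  exists (a * c^-1%:MP); split; first by rewrite Fc -mulrA -mpolyCM mulVf // mulr1.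
  by rewrite mulrAC e Fc -mulrA -mpolyCM divff // mulr1.
have [F0|F0] := eqVneq F 0.
  by apply: (IH F a) => //; rewrite F0 dhomog0.
have [o [F' [FE bF' F'd]]] := linear_factor bF Fd F0.
have [|[a' aE]|[G' GE]] := @line_prime o a G.
- by exists (b * F'); rewrite e FE mulrCA.
- have F'0 : F' != 0 by apply: contraNneq F0 => F'0; rewrite FE F'0 mulr0.
  have [||||||w [a'w bw]] := IH F' a' => //.
  + by rewrite (negPf F'0).
  + move=> o' F'' G'' F'E GE; apply: (nocommon o' (line o * F'') G'') => //.
    by rewrite FE F'E mulrCA.
  + by move=> F'e; rewrite F'e eqxx in F'0.
  + by apply: (mulfI (line_neq0 o)); rewrite mulrA -aE e FE mulrCA.
  by exists w; split=> //; rewrite aE a'w FE mulrCA.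
by case: (nocommon o F' G').
Qed.

End BinaryForms.

(** * Unmixed ideals in the ring of a plane *)

Section PureIdeals.
Variables (K : closedFieldType) (i j k l : 'I_4).
Hypothesis Uijkl : uniq [:: i; j; k; l].
Local Notation R := {mpoly K[4]}.
Local Notation line := (@line K k l).
Local Notation onto := (@onto_line K k l).
Local Notation binary := (@binary K i j).
Implicit Types (f g u w c : R) (o : option K) (J : R -> Prop).

(** Unmixedness, as far as it is needed in the plane X_j = 0: the prime of
    height two of a line of the pencil is not strictly contained in the
    annihilator of an element modulo J. *)
Definition pure_on_lines J : Prop := forall o u w,
  J (line o * u) -> J (w * u) -> onto o (kill j w) <> 0 -> J u.

(** The shape that unmixed ideals of codimension one have in the factorial
    coordinate ring of the plane. *)
Definition plane_principal J : Prop := exists d,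
  [/\ d != 0, kill j d = d, d \is homog mdeg &
      forall f, J f <-> exists a b, f = 'X_j * a + d * b].

Lemma ideal_kill J f : is_ideal J -> J 'X_j -> J f <-> J (kill j f).
Proof.
move=> iJ JX; have [g e] := kill_diff j f; split=> Jf.
  by have := idealB iJ Jf (ideal_mulr g iJ JX); rewrite {1}e addrK.
by rewrite e; apply: idealD => //; apply: ideal_mulr.
Qed.

Lemma homogeneous_colon J e f : homogeneous_set J -> f \is e.-homog ->
  homogeneous_set (fun u => J (f * u)).
Proof. by move=> hJ fe d u /(hJ (e + d)%N); rewrite pihomogMl. Qed.

Lemma pure_colon J f : pure_on_lines J -> pure_on_lines (fun u => J (f * u)).
Proof. by move=> pJ o u w; rewrite [f * (_ * u)]mulrCA [f * (w * u)]mulrCA; apply: pJ. Qed.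

(** Peel off the linear factors of the binary form: each one either may be
    dropped or divides every element of J modulo X_j. *)
Lemma plane_principal_binary e c J :
    is_ideal J -> homogeneous_set J -> J 'X_j -> pure_on_lines J ->
    binary c -> c \is e.-homog -> c != 0 -> J c ->
  plane_principal J.
Proof.
elim: e c J => [|e IH] c J iJ hJ JX pJ bc ce c0 Jc.
  exists 1; split; rewrite ?oner_neq0 ?rmorph1 //.
    by apply/homogP; exists 0%N; exact: dhomog1.
  move=> f; split=> _; first by exists 0, f; rewrite mulr0 mul1r add0r.
  have [a ca] := dhomog0P ce; rewrite ca mpolyC_eq0 in c0.
  by rewrite -[f]mulr1 -(mpolyC1 _ K) -(mulVf c0) mpolyCM mulrA -ca; apply: ideal_mull.
have [o [c' [cE bc' c'e]]] := linear_factor Uijkl bc ce c0.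
have c'0 : c' != 0 by apply: contraNneq c0 => c'0; rewrite cE c'0 mulr0.
have [Jc'|Jc'] := pselect (J c'); first exact: (IH c').
have [d [d0 jd dh dP]] : plane_principal (fun u => J (line o * u)).
  apply: (IH c') => //; last by rewrite -cE.
  - exact: is_ideal_colon.
  - exact: homogeneous_colon (line_homog k l o).
  - exact: ideal_mull.
  - exact: pure_colon.
have [n dn] := homogP _ _ dh.
exists (line o * d); split.
- by rewrite mulf_neq0 // (line_neq0 Uijkl).
- by rewrite rmorphM jd (binary_line Uijkl o).2.
- by apply/homogP; exists (1 + n)%N; apply: dhomogM (line_homog k l o) dn.
move=> f; split=> [Jf|[a [b ->]]]; last first.
  apply: idealD => //; first exact: ideal_mulr.
  by rewrite -mulrA; apply/dP; exists 0, b; rewrite mulr0 add0r.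
have /(onto_line0P Uijkl)[g fg] : onto o (kill j f) = 0.
  apply: contrapT => /(pJ o c' f) h; apply: Jc'; apply: h; rewrite -?cE //.
  exact: ideal_mulr.
have [g' fE] := kill_diff j f.
have /dP[a [b gE]] : J (line o * g) by rewrite -fg; apply: (ideal_kill f iJ JX).1 Jf.
exists (g' + line o * a), b; rewrite fE fg gE; ring.
Qed.

(** An element that does not vanish on any of the lines is regular modulo X_j
    and a binary form; so the form can be cancelled. *)
Lemma cancel_binary e w d g :
    kill j d = d -> (forall o, onto o d <> 0) ->
    binary w -> w \is e.-homog -> w != 0 ->
    (exists a b, w * g = 'X_j * a + d * b) -> exists a b, g = 'X_j * a + d * b.
Proof.
move=> jd od; elim: e w => [|e IH] w bw we w0 [a [b wg]].
  have [s ws] := dhomog0P we; rewrite ws mpolyC_eq0 in w0.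
  exists (s^-1%:MP * a), (s^-1%:MP * b).
  rewrite !(mulrCA _ s^-1%:MP) -mulrDr -wg ws mulrA -mpolyCM mulVf // mpolyC1.
  by rewrite mul1r.
have [o [w' [wE bw' w'e]]] := linear_factor Uijkl bw we w0.
have w'0 : w' != 0 by apply: contraNneq w0 => w'0; rewrite wE w'0 mulr0.
apply: (IH w') => //.
have e1 : line o * kill j (w' * g) = d * kill j b.
  have := congr1 (kill j) wg; rewrite wE -mulrA rmorphM (binary_line Uijkl o).2 => ->.
  by rewrite rmorphD !rmorphM /= killUi mul0r add0r jd.
have /eqP : onto o d * onto o (kill j b) = 0.
  by rewrite -rmorphM -e1 rmorphM (onto_line_line Uijkl) mul0r.
rewrite mulf_eq0 => /orP[/eqP/od//|/eqP/(onto_line0P Uijkl)[b' bE]].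
have [g' ->] := kill_diff j (w' * g); exists g', b'; rewrite addrC; congr (_ + _).
by apply: (mulfI (line_neq0 Uijkl o)); rewrite e1 bE mulrCA.
Qed.

Lemma primitive_part n d : d \is n.-homog -> d != 0 -> kill j d = d ->
  exists c d', [/\ d = c * d', binary c, c \is homog mdeg, d' \is homog mdeg
    & kill j d' = d' /\ forall o, onto o d' <> 0].
Proof.
elim: n d => [|n IH] d dn d0 jd;
  have [od|/existsNP[o /contrapT/(onto_line0P Uijkl)[d1 dE]]] := pselect (forall o, onto o d <> 0).
- exists 1, d; split; rewrite ?mul1r //; first by split; rewrite rmorph1.
    by apply/homogP; exists 0%N; apply: dhomog1.
  by apply/homogP; exists 0%N.
- have d10 : d1 != 0 by apply: contraNneq d0 => d10; rewrite dE d10 mulr0.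
  have [] := dhomog_factor (line_neq0 Uijkl o) d10 (line_homog k l o) (_ : _ \is 0.-homog).
    by rewrite -dE.
  by [].
- exists 1, d; split; rewrite ?mul1r //; first by split; rewrite rmorph1.
    by apply/homogP; exists 0%N; apply: dhomog1.
  by apply/homogP; exists n.+1.
have d10 : d1 != 0 by apply: contraNneq d0 => d10; rewrite dE d10 mulr0.
have [] := dhomog_factor (line_neq0 Uijkl o) d10 (line_homog k l o) (_ : _ \is n.+1.-homog).
  by rewrite -dE.
rewrite subSS subn0 => _ d1n.
have jd1 : kill j d1 = d1.
  apply: (mulfI (line_neq0 Uijkl o)); rewrite -{1}(binary_line Uijkl o).2 -rmorphM.
  by rewrite -dE jd.
have [c [d' [d1E bc ch d'h od']]] := IH _ d1n d10 jd1.
exists (line o * c), d'; split=> //; first by rewrite dE d1E mulrA.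
  exact: binaryM (binary_line Uijkl o) bc.
have [m cm] := homogP _ _ ch.
by apply/homogP; exists (1 + m)%N; apply: dhomogM (line_homog k l o) cm.
Qed.

Definition deg_lt e f : Prop := forall m, m \in msupp f -> (m i < e)%N.

Lemma deg_lt0 f : deg_lt 0 f -> f = 0.
Proof.
move=> h; apply/eqP; rewrite -msupp_eq0; move: h; rewrite /deg_lt.
by case: (msupp f) => // m s h; have := h m (mem_head _ _).
Qed.

Lemma deg_lt_exists f : exists e, deg_lt e f.
Proof.
exists (msize f) => m /msize_mdeg_lt; apply: leq_ltn_trans.
by rewrite mdegE (bigD1 i) //= leq_addr.
Qed.

Lemma deg_ltB e f g : deg_lt e f -> deg_lt e g -> deg_lt e (f - g).
Proof. by move=> fe ge m /msuppB_le; rewrite mem_cat => /orP[/fe|/ge]. Qed.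

Lemma deg_ltM e r f g : (forall m, m \in msupp f -> m i <= r)%N ->
  deg_lt e g -> deg_lt (r + e) (f * g).
Proof.
move=> fr ge m /msuppM_le/allpairsP[[m1 m2] /= [/fr h1 /ge h2 ->]].
by rewrite mnmDE -addnS leq_add.
Qed.

Lemma deg_ltMl e f g : kill i f = f -> deg_lt e g -> deg_lt e (f * g).
Proof. by move=> /kill_fixP fi; apply: (@deg_ltM e 0) => m /fi ->. Qed.

(** Separate the terms of the highest possible degree e in X_i. *)
Lemma top_coefficient e f : deg_lt e.+1 f -> exists a b,
  [/\ f = 'X_i ^+ e * a + b, kill i a = a, deg_lt e b,
      kill j f = f -> kill j a = a & forall d, f \is d.-homog -> a \is (d - e).-homog].
Proof.
move=> fe; pose a := \sum_(m <- msupp f | m i == e) f@_m *: 'X_[(m - U_(i) *+ e)%MM] : R.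
have killa h : (forall m, m \in msupp f -> m i = e -> (m - U_(i) *+ e)%MM h = 0)%N -> kill h a = a.
  move=> mh; rewrite /a rmorph_sum /= big_seq_cond [RHS]big_seq_cond.
  by apply: eq_bigr => m /andP[mf /eqP me]; rewrite subZ -/(kill h _) killX mh // eqxx.
have Xa : 'X_i ^+ e * a = \sum_(m <- msupp f | m i == e) f@_m *: 'X_[m].
  rewrite /a mulr_sumr; apply: eq_bigr => m /eqP me.
  rewrite -scalerAr mpolyXn -mpolyXD addmC submK //; apply/mnm_lepP => h.
  by rewrite mulmnE mnm1E; case: eqP => [<-|]; rewrite ?me ?mul1n ?mul0n.
exists a, (f - 'X_i ^+ e * a); split.
- by rewrite addrC subrK.
- by apply: killa => m _ me; rewrite mnmBE mulmnE mnm1E eqxx me mul1n subnn.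
- move=> m mb; have mf : m \in msupp f.
    move: mb => /msuppB_le; rewrite mem_cat => /orP[//|]; rewrite Xa => /msupp_sum_le.
    case/flattenP => _ /mapP[m' m'f ->] /msuppZ_le.
    by rewrite msuppX inE => /eqP ->; move: m'f; rewrite mem_filter => /andP[].
  have := fe m mf; rewrite ltnS leq_eqVlt => /orP[/eqP me|//].
  move: mb; rewrite mcoeff_msupp mcoeffB Xa raddf_sum /= big_mkcond.
  rewrite (bigD1_seq m) ?msupp_uniq //= me eqxx mcoeffZ mcoeffX eqxx mulr1.
  rewrite big1 ?addr0 ?subrr ?eqxx // => m' /negPf m'm; case: ifP => // _.
  by rewrite mcoeffZ mcoeffX m'm mulr0.
- move=> /kill_fixP jf; apply: killa => m /jf mj _.
  by rewrite mnmBE mj sub0n.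
move=> d /dhomogP fd; rewrite /a big_seq_cond; apply: rpred_sum => m /andP[/fd md /eqP me].
apply: dhomogZ; rewrite dhomogX /=; apply/eqP; rewrite -md -me.
have le : (U_(i) *+ m i <= m)%MM.
  by apply/mnm_lepP => h; rewrite mulmnE mnm1E; case: eqP => [<-|]; rewrite ?mul1n ?mul0n.
have dm : (mdeg (m - U_(i) *+ m i)%MM + m i = mdeg m)%N.
  by rewrite -[in RHS](submK le) mdegD mdegMn mdeg1 mul1n.
by rewrite -[LHS](addnK (m i)) dm.
Qed.

(** Pseudo-division by an element P of J, free of X_j and of least degree in
    X_i: a power of its leading coefficient multiplies J into (X_j, P). As J is
    pure, the primitive part of P divides J modulo X_j, and the quotient contains
    a binary form. *)
Theorem pure_plane_principal J :
    is_ideal J -> homogeneous_set J -> J 'X_j -> pure_on_lines J ->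
    (exists f, J f /\ kill j f <> 0) -> plane_principal J.
Proof.
move=> iJ hJ JX pJ [f0 [Jf0 jf0]].
have Jkill f : J f -> J (kill j f) by move=> Jf; exact: (ideal_kill f iJ JX).1 Jf.
have ex : exists e, `[< exists P, [/\ J P, kill j P = P, P != 0 & deg_lt e P] >].
  have [e de] := deg_lt_exists (kill j f0); exists e; apply/asboolP.
  by exists (kill j f0); split; rewrite ?killK //; [exact: Jkill | apply/eqP].
case: (ex_minnP ex) => e0 /asboolP[P1 [JP1 jP1 P10 dP1]] emin.
have [n P0] := pihomog_neq0 P10; set P := pihomog mdeg n P1 in P0.
have JP : J P by apply: hJ.
have jP : kill j P = P by rewrite /P -pihomog_kill jP1.
have dP : deg_lt e0 P.
  move=> m mP; apply: dP1; move: mP; rewrite mcoeff_msupp; apply: contraR => mP1.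
  rewrite /P pihomogE raddf_sum /= big_seq_cond big1 // => m' /andP[m'P1 _].
  by rewrite mcoeffZ mcoeffX; case: eqP => [e|_]; [rewrite -e m'P1 in mP1 | rewrite mulr0].
have Pn : P \is n.-homog by apply: pihomogP.
clearbody P.
case: e0 emin dP {dP1} => [_ /deg_lt0 P0'|e0 emin dP].
  by rewrite P0' eqxx in P0.
have [p [P' [PE ip dP' jp pn]]] := top_coefficient dP.
have {}jp := jp jP; have {}pn := pn _ Pn.
have jP' : kill j P' = P'.
  have -> : P' = P - 'X_i ^+ e0 * p by rewrite PE addrC addKr.
  have [[ij _ _ _ _] _] := distinct_variables Uijkl.
  by rewrite rmorphB rmorphM rmorphXn /= jP jp killUj.
have small g e : J g -> kill j g = g -> (e <= e0)%N -> deg_lt e g -> g = 0.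
  move=> Jg jg ee dg; apply/eqP; apply: contraT => g0.
  have : (e0.+1 <= e)%N by apply: emin; apply/asboolP; exists g.
  by rewrite ltnNge ee.
have p0 : p != 0.
  by apply: contraNneq P0 => p0; apply/eqP/(small P e0) => //; rewrite PE p0 mulr0 add0r.
have pdiv e g : J g -> kill j g = g -> deg_lt e g -> exists N q, p ^+ N * g = q * P.
  elim: e g => [|e IH] g Jg jg dg.
    by exists 0%N, 0; rewrite (deg_lt0 dg) mulr0 mul0r.
  have [lt|le] := ltnP e e0; first by exists 0%N, 0; rewrite (small g e.+1) // mulr0 mul0r.
  have [a [b [gE ia db ja _]]] := top_coefficient dg; have {}ja := ja jg.
  pose g1 := p * g - 'X_i ^+ (e - e0) * a * P.
  have [[ij _ _ _ _] _] := distinct_variables Uijkl.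
  have [N [q Nq]] : exists N q, p ^+ N * g1 = q * P.
    apply: IH.
    - by apply: idealB => //; apply: ideal_mull.
    - by rewrite rmorphB !rmorphM rmorphXn /= jp jg ja jP killUj.
    have -> : g1 = p * b - a * ('X_i ^+ (e - e0) * P').
      rewrite /g1 gE PE -{1}(subnK le) exprD; ring.
    apply: deg_ltB; first exact: deg_ltMl.
    apply: deg_ltMl => //; rewrite -{1}(subnK le); apply: deg_ltM => // m.
    by rewrite mpolyXn msuppX inE => /eqP->; rewrite mulmnE mnm1E eqxx mul1n.
  exists N.+1, (q + p ^+ N * ('X_i ^+ (e - e0) * a)).
  by rewrite mulrDl -Nq /g1 exprSr; ring.
have [c [d [PcE bc ch dh [jd od]]]] := primitive_part Pn P0 jP.
have c0 : c != 0 by apply: contraNneq P0 => c0; rewrite PcE c0 mul0r.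
have Jdiv f : J f -> exists a b, f = 'X_j * a + d * b.
  move=> Jf; have [e de] := deg_lt_exists (kill j f).
  have [N [q Nq]] := pdiv e _ (Jkill f Jf) (killK j f) de.
  have [|||a [b kf]] := @cancel_binary _ (p ^+ N) d (kill j f) jd od _ (dhomogMn N pn).
  - by split; rewrite rmorphXn /= ?ip ?jp.
  - exact: expf_neq0.
  - by exists 0, (q * c); rewrite Nq PcE; ring.
  have [g ->] := kill_diff j f; exists (a + g), b; rewrite kf; ring.
have [nd dnd] := homogP _ _ dh; have [nc cnc] := homogP _ _ ch.
have [r [r0 jr rh rP]] : plane_principal (fun u => J (d * u)).
  apply: (plane_principal_binary (e := nc) (c := c)) => //.
  - exact: is_ideal_colon.
  - exact: homogeneous_colon dnd.
  - exact: ideal_mull.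
  - exact: pure_colon.
  - by rewrite mulrC -PcE.
have d0 : d != 0 by apply: contraNneq P0 => d0; rewrite PcE d0 mulr0.
have [nr rnr] := homogP _ _ rh.
exists (d * r); split; first exact: mulf_neq0.
- by rewrite rmorphM jd jr.
- by apply/homogP; exists (nd + nr)%N; apply: dhomogM.
move=> f; split=> [Jf|[a [b ->]]]; last first.
  apply: idealD => //; first exact: ideal_mulr.
  by rewrite -mulrA; apply/rP; exists 0, b; rewrite mulr0 add0r.
have [a [b fE]] := Jdiv f Jf.
have /rP[a' [b' bE]] : J (d * b).
  by have := idealB iJ Jf (ideal_mulr a iJ JX); rewrite fE addrC addKr.
exists (a + d * a'), b'; rewrite fE bE; ring.
Qed.

End PureIdeals.

(** * Curves on a union of two planes *)

Section SmallGeneratingSets.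
Variable A : comNzRingType.
Implicit Types (a b c d f : A).

Lemma ideal_gen2 a b f :
  ideal_gen [:: a; b] f <-> exists u v, f = u * a + v * b.
Proof.
split=> [/ideal_gen_cons[u [_ [/ideal_gen_cons[v [_ [/ideal_gen_nil-> ->]]] ->]]]|[u [v ->]]].
  by exists u, v; rewrite addr0.
have h := is_ideal_gen [:: a; b].
by apply: idealD => //; apply: ideal_mull => //; apply: mem_ideal_gen; rewrite !inE eqxx ?orbT.
Qed.

Lemma ideal_gen3 a b c f :
  ideal_gen [:: a; b; c] f <-> exists u v w, f = u * a + v * b + w * c.
Proof.
split=> [/ideal_gen_cons[u [_ [/ideal_gen2[v [w ->]] ->]]]|[u [v [w ->]]]].
  by exists u, v, w; rewrite addrA.
by rewrite -addrA; apply/ideal_gen_cons; exists u, (v * b + w * c); split=> //;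
  apply/ideal_gen2; exists v, w.
Qed.

Lemma ideal_gen4 a b c d f : ideal_gen [:: a; b; c; d] f <->
  exists u v w z, f = u * a + v * b + w * c + z * d.
Proof.
split=> [/ideal_gen_cons[u [_ [/ideal_gen3[v [w [z ->]]] ->]]]|[u [v [w [z ->]]]]].
  by exists u, v, w, z; rewrite !addrA.
rewrite -!addrA; apply/ideal_gen_cons; exists u, (v * b + (w * c + z * d)); split=> //.
by apply/ideal_gen3; exists v, w, z; rewrite addrA.
Qed.

(** The consequence of purity that the classification uses: a function whose
    annihilator modulo I has height at least three lies in I. *)
Definition codim_two_pure (I : A -> Prop) : Prop := forall (p q : A -> Prop) u w,
  is_prime p -> is_prime q -> (exists2 a, p a & a != 0) ->
  (forall f, p f -> q f) -> (exists2 b, q b & ~ p b) ->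
  (forall f, q f -> I (f * u)) -> I (w * u) -> ~ q w -> I u.

End SmallGeneratingSets.

Section ResidualData.
Variables (K : closedFieldType) (i j : 'I_4).
Local Notation R := {mpoly K[4]}.

(** The curve decomposes into the plane curve X_j = P = 0, residual to the plane
    X_i = 0, and the trace X_i = S = 0 on that plane, both being complete
    intersections; and three equations suffice. *)
Definition residual_plane_curves (I : R -> Prop) : Prop := exists P S,
  [/\ [/\ P != 0, kill j P = P, S != 0 & kill i S = S],
      (forall f, I ('X_i * f) <-> exists a b, f = 'X_j * a + P * b),
      (forall f, (exists g, I (f - 'X_i * g)) <-> exists a b, f = 'X_i * a + S * b)
    & exists s, size s = 3 /\ forall f, I f <-> ideal_gen s f].

Lemma residual_three_generators I P S :
    P != 0 -> kill j P = P -> S != 0 -> kill i S = S -> i != j ->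
    (forall f, I ('X_i * f) <-> exists a b, f = 'X_j * a + P * b) ->
    (forall f, I f <-> ideal_gen [:: 'X_i * 'X_j; 'X_i * P; 'X_j * S] f) ->
  residual_plane_curves I.
Proof.
move=> P0 jP S0 iS ij IP Igen; exists P, ('X_j * S); split=> //.
- split=> //; first by rewrite mulf_neq0 ?mpolyX_neq0.
  by rewrite rmorphM iS killUj // eq_sym.
- move=> f; split=> [[g /Igen/ideal_gen3[u [v [w e]]]]|[a [b ->]]].
    exists (u * 'X_j + v * P + g), w; rewrite -[LHS](subrK ('X_i * g)) e; ring.
  by exists a; apply/Igen/ideal_gen3; exists 0, 0, b; ring.
- by exists [:: 'X_i * 'X_j; 'X_i * P; 'X_j * S].
Qed.

(** When the quotient on one plane is the constant c, the last generator carries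
    the equation S, so that the generator X_j S becomes redundant. *)
Lemma residual_constant I P S c q :
    P != 0 -> kill j P = P -> S != 0 -> kill i S = S -> c != 0 ->
    (forall f, I ('X_i * f) <-> exists a b, f = 'X_j * a + P * b) ->
    (forall f, I f <-> exists u v w z, f = u * ('X_i * 'X_j) + v * ('X_i * P)
        + w * ('X_j * S) + z * (c%:MP * S + 'X_i * q)) ->
  residual_plane_curves I.
Proof.
move=> P0 jP S0 iS c0 IP Igen.
have cV : c^-1%:MP * c%:MP = 1 :> R by rewrite -mpolyCM mulVf // mpolyC1.
exists P, S; split=> //.
  move=> f; split=> [[g /Igen[u [v [w [z e]]]]]|[a [b ->]]].
    exists (u * 'X_j + v * P + z * q + g), (w * 'X_j + z * c%:MP).
    rewrite -[LHS](subrK ('X_i * g)) e; ring.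
  exists (a - c^-1%:MP * b * q); apply/Igen; exists 0, 0, 0, (c^-1%:MP * b).
  transitivity ('X_i * (c^-1%:MP * b * q) + S * b * 1); first by ring.
  rewrite -cV; ring.
exists [:: 'X_i * 'X_j; 'X_i * P; c%:MP * S + 'X_i * q]; split=> // f.
split=> [/Igen[u [v [w [z ->]]]]|/ideal_gen3[u [v [w ->]]]]; last first.
  by apply/Igen; exists u, v, 0, w; ring.
apply/ideal_gen3; exists (u - c^-1%:MP * w * q), v, (z + c^-1%:MP * w * 'X_j).
transitivity (u * ('X_i * 'X_j) + v * ('X_i * P) + w * ('X_j * S) * 1
   + z * (c%:MP * S + 'X_i * q)); first by ring.
rewrite -cV; ring.
Qed.

End ResidualData.

Section Classification.
Variables (K : closedFieldType) (i j k l : 'I_4).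
Hypothesis Uijkl : uniq [:: i; j; k; l].
Local Notation R := {mpoly K[4]}.
Local Notation x := ('X_i : R).
Local Notation y := ('X_j : R).
Local Notation line := (@line K k l).
Local Notation onto := (@onto_line K k l).
Local Notation binary := (@binary K i j).
Variable I : R -> Prop.
Hypotheses (iI : is_ideal I) (hI : homogeneous_set I) (pI : codim_two_pure I).
Hypothesis Ixy : I (x * y).

Lemma kernel_mono (p q : {rmorphism R -> R}) f : p f = 0 -> (q \o p) f = 0.
Proof. by move=> /= ->; rewrite rmorph0. Qed.

Lemma colon_pure_on_lines : pure_on_lines j k l (fun u => I (x * u)).
Proof.
have [[ij ik il jk jl] kl] := distinct_variables Uijkl.
move=> o u w Jl Jw ow; pose q : {rmorphism R -> R} := onto o \o kill j.
have pK (p : {rmorphism R -> R}) := is_prime_ker p.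
apply: (pI (u := x * u) (p := fun f => kill j f = 0) (q := fun f => q f = 0) (w := w)) => //.
- by exists y; rewrite ?killUi // mpolyX_neq0.
- by move=> f; apply: kernel_mono.
- exists (line o).
    by rewrite /q /= (binary_line Uijkl o).2 (onto_line_line Uijkl).
  by rewrite (binary_line Uijkl o).2; apply/eqP; rewrite (line_neq0 Uijkl).
- move=> f /= /(onto_line0P Uijkl)[g fg]; have [g' ->] := kill_diff j f.
  rewrite fg mulrDl; apply: idealD => //.
    have -> : line o * g * (x * u) = g * (x * (line o * u)) by ring.
    exact: ideal_mull.
  have -> : y * g' * (x * u) = g' * u * (x * y) by ring.
  exact: ideal_mull.
by rewrite mulrCA.
Qed.

Lemma pure_on_axis u w : I (x * u) -> I (y * u) -> I (w * u) ->
  kill i (kill j w) <> 0 -> I u.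
Proof.
have [[ij _ _ _ _] _] := distinct_variables Uijkl.
move=> Ix Iy Iw w0; pose q : {rmorphism R -> R} := kill i \o kill j.
have pK (p : {rmorphism R -> R}) := is_prime_ker p.
apply: (pI (p := fun f => kill j f = 0) (q := fun f => q f = 0) (w := w)) => //.
- by exists y; rewrite ?killUi // mpolyX_neq0.
- by move=> f; apply: kernel_mono.
- exists x; first by rewrite /q /= killUj // killUi.
  by rewrite killUj //; apply/eqP/mpolyX_neq0.
move=> f /= /kill0P[g fg]; have [g' ->] := kill_diff j f.
rewrite fg mulrDl; apply: idealD => //.
  by rewrite mulrAC; apply: ideal_mulr.
by rewrite mulrAC; apply: ideal_mulr.
Qed.

Lemma colon_plane_principal :
  (exists f, I (x * f) /\ kill j f <> 0) ->
  plane_principal j (fun u => I (x * u)).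
Proof.
apply: (pure_plane_principal Uijkl) => //.
- exact: is_ideal_colon.
- exact: homogeneous_colon (dhomogX1 _ _).
- exact: colon_pure_on_lines.
Qed.

End Classification.

(** The equations of the curves that are not arithmetically Cohen-Macaulay, with
    P = x A + h F and S = y B + h G the equations of the plane curves residual to
    the two planes. *)
Record rao_form (K : closedFieldType) (i j k l : 'I_4) (I : {mpoly K[4]} -> Prop)
    (A B F G h : {mpoly K[4]}) : Prop := RaoForm {
  rf_binF : binary i j F; rf_binG : binary i j G; rf_binh : binary i j h;
  rf_F0 : F != 0; rf_G0 : G != 0;
  rf_homF : exists m, F \is m.+1.-homog; rf_homG : exists m, G \is m.+1.-homog;
  rf_homA : A \is homog mdeg; rf_homB : B \is homog mdeg; rf_homh : h \is homog mdeg;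
  rf_A : kill j A = A; rf_B : kill i B = B;
  rf_P0 : 'X_i * A + h * F != 0; rf_S0 : 'X_j * B + h * G != 0;
  rf_homP : 'X_i * A + h * F \is homog mdeg;
  rf_homS : 'X_j * B + h * G \is homog mdeg;
  rf_homf : 'X_i * A * G + 'X_j * B * F + h * F * G \is homog mdeg;
  rf_lines : forall o F' G', F = line k l o * F' -> G = line k l o * G' -> False;
  rf_coprime : forall a b, a * G = b * F -> exists w, a = w * F /\ b = w * G;
  rf_gen : forall f, I f <->
    ideal_gen [:: 'X_i * 'X_j; 'X_i ^+ 2 * A + 'X_i * h * F;
                  'X_j ^+ 2 * B + 'X_j * h * G;
                  'X_i * A * G + 'X_j * B * F + h * F * G] f;
  rf_colon : forall f, I ('X_i * f) <-> exists a b, f = 'X_j * a + ('X_i * A + h * F) * b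
}.

Section Structure.
Variables (K : closedFieldType) (i j k l : 'I_4).
Hypothesis Uijkl : uniq [:: i; j; k; l].
Local Notation R := {mpoly K[4]}.
Local Notation x := ('X_i : R).
Local Notation y := ('X_j : R).
Local Notation line := (@line K k l).
Local Notation binary := (@binary K i j).
Variables (I : R -> Prop) (P S A B P0 S0 : R).
Hypotheses (iI : is_ideal I) (hI : homogeneous_set I) (pI : codim_two_pure I).
Hypothesis Ixy : I (x * y).
Hypotheses (nzP : P != 0) (jP : kill j P = P) (homP : P \is homog mdeg).
Hypotheses (nzS : S != 0) (iS : kill i S = S) (homS : S \is homog mdeg).
Hypothesis IP : forall f, I (x * f) <-> exists a b, f = y * a + P * b.
Hypothesis IS : forall f, I (y * f) <-> exists a b, f = x * a + S * b.
Hypotheses (P0E : P0 = kill i P) (PE : P = P0 + x * A).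
Hypotheses (S0E : S0 = kill j S) (SE : S = S0 + y * B).

(** The pairs (a, b) of binary forms for which some element of I restricts to a
    multiple of S with quotient a on the plane x = 0, and to a multiple of P with
    quotient b on the plane y = 0, modulo y and x respectively; glue a b is such
    an element. *)
Definition glue a b : R := S * a + P * b - S0 * a.

Definition glueable a b : Prop :=
  [/\ binary a, binary b, S0 * a = P0 * b & I (glue a b)].

Lemma xP_mem : I (x * P).
Proof. by apply/IP; exists 0, 1; ring. Qed.

Lemma yS_mem : I (y * S).
Proof. by apply/IS; exists 0, 1; ring. Qed.

Lemma x_glue a b : I (x * glue a b).
Proof.
have -> : x * glue a b = x * y * (B * a) + x * P * b.
  by rewrite /glue {1}SE; ring.
by apply: idealD => //; apply: ideal_mulr => //; apply: xP_mem.
Qed.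

Lemma y_glue a b : S0 * a = P0 * b -> I (y * glue a b).
Proof.
move=> e; have -> : y * glue a b = y * S * a + x * y * (A * b).
  by rewrite /glue e {1}PE; ring.
by apply: idealD => //; apply: ideal_mulr => //; apply: yS_mem.
Qed.

Lemma kill_binary a : binary a -> kill i (kill j a) = a.
Proof. by case=> ia ->. Qed.

Lemma binary_P0 : binary P0.
Proof. by split; rewrite P0E ?killK // kill_comm jP. Qed.

Lemma glueable_cancel w a b : w != 0 -> binary w -> binary a -> binary b ->
  glueable (w * a) (w * b) -> glueable a b.
Proof.
move=> w0 bw ba bb [_ _ e Ie]; have {}e : S0 * a = P0 * b.
  by apply: (mulfI w0); rewrite mulrCA e mulrCA.
split=> //; apply: (pure_on_axis Uijkl iI pI (w := w) (x_glue _ _) (y_glue e)); last first.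
  by rewrite (kill_binary bw); apply/eqP; exact: w0.
by move: Ie; congr I; rewrite /glue; ring.
Qed.

(** An element f of I restricts to a multiple of S on x = 0, because y f lies in
    I and so in (x, S), and likewise to a multiple of P on y = 0. *)
Lemma glue_decomposition f : I f -> exists a b,
  glueable a b /\ exists c u v, f = c * (x * y) + u * (x * P) + v * (y * S) + glue a b
  /\ forall d, f \is d.-homog -> S * a \is d.-homog /\ P * b \is d.-homog.
Proof.
have [[ij _ _ _ _] _] := distinct_variables Uijkl.
move=> If.
have [u1 fu] : exists u, kill i f = S * kill i u.
  have /IS[a [u e]] : I (y * f) by apply: ideal_mull.
  by exists u; rewrite e rmorphD !rmorphM /= killUi iS mul0r add0r.
have [v1 fv] : exists v, kill j f = P * kill j v.
  have /IP[a [v e]] : I (x * f) by apply: ideal_mull.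
  by exists v; rewrite e rmorphD !rmorphM /= killUi jP mul0r add0r.
pose u := kill i u1; pose v := kill j v1.
rewrite -/u in fu; rewrite -/v in fv.
have iu : kill i u = u by rewrite killK.
have jv : kill j v = v by rewrite killK.
have [u' uE] := kill_diff j u; have [v' vE] := kill_diff i v.
pose a := kill j u; pose b := kill i v; rewrite -/a in uE; rewrite -/b in vE.
have ba : binary a by split; rewrite /a ?killK // kill_comm iu.
have bb : binary b by split; rewrite /b ?killK // kill_comm jv.
have ab : S0 * a = P0 * b.
  by rewrite S0E P0E /a /b -!rmorphM -fu -fv kill_comm.
have [g1 fE] := kill_diff i f; have [g2 g1E] := kill_diff j g1.
have fjE : kill j f = S0 * a + x * kill j g1.
  by rewrite {1}fE rmorphD rmorphM /= fu rmorphM /= killUj // S0E.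
have fE' : f = g2 * (x * y) + v' * (x * P) + u' * (y * S) + glue a b.
  have e : x * kill j g1 = P * v - S0 * a by rewrite -fv fjE addrC addKr.
  have -> : f = S * u + x * kill j g1 + x * (y * g2).
    by rewrite {1}fE fu {1}g1E; ring.
  by rewrite e {1}uE {1}vE /glue; ring.
exists a, b; split.
  split=> //; have : I (f - (g2 * (x * y) + v' * (x * P) + u' * (y * S))).
    apply: idealB => //; do 2?apply: idealD => //; apply: ideal_mull => //.
      exact: xP_mem.
    exact: yS_mem.
  by congr I; rewrite fE'; ring.
exists g2, v', u'; split=> // d fd.
have homog_part (T w : R) h : T != 0 -> T \is homog mdeg -> T * w \is d.-homog ->
    T * kill h w \is d.-homog.
  move=> nzT /homogP[e Te] Twd.
  have [->|w0] := eqVneq w 0; first by rewrite rmorph0 mulr0 dhomog0.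
  have [ed wd] := dhomog_factor nzT w0 Te Twd.
  by rewrite -(subnKC ed); apply: dhomogM => //; apply: dhomog_kill.
split; apply: homog_part => //; first by rewrite -fu; apply: dhomog_kill.
by rewrite -fv; apply: dhomog_kill.
Qed.

Lemma generated_by_components (s : seq R) :
    (forall f, ideal_gen s f -> I f) ->
    (forall d f, f \is d.-homog -> I f -> ideal_gen s f) ->
  forall f, I f <-> ideal_gen s f.
Proof.
move=> sI Is f; split=> [If|]; last exact: sI.
rewrite (pihomog_partitionE (leqnn (msize f))).
apply: ideal_sum (is_ideal_gen s) _ => d _.
exact: (Is d) (pihomogP _ _ _) (hI _ If).
Qed.

(** Eliminating between the two gluings gives one of the form (w, 0). For w
    nonzero purity would put S in I; when S vanishes on the axis, its proper
    divisor S / y would then lie in I : y = (x, S). *)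
Lemma glueable_proportional a b F G : glueable a b -> glueable F G -> a * G = b * F.
Proof.
have [[ij _ _ _ _] _] := distinct_variables Uijkl.
move=> [ba bb ab Iab] [bF bG FG IFG].
have [P00|P00] := eqVneq P0 0; last first.
  by apply: (mulfI P00); rewrite mulrCA -FG [RHS]mulrA -ab; ring.
have [S00|S00] := eqVneq S0 0; last first.
  by apply: (mulfI S00); rewrite [LHS]mulrA ab [RHS]mulrCA FG; ring.
apply/eqP; rewrite -subr_eq0; apply: contraT => w0.
(* As S0 = P0 = 0, the pair (w, 0) glues to w * S for w = a * G - b * F. *)
have IS1 : I S.
  apply: (pure_on_axis Uijkl iI pI (w := a * G - b * F)).
  - by rewrite SE S00 add0r mulrA; apply: ideal_mulr.
  - exact: yS_mem.
  - have -> : (a * G - b * F) * S = G * glue a b - b * glue F G.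
      by rewrite /glue S00; ring.
    by apply: idealB => //; apply: ideal_mull.
  rewrite kill_binary; first exact/eqP.
  by split; rewrite rmorphB !rmorphM ?ba.1 ?ba.2 ?bb.1 ?bb.2 ?bF.1 ?bF.2 ?bG.1 ?bG.2.
have BE : S = y * B by rewrite {1}SE S00 add0r.
have iB : kill i B = B.
  apply: (mulfI (mpolyX_neq0 K (U_(j))%MM)); rewrite -[in RHS]BE -[in RHS]iS BE.
  by rewrite rmorphM killUj // eq_sym.
have /IS[c [e Be]] : I (y * B) by rewrite -BE.
have B0 : B != 0 by apply: contraNneq nzS => B0; rewrite BE B0 mulr0.
have BS : B = S * kill i e.
  by rewrite -{1}iB {1}Be rmorphD !rmorphM /= killUi iS mul0r add0r.
have : B * 1 = B * (y * kill i e) by rewrite mulr1 {1}BS BE; ring.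
move=> /(mulfI B0)/(congr1 (kill j))/eqP.
by rewrite rmorph1 rmorphM killUi mul0r oner_eq0.
Qed.

Lemma zero_glue_residual :
  (forall d a b, glueable a b -> S * a \is d.-homog -> P * b \is d.-homog ->
     a = 0 /\ b = 0) ->
  residual_plane_curves i j I.
Proof.
have [[ij _ _ _ _] _] := distinct_variables Uijkl.
move=> N0; apply: (residual_three_generators nzP jP nzS iS ij IP).
apply: generated_by_components => [f /ideal_gen3[u [v [w ->]]]|d f fd If].
  do 2?apply: idealD => //; apply: ideal_mull => //; [exact: xP_mem | exact: yS_mem].
have [a [b [Nab [c [u [v [fE hom]]]]]]] := glue_decomposition If.
have [Sa Pb] := hom d fd; have [a0 b0] := N0 d a b Nab Sa Pb.
apply/ideal_gen3; exists c, u, v; rewrite fE a0 b0 /glue; ring.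
Qed.

(** In a pair of least degree the two forms have no common linear factor: by
    purity along the axis it could be cancelled. *)
Lemma glueable_minimal :
  (exists d a b, [/\ glueable a b, S * a \is d.-homog, P * b \is d.-homog
                   & ~ (a = 0 /\ b = 0)]) ->
  exists d F G, [/\ glueable F G, S * F \is d.-homog, P * G \is d.-homog,
    ~ (F = 0 /\ G = 0) &
    forall o F' G', F = line o * F' -> G = line o * G' -> False].
Proof.
case=> d0 ex0.
have ex : exists d, `[< exists a b, [/\ glueable a b, S * a \is d.-homog,
    P * b \is d.-homog & ~ (a = 0 /\ b = 0)] >] by exists d0; apply/asboolP.
case: (ex_minnP ex) => d /asboolP[F [G [NFG SF PG FG0]]] dmin.
exists d, F, G; split=> // o F' G' FE GE.
have lower T T' : T * (line o * T') \is d.-homog -> T * T' != 0 ->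
    (0 < d)%N /\ T * T' \is d.-1.-homog.
  rewrite mulrCA => h T0; have [] := dhomog_factor (line_neq0 Uijkl o) T0 (line_homog k l o) h.
  by rewrite subn1.
rewrite FE in SF; rewrite GE in PG.
have d0' : (0 < d)%N.
  have [F'0|F'0] := eqVneq F' 0.
    have G'0 : G' != 0.
      by apply/eqP => G'0; apply: FG0; rewrite FE GE F'0 G'0 !mulr0.
    by have [] := lower _ _ PG (mulf_neq0 nzP G'0).
  by have [] := lower _ _ SF (mulf_neq0 nzS F'0).
have low T T' : T * (line o * T') \is d.-homog -> T * T' \is d.-1.-homog.
  have [->|T0 h] := eqVneq (T * T') 0; first by rewrite dhomog0.
  by have [] := lower _ _ h T0.
have bl := binary_line Uijkl o.
have [bF bG _ _] := NFG; rewrite FE in bF; rewrite GE in bG.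
have bF' := binary_cofactor (line_neq0 Uijkl o) bl bF.
have bG' := binary_cofactor (line_neq0 Uijkl o) bl bG.
have : (d <= d.-1)%N; last by rewrite leqNgt ltn_predL d0'.
apply: dmin; apply/asboolP; exists F', G'; split; [|exact: low|exact: low|].
  by apply: (@glueable_cancel (line o)) => //; rewrite -?FE -?GE // (line_neq0 Uijkl).
by case=> F'0 G'0; apply: FG0; rewrite FE GE F'0 G'0 !mulr0.
Qed.

Lemma cofactor_homog (T a : R) d : T != 0 -> T \is homog mdeg -> T * a \is d.-homog ->
  exists m, a \is m.-homog.
Proof.
move=> T0 /homogP[e Te] Ta; have [->|a0] := eqVneq a 0.
  by exists 0%N; rewrite dhomog0.
by have [_ h] := dhomog_factor T0 a0 Te Ta; exists (d - e)%N.
Qed.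

Lemma no_line_constant (F G : R) m :
  (forall o F' G', F = line o * F' -> G = line o * G' -> False) ->
  binary G -> G \is m.-homog -> G != 0 -> F = 0 -> exists2 c, c != 0 & G = c%:MP.
Proof.
move=> nol bG Gm G0 F0; case: m Gm => [/dhomog0P[c Gc]|m Gm].
  by exists c; rewrite // -(mpolyC_eq0 4) -Gc.
have [o [g [Gg _ _]]] := linear_factor Uijkl bG Gm G0.
by case: (nol o 0 g) => //; rewrite mulr0.
Qed.

(** The gluing pairs form a saturated module of rank at most one over the binary
    forms. It is zero, or generated by a pair (F, G) in which F or G is constant,
    or by a pair of coprime forms of positive degree. *)
Theorem classification_of_equations :
  [\/ residual_plane_curves i j I, residual_plane_curves j i I
    | exists A' B' F G h, rao_form i j k l I A' B' F G h].
Proof.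
have [[ij _ _ _ _] _] := distinct_variables Uijkl.
have [/glueable_minimal[d [F [G [NFG SF PG FG0 nol]]]]|N0] := pselect
  (exists d a b, [/\ glueable a b, S * a \is d.-homog, P * b \is d.-homog
                   & ~ (a = 0 /\ b = 0)]); last first.
  apply: Or31; apply: zero_glue_residual => d a b Nab Sa Pb.
  by apply: contrapT => ab0; apply: N0; exists d, a, b.
have [bF bG SPFG Iglue] := NFG.
have [m Fm] := cofactor_homog nzS homS SF; have [m' Gm'] := cofactor_homog nzP homP PG.
have nol' o F' G' : G = line o * F' -> F = line o * G' -> False.
  by move=> h h'; apply: (nol o G' F').
have cop a b : a * G = b * F -> exists w, a = w * F /\ b = w * G.
  apply: (binary_coprime Uijkl bF Fm) => //.
    by apply/negP => /andP[/eqP F0 /eqP G0]; apply: FG0.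
  move=> F0; apply: (no_line_constant nol bG Gm' _ F0).
  by apply/eqP => G0; apply: FG0.
have glueZ w a b : glue (w * a) (w * b) = w * glue a b by rewrite /glue; ring.
have Igen f : I f <-> ideal_gen [:: x * y; x * P; y * S; glue F G] f.
  apply: generated_by_components f => [f /ideal_gen4[u [v [w [z ->]]]]|e f fe If].
    by do 3?apply: idealD => //; apply: ideal_mull => //; [exact: xP_mem | exact: yS_mem].
  have [a [b [Nab [c [u [v [fE _]]]]]]] := glue_decomposition If.
  have [w [aE bE]] := cop a b (glueable_proportional Nab NFG).
  by apply/ideal_gen4; exists c, u, v, w; rewrite fE aE bE glueZ.
have glueE : glue F G = S * F + x * (A * G).
  by rewrite /glue SPFG {1}PE; ring.
have glueE' : glue F G = P * G + y * (B * F).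
  by rewrite /glue {1}SE; ring.
have [F0|F0] := eqVneq F 0.
  have G0 : G != 0 by apply/eqP => G0; apply: FG0.
  have [c c0 Gc] := no_line_constant nol bG Gm' G0 F0.
  apply: Or32; apply: (residual_constant nzS iS nzP jP c0 IS (q := B * F)) => f.
  rewrite Igen; split=> [/ideal_gen4[u [v [w [z ->]]]]|[u [v [w [z ->]]]]].
    by exists u, w, v, z; rewrite glueE' Gc; ring.
  by apply/ideal_gen4; exists u, w, v, z; rewrite glueE' Gc; ring.
have [G0|G0] := eqVneq G 0.
  have [c c0 Fc] := no_line_constant nol' bF Fm F0 G0.
  apply: Or31; apply: (residual_constant nzP jP nzS iS c0 IP (q := A * G)) => f.
  rewrite Igen; split=> [/ideal_gen4[u [v [w [z ->]]]]|[u [v [w [z ->]]]]].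
    by exists u, v, w, z; rewrite glueE Fc; ring.
  by apply/ideal_gen4; exists u, v, w, z; rewrite glueE Fc; ring.
case: m Fm => [/dhomog0P[c Fc]|m Fm].
  have c0 : c != 0 by rewrite -(mpolyC_eq0 4) -Fc.
  apply: Or31; apply: (residual_constant nzP jP nzS iS c0 IP (q := A * G)) => f.
  rewrite Igen; split=> [/ideal_gen4[u [v [w [z ->]]]]|[u [v [w [z ->]]]]].
    by exists u, v, w, z; rewrite glueE Fc; ring.
  by apply/ideal_gen4; exists u, v, w, z; rewrite glueE Fc; ring.
case: m' Gm' => [/dhomog0P[c Gc]|m' Gm'].
  have c0 : c != 0 by rewrite -(mpolyC_eq0 4) -Gc.
  apply: Or32; apply: (residual_constant nzS iS nzP jP c0 IS (q := B * F)) => f.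
  rewrite Igen; split=> [/ideal_gen4[u [v [w [z ->]]]]|[u [v [w [z ->]]]]].
    by exists u, w, v, z; rewrite glueE' Gc; ring.
  by apply/ideal_gen4; exists u, w, v, z; rewrite glueE' Gc; ring.
(* The gluing condition S0 * F = P0 * G for coprime F and G. *)
have [h [P0h S0h]] := cop P0 S0 (esym SPFG).
have PE' : P = x * A + h * F by rewrite PE P0h addrC.
have SE' : S = y * B + h * G by rewrite SE S0h addrC.
have bP0 := binary_P0.
have bh : binary h.
  by apply: (binary_cofactor F0 bF); rewrite mulrC -P0h.
have hom_cofactor (T g : R) : T != 0 -> T \is homog mdeg -> T * g \is homog mdeg ->
    g \is homog mdeg.
  move=> T0 Th /homogP[e Tg]; have [n gn] := cofactor_homog T0 Th Tg.
  by apply/homogP; exists n.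
have hom_kill h' (f : R) : f \is homog mdeg -> kill h' f \is homog mdeg.
  by move=> /homogP[e fe]; apply/homogP; exists e; apply: dhomog_kill.
have hom_diff h' (f : R) : f \is homog mdeg -> f - kill h' f \is homog mdeg.
  by move=> /homogP[e fe]; apply/homogP; exists e; rewrite rpredB // dhomog_kill.
have homX h' : ('X_h' : R) \is homog mdeg by apply/homogP; exists 1%N; exact: dhomogX1.
have xA : x * A = P - kill i P by rewrite -P0E {1}PE addrC addKr.
have yB : y * B = S - kill j S by rewrite -S0E {1}SE addrC addKr.
apply: Or33; exists A, B, F, G, h; split=> //.
- by exists m.
- by exists m'.
- by apply: (hom_cofactor x) => //; rewrite ?mpolyX_neq0 // xA hom_diff.
- by apply: (hom_cofactor y) => //; rewrite ?mpolyX_neq0 // yB hom_diff.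
- apply: (hom_cofactor F) => //; first by apply/homogP; exists m.+1.
  by rewrite mulrC -P0h P0E hom_kill.
- apply: (mulfI (mpolyX_neq0 K (U_(i))%MM)).
  by rewrite -[in LHS](killUj ij) -rmorphM xA rmorphB /= jP -kill_comm jP.
- apply: (mulfI (mpolyX_neq0 K (U_(j))%MM)).
  have ji : j != i by rewrite eq_sym.
  by rewrite -[in LHS](killUj ji) -rmorphM yB rmorphB /= iS -kill_comm iS.
- by rewrite -PE'.
- by rewrite -SE'.
- by rewrite -PE'.
- by rewrite -SE'.
- have -> : x * A * G + y * B * F + h * F * G = glue F G.
    by rewrite glueE SE'; ring.
  apply/homogP; exists d; rewrite /glue; apply: rpredB; first exact: rpredD.
  by rewrite S0E -bF.2 -rmorphM; apply: dhomog_kill.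
- move=> f; rewrite Igen.
  have -> : x * P = x ^+ 2 * A + x * h * F by rewrite PE'; ring.
  have -> : y * S = y ^+ 2 * B + y * h * G by rewrite SE'; ring.
  have -> // : glue F G = x * A * G + y * B * F + h * F * G by rewrite glueE SE'; ring.
- by move=> f; rewrite -PE'.
Qed.

End Structure.

(** Purity first provides the equations P and S of the two residual curves. *)
Theorem classification (K : closedFieldType) (i j k l : 'I_4)
    (I : {mpoly K[4]} -> Prop) :
    uniq [:: i; j; k; l] ->
    is_ideal I -> homogeneous_set I -> codim_two_pure I -> I ('X_i * 'X_j) ->
    (exists f, I ('X_i * f) /\ kill j f <> 0) ->
    (exists f, I ('X_j * f) /\ kill i f <> 0) ->
  [\/ residual_plane_curves i j I, residual_plane_curves j i I
    | exists A B F G h, rao_form i j k l I A B F G h].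
Proof.
move=> U iI hI pI Ixy exj exi.
have U' : uniq [:: j; i; k; l].
  by move: U; rewrite /= !inE !negb_or [i == j]eq_sym; do !case: (_ == _).
have Iyx : I ('X_j * 'X_i) by rewrite mulrC.
have [P [P0 jP homP IP]] := colon_plane_principal U iI hI pI Ixy exj.
have [S [S0 iS homS IS]] := colon_plane_principal U' iI hI pI Iyx exi.
have [A PE] := kill_diff i P; have [B SE] := kill_diff j S.
exact: (classification_of_equations U iI hI pI Ixy P0 jP homP S0 iS homS IP IS
          (erefl _) PE (erefl _) SE).
Qed.

(** * Arithmetically Cohen-Macaulay curves *)

Section RegularSequences.
Variable A : comNzRingType.
Implicit Types (I J p q : A -> Prop) (a b u x : A).

Lemma adjoin_comm J a b f : adjoin (adjoin J a) b f -> adjoin (adjoin J b) a f.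
Proof.
move=> [_ [c [[j [d [Jj ->]]] ->]]]; exists (j + c * b), d; split; last by ring.
by exists j, c.
Qed.

Lemma regular_mod_ext J J' a : (forall f, J f <-> J' f) ->
  regular_mod J a -> regular_mod J' a.
Proof. by move=> e h u /e/h/e. Qed.

Lemma adjoin_ext J J' a f : (forall f, J f <-> J' f) -> adjoin J a f <-> adjoin J' a f.
Proof. by move=> e; split=> -[j [c [/e Jj ->]]]; exists j, c. Qed.

(** Exchange: modulo the prime q the elements a and P form a regular sequence in
    this order, hence a stays regular after P. *)
Lemma regular_exchange q a P : is_prime q -> ~ q a ->
  is_prime (adjoin q a) -> ~ adjoin q a P -> regular_mod (adjoin q P) a.
Proof.
move=> [iq _ pq] qa [iqa _ pqa] qaP u [j [w [qj e]]].
have : adjoin q a (w * P).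
  exists (- j), u; split; first exact: idealN.
  by rewrite [u * a]mulrC e addKr.
move=> /pqa[[j' [w' [qj' ew]]]|//].
have : q (a * (u - w' * P)).
  have -> : a * (u - w' * P) = j + j' * P.
    by rewrite mulrBr e ew; ring.
  by apply: idealD => //; apply: ideal_mulr.
move=> /pq[//|qu]; exists (u - w' * P), w'; split=> //; by rewrite subrK.
Qed.

(** From 0 -> A/(I : x) -> A/I -> A/(I + x) -> 0, a sequence of two elements that
    is regular on both ends is regular in the middle. *)
Lemma regular_extension I x a b : is_ideal I ->
    regular_mod (fun u => I (x * u)) a -> regular_mod (adjoin I x) a ->
    regular_mod (adjoin (fun u => I (x * u)) a) b ->
    regular_mod (adjoin (adjoin I x) a) b ->
  regular_mod I a /\ regular_mod (adjoin I a) b.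
Proof.
move=> iI rJa rTa rJb rTb; split=> u.
  move=> Iau; have [j [v [Ij uE]]] := rTa u (sub_adjoin x Iau).
  have Iv : I (x * v).
    apply: rJa; have -> : x * (a * v) = a * u - a * j by rewrite uE; ring.
    by apply: idealB => //; apply: ideal_mull.
  by rewrite uE [v * x]mulrC; apply: idealD.
move=> [j [w [Ij e]]].
have [_ [w' [[j' [v [Ij' ->]]] uE]]] : adjoin (adjoin I x) a u.
  by apply: rTb; exists j, w; split=> //; apply: sub_adjoin.
have [j1 [w1 [Ij1 w1E]]] : adjoin I x (w - b * w').
  apply: rTa; exists (b * j' - j), (b * v).
  split; first by apply: idealB => //; apply: ideal_mull.
  have -> : a * (w - b * w') = (b * u - j) - a * b * w' by rewrite e; ring.
  by rewrite uE; ring.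
have [j2 [v2 [Ij2 vE]]] : adjoin (fun u => I (x * u)) a v.
  apply: rJb; exists (b * v - w1 * a), w1; split; last by ring.
  have -> : x * (b * v - w1 * a) = j - b * j' + a * j1.
    have : w = b * w' + (j1 + w1 * x) by rewrite -w1E; ring.
    move=> wE; have : b * (j' + v * x + w' * a) = j + w * a by rewrite -uE.
    rewrite wE => h; have {h} -> : j = b * (j' + v * x + w' * a) - (b * w' + (j1 + w1 * x)) * a.
      by rewrite h; ring.
    by ring.
  apply: idealD => //; last exact: ideal_mull.
  by apply: idealB => //; apply: ideal_mull.
exists (j' + x * j2), (w' + v2 * x); split; first exact: idealD.
by rewrite uE vE; ring.
Qed.

Lemma maximal_prime (M : idealr A) : noeth A -> maximal_ideal M ->
  is_prime (fun f => f \in M).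
Proof.
move=> nA maxM; have iM := ideal_idealr M.
have [|||P [pP MP _]] := prime_avoiding nA iM (S := fun a => a = 1).
- by [].
- by move=> _ _ -> ->; rewrite mulr1.
- by move=> _ -> ; rewrite idealr1.
have [iP P1 Pp] := pP; have [I IP] := idealr_of iP P1.
have IM : I =i M by apply: maxM => f fM; apply/IP/MP.
have MP' f : f \in M <-> P f by rewrite -IM.
split=> //; first by rewrite idealr1.
by move=> a b /MP'/Pp[h|h]; [left | right]; apply/MP'.
Qed.

(** A ring in which dimension and depth are at most two is Cohen-Macaulay as soon
    as every maximal ideal contains a regular sequence of length two, because
    such a sequence gives a chain of primes of the same length. *)
Theorem cohen_macaulay_of_regular_pairs : noeth A ->
    (forall (p : nat -> prime_idealr A) n,
       (forall m, (m < n)%N -> strict_sub (p m) (p m.+1)) -> (n <= 2)%N) ->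
    (forall s : seq A, regular_sequence s -> (size s <= 2)%N) ->
    (forall M : idealr A, maximal_ideal M -> exists a b, [/\ a \in M, b \in M,
       regular_mod (fun f => f = 0) a & regular_mod (adjoin (fun f => f = 0) a) b]) ->
  cohen_macaulay A.
Proof.
move=> nA chain_le seq_le pair; split; first exact: noetherianP.
move=> M maxM; exists 2%N; have [a [b [aM bM ra rb]]] := pair M maxM.
have pM := maximal_prime nA maxM; have [iM M1 _] := pM.
have i0 : is_ideal (fun f : A => f = 0).
  by split=> [|u v -> ->|c u ->]; rewrite ?addr0 ?mulr0.
split; split.
- exists [:: a; b]; split=> //.
    by move=> c; rewrite !inE => /orP[] /eqP->.
  split; last first.
    move=> h; apply: M1; apply: ideal_gen_sub iM _ h => c.
    by rewrite !inE => /orP[] /eqP->.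
  case=> [_ u|[_ u|//]] /=; first by move=> /ideal_gen_nil/ra ->; apply/ideal_gen_nil.
  have e f : ideal_gen [:: a] f <-> adjoin (fun f => f = 0) a f.
    split=> [/ideal_gen_cons[c [g [/ideal_gen_nil-> ->]]]|[g [c [-> ->]]]].
      by exists 0, c; rewrite addr0 add0r.
    by apply/ideal_gen_cons; exists c, 0; rewrite addrC; split=> //; apply/ideal_gen_nil.
  by move=> /e/rb/e.
- by move=> n [s [<- _ /seq_le]].
- have [p1 [pp1 sub1 p1M p1b]] := prime_avoiding_regular nA (is_ideal_adjoin a i0) pM
    (fun f => adjoin_sub (f := f) iM (fun g e => eq_ind_r (fun g => g \in M) (idealr0 M) e) aM) rb.
  have p1a : p1 a by apply: sub1; apply: mem_adjoin.
  have p1_0 f : f = 0 -> p1 f by move=> ->; case: pp1 => /ideal0.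
  have [p0 [pp0 _ p01 p0a]] := prime_avoiding_regular nA i0 pp1 p1_0 ra.
  have [P0 P0E] := prime_idealr_of pp0; have [P1 P1E] := prime_idealr_of pp1.
  have [P2 P2E] := prime_idealr_of pM.
  exists (fun m => match m with 0%N => P0 | 1%N => P1 | _ => P2 end); split.
    case=> [_|[_|//]]; split=> /=.
    + by move=> f /P0E/p01/P1E.
    + by move=> h; apply: p0a; apply/P0E/h/P1E.
    + by move=> f /P1E/p1M/P2E.
    + by move=> h; apply: p1b; apply/P1E/h/P2E.
  by move=> f; apply/idP/idP => /P2E.
- by move=> n [p [/chain_le]].
Qed.

End RegularSequences.

Section Residual.
Variables (K : closedFieldType) (i j k l : 'I_4).
Hypothesis Uijkl : uniq [:: i; j; k; l].
Local Notation R := {mpoly K[4]}.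
Variables (A : comNzRingType) (pr : {rmorphism R -> A}).
Hypothesis pr_surj : forall a, exists f, pr f = a.

(** Preimages of primes containing a variable and an element outside the ideal
    of that variable: their coheight is at most two, as they sit above the
    chain of 0 and the ideal of the variable. *)
Lemma no_long_chain_above_plane (h : 'I_4) T (p : nat -> prime_idealr A) :
  pr 'X_h \in p 0%N -> pr T \in p 0%N -> kill h T <> 0 ->
  ~ (forall m, (m < 3)%N -> strict_sub (p m) (p m.+1)).
Proof.
move=> hp Tp hT strict.
have lift m : (m < 3)%N -> exists f, pr f \in p m.+1 /\ ~ pr f \in p m.
  move=> /strict[_ h']; apply: contrapT => /forallNP none; apply: h' => a ap.
  have [f fa] := pr_surj a; apply: contrapT => nap.
  by apply: (none f); rewrite fa.
have [b0 [b0p b0n]] := lift 0%N isT; have [b1 [b1p b1n]] := lift 1%N isT.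
have [b2 [b2p b2n]] := lift 2%N isT.
have sub m : (m < 3)%N -> {subset p m <= p m.+1} by move=> /strict[].
have reg m f : ~ pr f \in p m -> regular_mod (fun g => pr g \in p m) f.
  by move=> nf u; rewrite rmorphM prime_idealrM => /orP[].
pose J (m : nat) : R -> Prop := match m with
  | 0%N => fun f => f = 0 | 1%N => fun f => kill h f = 0 | m'.+2 => fun f => pr f \in p m' end.
have iJ m : is_ideal (J m).
  case: m => [|[|m]] /=; first by split=> [|a b -> ->|c a ->]; rewrite ?addr0 ?mulr0.
    by case: (is_prime_ker (kill h : {rmorphism R -> R})).
  split=> [|a b|c a]; rewrite ?rmorph0 ?rmorphD ?rmorphM.
  - exact: rpred0.
  - exact: rpredD.
  - exact: idealMr.
have := @chain_unit K 4 [tuple 'X_h; T; b0; b1; b2] J iJ.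
rewrite /= rmorph1 idealr1 => contra; suff : false by []; apply: contra.
case=> [[|[|[|[|[|//]]]]] lt]; rewrite (tnth_nth 0) /=; split=> //.
- by move=> f ->; rewrite rmorph0.
- exact: killUi.
- by move=> u /eqP; rewrite mulf_eq0 (negPf (mpolyX_neq0 _ _)) => /eqP.
- by move=> f /kill0P[g ->]; rewrite rmorphM mulrC; apply: idealMr.
- move=> u; rewrite rmorphM => /eqP; rewrite mulf_eq0 => /orP[/eqP/hT//|/eqP//].
- by move=> f; apply: sub.
- exact: reg.
- by move=> f; apply: sub.
- exact: reg.
- by move=> f; apply: sub.
- exact: reg.
Qed.

Local Notation I := (fun f : R => pr f = 0).
Variables (P S : R).
Hypothesis Ixy : pr ('X_i * 'X_j) = 0.
Hypotheses (P0 : P != 0) (jP : kill j P = P) (S0 : S != 0) (iS : kill i S = S).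
Hypothesis IP : forall f, pr ('X_i * f) = 0 <-> exists a b, f = 'X_j * a + P * b.
Hypothesis IS : forall f,
  (exists g, pr (f - 'X_i * g) = 0) <-> exists a b, f = 'X_i * a + S * b.

Lemma is_ideal_kernel : is_ideal I.
Proof.
split=> [|a b|c a]; rewrite ?rmorph0 ?rmorphD ?rmorphM // => ->.
  by move=> ->; rewrite addr0.
by rewrite mulr0.
Qed.

Lemma residual_chain_le (p : nat -> prime_idealr A) n :
  (forall m, (m < n)%N -> strict_sub (p m) (p m.+1)) -> (n <= 2)%N.
Proof.
move=> strict; rewrite leqNgt; apply/negP => n3.
have {}strict m : (m < 3)%N -> strict_sub (p m) (p m.+1).
  by move=> m3; apply: strict; apply: leq_trans n3.
have : pr 'X_i * pr 'X_j \in p 0%N by rewrite -rmorphM Ixy rpred0.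
rewrite prime_idealrM => /orP[xp|yp].
  have [g e] : exists g, pr (S - 'X_i * g) = 0 by apply/IS; exists 0, 1; ring.
  apply: (@no_long_chain_above_plane i S p xp) => //; last by rewrite iS; exact/eqP.
  have -> : pr S = pr g * pr 'X_i.
    by apply/eqP; rewrite mulrC -rmorphM -subr_eq0 -rmorphB e.
  exact: idealMr.
apply: (@no_long_chain_above_plane j ('X_i * P) p yp) => //.
  by rewrite (_ : pr _ = 0) ?rpred0 //; apply/IP; exists 0, 1; ring.
have [[ij _ _ _ _] _] := distinct_variables Uijkl.
by rewrite rmorphM killUj // jP; apply/eqP/mulf_neq0 => //; apply: mpolyX_neq0.
Qed.

Lemma from_varM (n r : nat) (Q Q' : {mpoly K[n]}) :
  from_var r Q -> from_var r Q' -> from_var r (Q * Q').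
Proof.
move=> fQ fQ' m /msuppM_le/allpairsP[[m1 m2] /= [/fQ h1 /fQ' h2 ->]] a ar.
by rewrite mnmDE h1 ?h2.
Qed.

Lemma from_var_ext (n r : nat) (s s' : n.-tuple R) (Q : {mpoly K[n]}) :
  from_var r Q -> (forall a : 'I_n, (r <= a)%N -> tnth s a = tnth s' a) ->
  Q \mPo s = Q \mPo s'.
Proof.
move=> fQ ss'; rewrite /comp_mpoly /mmap big_seq [RHS]big_seq.
apply: eq_bigr => m /fQ mQ; congr (_ * _); apply: eq_bigr => a _.
by have [/ss'->|/mQ->] := leqP r a; rewrite ?expr0.
Qed.

(** Eliminate X_h and T from an algebraic relation between five elements of
    K[4]: the three others satisfy a relation modulo (X_h, T). *)
Lemma relation_mod_plane (h : 'I_4) T (b : 3.-tuple R) (J : R -> Prop) :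
    kill h T <> 0 -> is_ideal J -> J 'X_h -> J T ->
  exists Q : {mpoly K[5]}, [/\ Q != 0, from_var 2 Q &
    J (Q \mPo [tuple of 'X_h :: T :: b])].
Proof.
move=> hT iJ Jh JT; set s := [tuple of _].
have [Q [Q0 Qs]] := algebraic_dependence s.
have i0 : is_ideal (fun f : R => f = 0).
  by split=> [|u v -> ->|c u ->]; rewrite ?addr0 ?mulr0.
have ik : is_ideal (fun f : R => kill h f = 0).
  by case: (is_prime_ker (kill h : {rmorphism R -> R})).
have sE a : 'X_a \mPo s = nth 0 s a by rewrite comp_mpolyXU.
have [||||||Q1 [Q10 fQ1 sQ1]] := @eliminate_variable K 5 R (comp_mpoly s)
   (fun f => f = 0) (fun f => kill h f = 0) ord0 Q ik => //=.
- by move=> f ->; rewrite rmorph0.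
- by rewrite sE /= killUi.
- by move=> u; rewrite sE /= => /eqP; rewrite mulf_eq0 (negPf (mpolyX_neq0 _ _)) => /eqP.
have [||||||Q2 [Q20 fQ2 sQ2]] := @eliminate_variable K 5 R (comp_mpoly s)
   (fun f => kill h f = 0) J (lift ord0 ord0) Q1 iJ => //=.
- by move=> f /kill0P[g ->]; apply: ideal_mulr.
- by rewrite sE.
- by move=> u; rewrite sE /= rmorphM => /eqP; rewrite mulf_eq0 => /orP[/eqP/hT|/eqP].
by exists Q2.
Qed.

(** The product of a relation modulo I : X_i and one modulo I + (X_i) is a
    relation modulo I, which a regular sequence of length three excludes. *)
Lemma residual_regular_le (s : seq A) : regular_sequence s -> (size s <= 2)%N.
Proof.
case=> reg s1; rewrite leqNgt; apply/negP => s3.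
have /choice[b bs] : forall m, exists f, pr f = s`_m by move=> m; apply: pr_surj.
pose t := [tuple of [:: b 0%N; b 1%N; b 2%N]].
have iI := is_ideal_kernel.
have [||||] := @relation_mod_plane j P t (fun f => I ('X_i * f)).
- by rewrite jP; apply/eqP.
- exact: (is_ideal_colon 'X_i iI).
- exact: Ixy.
- by apply/IP; exists 0, 1; ring.
move=> Q1 [Q10 fQ1 IQ1].
have [||||] := @relation_mod_plane i S t (adjoin I 'X_i).
- by rewrite iS; apply/eqP.
- exact: is_ideal_adjoin.
- exact: mem_adjoin.
- have [g e] : exists g, pr (S - 'X_i * g) = 0 by apply/IS; exists 0, 1; ring.
  by exists (S - 'X_i * g), g; split=> //; ring.
move=> Q2 [Q20 fQ2 [r [g [Ir Q2E]]]].
pose J m : R -> Prop := fun f => ideal_gen (take (m - 2) s) (pr f).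
have iJ m : is_ideal (J m).
  have [h0 hD hM] := is_ideal_gen (take (m - 2) s).
  split=> [|u v|c u]; rewrite /J ?rmorph0 ?rmorphD ?rmorphM //; [exact: hD | exact: hM].
suff : J 5 1.
  rewrite /J rmorph1 => h; apply: s1; apply: ideal_gen_sub_seq h => a.
  exact: mem_take.
pose u := [tuple of 'X_j :: P :: t].
have uE (a : 'I_5) : (2 <= a)%N -> pr ('X_a \mPo u) = s`_(a - 2).
  rewrite comp_mpolyXU; case: a => [[|[|[|[|[|//]]]]] lt] //= _; exact: bs.
apply: (relation_unit (ev := comp_mpoly u) (r := 2) (Q := Q1 * Q2) (J := J)) => //.
- move=> a a2; have as3 : (a - 2 < size s)%N.
    by apply: leq_trans s3; case: a a2 => [[|[|[|[|[|//]]]]] lt].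
  have tk : take (a.+1 - 2) s = rcons (take (a - 2) s) s`_(a - 2).
    by rewrite subSn // (take_nth 0).
  rewrite /J tk; split=> [f|| f].
  + by apply: ideal_gen_sub_seq => c; rewrite mem_rcons inE orbC => ->.
  + by rewrite uE //; apply: mem_ideal_gen; rewrite mem_rcons mem_head.
  + by rewrite rmorphM uE //; apply: reg.
- exact: mulf_neq0.
- exact: from_varM.
rewrite /J /= take0; apply/ideal_gen_nil.
have -> : comp_mpoly u (Q1 * Q2) = (Q1 \mPo u) * (Q2 \mPo u) by rewrite rmorphM.
rewrite (from_var_ext (s := u) (s' := [tuple of 'X_i :: S :: t]) fQ2); last first.
  by case=> [[|[|[|[|[|//]]]]] lt]; rewrite ?(tnth_nth 0).
rewrite Q2E mulrDr rmorphD !rmorphM Ir mulr0 add0r.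
have e : pr (Q1 \mPo u) * pr 'X_i = 0 by rewrite -rmorphM mulrC.
by rewrite mulrCA e mulr0.
Qed.

Lemma adjoin_ker s (J : R -> Prop) a : is_ideal J ->
    (forall m, adjoin J a ('X_m - s m)) -> (forall f, J f -> sub s f = 0) ->
    sub s a = 0 ->
  forall f, adjoin J a f <-> sub s f = 0.
Proof.
move=> iJ Js Jk ak f; split=> [[g [c [Jg ->]]]|e].
  by rewrite rmorphD rmorphM Jk // ak mulr0 addr0.
by have := sub_mod (is_ideal_adjoin a iJ) Js f; rewrite e subr0.
Qed.

Lemma is_prime_ext (B : comNzRingType) (p q : B -> Prop) :
  (forall f, p f <-> q f) -> is_prime p -> is_prime q.
Proof.
move=> e [[h0 hD hM] h1 hp]; split; first split.
- exact/e.
- by move=> a b /e pa /e pb; apply/e/hD.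
- by move=> c a /e pa; apply/e/hM.
- by move=> /e.
- by move=> a b /e/hp[] /e; [left | right].
Qed.

End Residual.

Section RegularPairs.
Variables (K : closedFieldType) (i j k l : 'I_4).
Hypothesis Uijkl : uniq [:: i; j; k; l].
Local Notation R := {mpoly K[4]}.
Variables (c : 'I_4 -> K) (m la mu : K).

(** Two planes through the point c; the first is parallel to the first two axes,
    and the second has a nonzero coefficient in the third variable. *)
Definition first_plane : R := 'X_l - (c l)%:MP - m *: ('X_k - (c k)%:MP).
Definition second_plane : R :=
  'X_k - (c k)%:MP + la *: ('X_i - (c i)%:MP) + mu *: ('X_j - (c j)%:MP).

Lemma eval_first v : first_plane.@[v] = v l - c l - m * (v k - c k).
Proof. by rewrite !(mevalB, mevalZ, mevalXU, mevalC). Qed.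

Lemma eval_second v :
  second_plane.@[v] = v k - c k + la * (v i - c i) + mu * (v j - c j).
Proof. by rewrite !(mevalD, mevalN, mevalZ, mevalXU, mevalC). Qed.

(** X_j and the two planes generate an increasing chain of primes, being kernels
    of linear substitutions; all of them vanish at v, where P does not. *)
Lemma regular_pair_on_plane (P : R) (v : 'I_4 -> K) :
    kill j P = P -> P.@[v] != 0 -> v j = 0 ->
    first_plane.@[v] = 0 -> second_plane.@[v] = 0 ->
  let J := adjoin (fun f => exists g, f = 'X_j * g) P in
  regular_mod J first_plane /\ regular_mod (adjoin J first_plane) second_plane.
Proof.
have [[ij ik il jk jl] kl] := distinct_variables Uijkl.
move=> jP Pv vj v1 v2 /=.
pose q0 (f : R) := exists g, f = 'X_j * g.
have iq0 : is_ideal q0 by apply: is_ideal_multiples.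
have pq0 : is_prime q0.
  apply: is_prime_ext (is_prime_ker (kill j : {rmorphism R -> R})) => f.
  exact: kill0P.
pose q1 := adjoin q0 first_plane; pose q2 := adjoin q1 second_plane.
have iq1 : is_ideal q1 by apply: is_ideal_adjoin.
have iq2 : is_ideal q2 by apply: is_ideal_adjoin.
pose kap : R := (c k)%:MP - la *: ('X_i - (c i)%:MP) + (mu * c j)%:MP.
pose s1 (a : 'I_4) : R := if a == j then 0 else
  if a == l then (c l)%:MP + m *: ('X_k - (c k)%:MP) else 'X_a.
pose s2 (a : 'I_4) : R := if a == j then 0 else
  if a == k then kap else
  if a == l then (c l)%:MP + m *: (kap - (c k)%:MP) else 'X_a.
have q1E : forall f, q1 f <-> sub s1 f = 0.
  apply: adjoin_ker => // [a|f [g ->]|].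
  - rewrite /s1; case: eqP => [->|_].
      by apply: sub_adjoin; exists 1; rewrite subr0 mulr1.
    case: eqP => [->|_]; last by rewrite subrr; apply: ideal0.
    by rewrite opprD addrA; apply: mem_adjoin.
  - by rewrite rmorphM subU /s1 eqxx mul0r.
  rewrite /first_plane !rmorphB /= !subZ !rmorphB /= !subC !subU /s1 eqxx.
  rewrite ![l == j]eq_sym ![k == j]eq_sym (negPf jk) (negPf jl) (negPf kl).
  by rewrite -!mul_mpolyC; ring.
have q2E : forall f, q2 f <-> sub s2 f = 0.
  have s2X : sub s2 first_plane = 0.
    rewrite /first_plane !rmorphB /= !subZ !rmorphB /= !subC !subU /s2 eqxx.
    rewrite ![l == j]eq_sym ![k == j]eq_sym ![l == k]eq_sym.
    rewrite (negPf jk) (negPf jl) (negPf kl) eqxx.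
    by rewrite -!mul_mpolyC; ring.
  have Xj : q2 'X_j by do 2!apply: sub_adjoin; exists 1; rewrite mulr1.
  have q2k : q2 ('X_k - kap).
    have -> : 'X_k - kap = second_plane - mu *: 'X_j.
      rewrite /kap /second_plane !scalerBr -!mul_mpolyC mpolyCM; ring.
    apply: idealB => //; first exact: mem_adjoin.
    by rewrite -mul_mpolyC; apply: ideal_mull.
  apply: adjoin_ker => // [a|f [g [d [[g' ->] ->]]]|].
  - rewrite /s2; case: eqP => [->|_]; first by rewrite subr0.
    case: eqP => [->//|_]; case: eqP => [->|_]; last by rewrite subrr; apply: ideal0.
    have -> : 'X_l - ((c l)%:MP + m *: (kap - (c k)%:MP))
        = first_plane + m%:MP * ('X_k - kap).
      rewrite /first_plane -!mul_mpolyC; ring.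
    apply: idealD => //; last exact: ideal_mull.
    by apply: sub_adjoin; apply: mem_adjoin.
  - by rewrite rmorphD !rmorphM s2X mulr0 addr0 subU /s2 eqxx mul0r.
  rewrite /second_plane -!mul_mpolyC !(rmorphD, rmorphN, rmorphM) /= !subC !subU /s2 !eqxx.
  rewrite ![k == j]eq_sym (negPf jk) (negPf ij) (negPf ik) (negPf il) /kap.
  by rewrite -!mul_mpolyC mpolyCM; ring.
have pq1 : is_prime q1.
  by apply: is_prime_ext (is_prime_ker (sub s1 : {rmorphism R -> R})) => f; rewrite q1E.
have pq2 : is_prime q2.
  by apply: is_prime_ext (is_prime_ker (sub s2 : {rmorphism R -> R})) => f; rewrite q2E.
have q0v w f : w j = 0 -> q0 f -> f.@[w] = 0.
  by move=> wj [g ->]; rewrite mevalM mevalXU wj mul0r.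
have q1v w f : w j = 0 -> first_plane.@[w] = 0 -> q1 f -> f.@[w] = 0.
  move=> wj w1 [g [d [q0g ->]]]; rewrite mevalD mevalM w1 mulr0 addr0.
  exact: q0v q0g.
have q2v w f : w j = 0 -> first_plane.@[w] = 0 -> second_plane.@[w] = 0 ->
    q2 f -> f.@[w] = 0.
  move=> wj w1 w2 [g [d [q1g ->]]]; rewrite mevalD mevalM w2 mulr0 addr0.
  exact: q1v q1g.
have q0first : ~ q0 first_plane.
  pose w a := if a == j then 0 else if a == l then c l + 1 else c a.
  move=> /(q0v w); rewrite /w eqxx eval_first ![l == j]eq_sym ![k == j]eq_sym.
  rewrite (negPf jl) (negPf jk) eqxx (negPf kl) subrr mulr0 subr0 addrC addKr.
  by move=> /(_ (erefl _))/eqP; rewrite oner_eq0.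
have q1second : ~ q1 second_plane.
  pose d := 1 + mu * c j.
  pose w a := if a == j then 0 else if a == l then c l + m * d
              else if a == k then c k + d else c a.
  have wj : w j = 0 by rewrite /w eqxx.
  have wi : w i = c i by rewrite /w (negPf ij) (negPf il) (negPf ik).
  have wk : w k = c k + d by rewrite /w eq_sym (negPf jk) (negPf kl) eqxx.
  have wl : w l = c l + m * d by rewrite /w eq_sym (negPf jl) eqxx.
  move=> /(q1v w) h; have /h/eqP : first_plane.@[w] = 0.
    by rewrite eval_first wk wl; ring.
  rewrite eval_second wi wj wk /d; have -> :
    c k + (1 + mu * c j) - c k + la * (c i - c i) + mu * (0 - c j) = 1 by ring.
  by move=> /(_ (erefl _)); rewrite oner_eq0.
have q1P : ~ q1 P by move=> /(q1v v) h; case/eqP: Pv; apply: h.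
have q2P : ~ q2 P by move=> /(q2v v) h; case/eqP: Pv; apply: h.
split; first exact: regular_exchange q1P.
apply: regular_mod_ext (regular_exchange pq1 q1second pq2 q2P) => f.
by split; apply: adjoin_comm.
Qed.

End RegularPairs.

Lemma meval_kill (K : fieldType) n (h : 'I_n) (f : {mpoly K[n]}) v :
  (kill h f).@[v] = f.@[fun a => if a == h then 0 else v a].
Proof.
have := @mpoly_morph_ext K n K (meval v \o kill h)
  (meval (fun a => if a == h then 0 else v a)) _ _ f.
apply=> [c|a] /=; first by rewrite killC !mevalC.
by rewrite killU mevalXU; case: ifP => _; rewrite ?meval0 ?mevalXU.
Qed.

(** At a point of the curve, two planes in general position through the point and
    through two auxiliary points off the plane curves, one in each of the two
    planes, are regular on both plane curves. *)
Theorem residual_cohen_macaulay (K : closedFieldType) (i j k l : 'I_4)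
    (A : comNzRingType) (pr : {rmorphism {mpoly K[4]} -> A}) :
    uniq [:: i; j; k; l] -> (forall a, exists f, pr f = a) ->
    pr ('X_i * 'X_j) = 0 -> residual_plane_curves i j (fun f => pr f = 0) ->
  cohen_macaulay A.
Proof.
move=> U surj Ixy [P [S [[P0 jP S0 iS] IP IS _]]].
have U' : uniq [:: j; i; k; l].
  by move: U; rewrite /= !inE !negb_or [i == j]eq_sym; do !case: (_ == _).
have [[ij ik il jk jl] kl] := distinct_variables U.
apply: cohen_macaulay_of_regular_pairs.
- exact: noeth_surj surj (@hilbert_basis K 4).
- exact: (residual_chain_le U surj Ixy P0 jP S0 iS IP IS).
- exact: (residual_regular_le surj Ixy P0 jP S0 iS IP IS).
move=> M maxM; have [c cM] := nullstellensatz surj maxM.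
have cij : c i * c j = 0.
  have /cM : pr ('X_i * 'X_j) \in M by rewrite Ixy rpred0.
  by rewrite mevalM !mevalXU.
have [p] : exists p, (('X_i - (c i)%:MP) * ('X_j - (c j)%:MP) *
    ('X_k - (c k)%:MP) * (P * S)).@[p] != 0.
  have nz (a : 'I_4) : 'X_a - (c a)%:MP != 0 :> {mpoly K[4]}.
    apply: contraTneq (oner_neq0 K) => /(congr1 (meval (fun b => c b + 1))).
    by rewrite mevalB mevalXU mevalC meval0 addrC addKr => ->; rewrite eqxx.
  by apply: mpoly_nonzero_value; rewrite !mulf_neq0.
rewrite !mevalM !mevalB !mevalXU !mevalC !mulf_eq0 !negb_or.
move=> /andP[/andP[/andP[pi pj] pk] /andP[Pp Sp]].
pose m := (p l - c l) / (p k - c k).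
pose D := (p i - c i) * (p j - c j).
(* The second plane has to contain the projections vj and vi of p to the planes
   X_j = 0 and X_i = 0; as c i * c j = 0, these two linear conditions on la and
   mu have determinant D. *)
pose la := - (p k - c k) * p j / D; pose mu := - (p k - c k) * p i / D.
have D0 : D != 0 by rewrite mulf_neq0.
pose a := first_plane k l c m; pose b := second_plane i j k c la mu.
have bE : b = second_plane j i k c mu la by rewrite /b /second_plane addrAC.
have on_a (v : 'I_4 -> K) : v l = p l -> v k = p k -> a.@[v] = 0.
  by move=> vl vk; rewrite eval_first vl vk /m divfK // subrr.
pose vj h := if h == j then 0 else p h; pose vi h := if h == i then 0 else p h.
have vj_j : vj j = 0 by rewrite /vj eqxx.
have vi_i : vi i = 0 by rewrite /vi eqxx.
have vj_l : vj l = p l by rewrite /vj eq_sym (negPf jl).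
have vj_k : vj k = p k by rewrite /vj eq_sym (negPf jk).
have vi_l : vi l = p l by rewrite /vi eq_sym (negPf il).
have vi_k : vi k = p k by rewrite /vi eq_sym (negPf ik).
have on_bj : b.@[vj] = 0.
  rewrite eval_second vj_k /vj eqxx (negPf ij).
  transitivity ((p k - c k) * (c i * c j) / D); last by rewrite cij mulr0 mul0r.
  rewrite /la /mu /D; field; exact/andP.
have on_bi : b.@[vi] = 0.
  rewrite eval_second vi_k /vi eqxx eq_sym (negPf ij).
  transitivity ((p k - c k) * (c i * c j) / D); last by rewrite cij mulr0 mul0r.
  rewrite /la /mu /D; field; exact/andP.
have Pvj : P.@[vj] != 0 by rewrite -meval_kill jP.
have Svi : S.@[vi] != 0 by rewrite -meval_kill iS.
have [rP rP'] := regular_pair_on_plane U jP Pvj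
  vj_j (on_a _ vj_l vj_k) on_bj.
have on_bi' : (second_plane j i k c mu la).@[vi] = 0 by rewrite -bE.
have [rS rS'] := regular_pair_on_plane U' iS Svi
  vi_i (on_a _ vi_l vi_k) on_bi'.
rewrite -bE in rS'; rewrite -/a -/b in rP rP' rS rS'.
pose I (f : {mpoly K[4]}) := pr f = 0; have iI : is_ideal I by apply: is_ideal_kernel.
have JE f : adjoin (fun f => exists g, f = 'X_j * g) P f <-> I ('X_i * f).
  rewrite /I IP; split=> [[_ [d [[g ->] ->]]]|[u [w ->]]].
    by exists g, d; rewrite [d * _]mulrC.
  by exists ('X_j * u), w; rewrite [w * _]mulrC; split=> //; exists u.
have TE f : adjoin (fun f => exists g, f = 'X_i * g) S f <-> adjoin I 'X_i f.
  have e : adjoin I 'X_i f <-> exists g, pr (f - 'X_i * g) = 0.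
    split=> [[g [d [Ig ->]]]|[g fg]]; first by exists d; rewrite [d * _]mulrC addrK.
    by exists (f - 'X_i * g), g; rewrite [g * _]mulrC subrK.
  rewrite e IS; split=> [[_ [d [[g ->] ->]]]|[u [w ->]]].
    by exists g, d; rewrite [d * _]mulrC.
  by exists ('X_i * u), w; rewrite [w * _]mulrC; split=> //; exists u.
have [ra rb] : regular_mod I a /\ regular_mod (adjoin I a) b.
  apply: (regular_extension (x := 'X_i)) => //.
  - exact: regular_mod_ext JE rP.
  - exact: regular_mod_ext TE rS.
  - by apply: regular_mod_ext rP' => f; apply: adjoin_ext.
  - by apply: regular_mod_ext rS' => f; apply: adjoin_ext.
exists (pr a), (pr b); split.
- by apply/cM; rewrite eval_first !subrr mulr0 subr0.
- by apply/cM; rewrite eval_second !subrr !mulr0 !addr0.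
- by move=> u; have [f <-] := surj u; rewrite -rmorphM => /ra.
move=> u; have [f <-] := surj u => -[_ [d [-> e]]]; have [d' de] := surj d.
have [g [w [Ig fE]]] : adjoin I a f.
  apply: rb; exists (b * f - d' * a), d'; rewrite subrK; split=> //.
  by rewrite /I rmorphB !rmorphM de e add0r subrr.
by exists 0, (pr w); rewrite fE rmorphD rmorphM Ig.
Qed.

(** * The exceptional curves *)

Section RaoForm.
Variables (K : closedFieldType) (i j k l : 'I_4).
Hypothesis Uijkl : uniq [:: i; j; k; l].
Local Notation R := {mpoly K[4]}.
Local Notation x := ('X_i : R).
Local Notation y := ('X_j : R).
Local Notation line := (@line K k l).
Local Notation origin := (fun _ : 'I_4 => 0 : K).
Variables (I : R -> Prop) (A B F G h : R).
Hypotheses (iI : is_ideal I) (pI : codim_two_pure I).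
Hypothesis form : rao_form i j k l I A B F G h.

Let P : R := x * A + h * F.
Let S : R := y * B + h * G.
Let f4 : R := x * A * G + y * B * F + h * F * G.

Lemma rao_genP f : I f <->
  exists u v w z, f = u * (x * y) + v * (x * P) + w * (y * S) + z * f4.
Proof.
have e1 : x ^+ 2 * A + x * h * F = x * P by rewrite /P; ring.
have e2 : y ^+ 2 * B + y * h * G = y * S by rewrite /S; ring.
by rewrite (rf_gen form) -/f4 e1 e2; apply: ideal_gen4.
Qed.

Lemma rao_f4 : I f4.
Proof. by apply/rao_genP; exists 0, 0, 0, 1; ring. Qed.

Lemma kill_P : kill j P = P.
Proof.
have [[ij _ _ _ _] _] := distinct_variables Uijkl.
have [[[_ jF] [_ jh] jA]] := (rf_binF form, rf_binh form, rf_A form).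
by rewrite /P rmorphD !rmorphM /= killUj // jF jh jA.
Qed.

Lemma homog_pos_origin n (f : R) : f \is n.+1.-homog -> f.@[origin] = 0.
Proof.
move=> /dhomogP fn; rewrite mevalE big_seq big1 // => m /fn md.
have [a ma] : exists a, m a != 0%N.
  apply: contrapT => /forallNP m0; move: md; rewrite /= mdegE big1 // => a _.
  by have /negP/negPn/eqP := m0 a.
by rewrite (bigD1 a) //= expr0n (negPf ma) mul0r mulr0.
Qed.

Lemma F_origin : F.@[origin] = 0.
Proof. by have [n] := rf_homF form; apply: homog_pos_origin. Qed.
Lemma G_origin : G.@[origin] = 0.
Proof. by have [n] := rf_homG form; apply: homog_pos_origin. Qed.

Lemma rao_origin f : I f -> f.@[origin] = 0.
Proof.
move=> /rao_genP[u [v [w [z ->]]]].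
rewrite /P /S /f4 !(mevalD, mevalM, mevalXU) F_origin G_origin; ring.
Qed.

(** The ideal (x, y, F, G), the annihilator of the Hartshorne-Rao module. *)
Definition rao_annihilator f : Prop :=
  exists a b c d, f = x * a + y * b + F * c + G * d.

Lemma rao_annihilator_ideal : is_ideal rao_annihilator.
Proof.
split=> [|_ _ [a [b [c [d ->]]]] [a' [b' [c' [d' ->]]]]|e _ [a [b [c [d ->]]]]].
- by exists 0, 0, 0, 0; ring.
- by exists (a + a'), (b + b'), (c + c'), (d + d'); ring.
- by exists (e * a), (e * b), (e * c), (e * d); ring.
Qed.

Lemma prime_contains_line n (f : R) (q : R -> Prop) : is_prime q ->
  binary i j f -> f \is n.-homog -> f != 0 -> q f ->
  exists o g, q (line o) /\ f = line o * g.
Proof.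
move=> [iq q1 pq]; elim: n f => [|n IH] f bf fn f0 qf.
  have [c fc] := dhomog0P fn; rewrite fc mpolyC_eq0 in f0.
  by case: q1; rewrite -(mpolyC1 4 K) -(mulVf f0) mpolyCM; apply: ideal_mull => //; rewrite -fc.
have [o [g [fE bg gn]]] := linear_factor Uijkl bf fn f0.
have g0 : g != 0 by apply: contraNneq f0 => g0; rewrite fE g0 mulr0.
move: qf; rewrite {1}fE => /pq[qo|/(IH _ bg gn g0)[o' [g' [qo' gE]]]].
  by exists o, g.
by exists o', (line o * g'); rewrite fE gE mulrCA.
Qed.

Lemma two_lines (q : R -> Prop) o o' : is_ideal q -> q (line o) -> q (line o') ->
  o <> o' -> q 'X_k /\ q 'X_l.
Proof.
move=> iq; wlog: o o' / (if o is Some _ then true else o' == None).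
  move=> W qo qo' oo'; case: o o' qo qo' oo' => [c|] [c'|] qo qo' oo';
    [exact: (W (Some c) (Some c')) | exact: (W (Some c) None) |
     apply: (W (Some c') None) => // | by []].
case: o => [c|/eqP->] //= _; case: o' => [c'|] /= qo qo' oo'; last first.
  split=> //; apply: (ideal_congr iq qo); rewrite -mul_mpolyC; exact: ideal_mull.
have ql : q 'X_l.
  have cc' : c' - c != 0 by rewrite subr_eq0; apply/eqP => e; apply: oo'; rewrite e.
  have -> : ('X_l : R) = (c' - c)^-1%:MP * (('X_k - c *: 'X_l) - ('X_k - c' *: 'X_l)).
    transitivity ((c' - c)^-1%:MP * (c' - c)%:MP * 'X_l : R).
      by rewrite -mpolyCM mulVf // mul1r.
    rewrite mpolyCB -!mul_mpolyC; ring.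
  by apply: ideal_mull => //; apply: idealB.
by split=> //; apply: (ideal_congr iq qo); rewrite -mul_mpolyC; apply: ideal_mull.
Qed.

(** A prime containing F and G contains two distinct linear factors, so the
    finite-length algebra R / (x, y, F, G) has a socle. *)
Lemma rao_socle : exists s, ~ rao_annihilator s /\
  forall f, f.@[origin] = 0 -> rao_annihilator (f * s).
Proof.
have iC := rao_annihilator_ideal.
have C1 : ~ rao_annihilator 1.
  move=> [a [b [c [d /(congr1 (meval origin))/eqP]]]].
  rewrite !(mevalD, mevalM, mevalXU) meval1 F_origin G_origin !mul0r !addr0.
  by rewrite oner_eq0.
have [s [pq sub]] := associated_prime_exists (@hilbert_basis K 4) iC C1.
have {}sub g : rao_annihilator g -> rao_annihilator (g * s).
  by move=> Cg; apply: sub; rewrite mulr1.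
exists s; have [iq q1 pq'] := pq; split; first by rewrite -[s]mul1r.
have qx : rao_annihilator (x * s) by apply: sub; exists 1, 0, 0, 0; ring.
have qy : rao_annihilator (y * s) by apply: sub; exists 0, 1, 0, 0; ring.
have qF : rao_annihilator (F * s) by apply: sub; exists 0, 0, 1, 0; ring.
have qG : rao_annihilator (G * s) by apply: sub; exists 0, 0, 0, 1; ring.
have [n Fn] := rf_homF form; have [n' Gn] := rf_homG form.
have [o [F' [qo FE]]] := prime_contains_line pq (rf_binF form) Fn (rf_F0 form) qF.
have [o' [G' [qo' GE]]] := prime_contains_line pq (rf_binG form) Gn (rf_G0 form) qG.
have [|qk ql] := two_lines iq qo qo'.
  by move=> e; rewrite -e in GE; apply: (rf_lines form FE GE).
have qX a : rao_annihilator ('X_a * s).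
  by case: (four_variables Uijkl a) => ->.
move=> f f0; have := @morph_congruence K 4 R (fun g => rao_annihilator (g * s))
   idfun (@mpolyC 4 K \o meval origin) iq _ _ f.
rewrite /= f0 mpolyC0 subr0; apply=> [c|a]; first by rewrite mevalC.
by rewrite mevalXU mpolyC0 subr0.
Qed.

(** The generator e of the Hartshorne-Rao module satisfies x e = 0, y e = y h,
    F e = P and G e = - y B in R / I; this is the multiple of e by the
    combination x a + y b + F c + G d. *)
Definition rao_value b c d : R := b * (y * h) + c * P - d * (y * B).

Lemma rao_value_F a b c d :
  I (F * rao_value b c d - P * (x * a + y * b + F * c + G * d)).
Proof.
apply/rao_genP; exists (- b * A), (- a), 0, (- d).
by rewrite /rao_value /f4 /P; ring.
Qed.

Lemma rao_value_x b c d : I (x * rao_value b c d).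
Proof.
apply/rao_genP; exists (b * h - d * B), c, 0, 0.
by rewrite /rao_value; ring.
Qed.

Lemma rao_value_y a b c d :
  I (y * rao_value b c d - y * h * (x * a + y * b + F * c + G * d)).
Proof.
apply/rao_genP; exists (- a * h + c * A), 0, (- d), 0.
by rewrite /rao_value /P /S; ring.
Qed.

(** The multiple of e given by a trivial combination is killed by x, y and F, so
    that purity applies. *)
Lemma rao_value0 a b c d : x * a + y * b + F * c + G * d = 0 -> I (rao_value b c d).
Proof.
move=> e; apply: (pure_on_axis Uijkl iI pI (w := F)).
- exact: rao_value_x.
- by have := rao_value_y a b c d; rewrite e mulr0 subr0.
- by have := rao_value_F a b c d; rewrite e mulr0 subr0.
- by rewrite (rf_binF form).2 (rf_binF form).1; apply/eqP/(rf_F0 form).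
Qed.

(** A regular pair at the origin would make the socle multiple s e an element r of
    R / I; but F r = s P and x r = 0 place s in (x, y, F, G). *)
Theorem rao_depth (al be : R) : al.@[origin] = 0 -> be.@[origin] = 0 ->
  regular_mod I al -> regular_mod (adjoin I al) be -> False.
Proof.
move=> al0 be0 ral rbe.
have [s [Cs socle]] := rao_socle.
have [a1 [a2 [a3 [a4 aE]]]] := socle al al0.
have [b1 [b2 [b3 [b4 bE]]]] := socle be be0.
pose Ua := rao_value a2 a3 a4; pose Ub := rao_value b2 b3 b4.
have Iab : I (be * Ua - al * Ub).
  have -> : be * Ua - al * Ub =
      rao_value (be * a2 - al * b2) (be * a3 - al * b3) (be * a4 - al * b4).
    by rewrite /Ua /Ub /rao_value; ring.
  apply: (rao_value0 (a := be * a1 - al * b1)).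
  transitivity (be * (x * a1 + y * a2 + F * a3 + G * a4)
                - al * (x * b1 + y * b2 + F * b3 + G * b4)); first by ring.
  rewrite -aE -bE; ring.
(* r represents s * e: al * r and Ua = al * s * e agree modulo I. *)
have [u [r [Iu UaE]]] : adjoin I al Ua.
  apply: rbe; exists (be * Ua - al * Ub), Ub; split=> //; by ring.
have Ixr : I (x * r).
  apply: ral; have -> : al * (x * r) = x * Ua - x * u by rewrite UaE; ring.
  by apply: idealB => //; [apply: rao_value_x | apply: ideal_mull].
have IFr : I (F * r - P * s).
  apply: ral; have -> : al * (F * r - P * s) = (F * Ua - P * (al * s)) - F * u.
    by rewrite UaE; ring.
  apply: idealB => //; last exact: ideal_mull.
  by rewrite aE; apply: rao_value_F.
have [[ij _ _ _ _] _] := distinct_variables Uijkl.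
have [[[_ jF] [_ jG]] [_ jh]] := ((rf_binF form, rf_binG form), rf_binh form).
have jA := rf_A form; have jP := kill_P.
have [r1 [r2 rE]] := (rf_colon form r).1 Ixr; rewrite -/P in rE.
have [u1 [u2 [u3 [u4 e]]]] := (rao_genP _).1 IFr.
have jf4 : kill j f4 = P * G.
  by rewrite /f4 /P !rmorphD !rmorphM /= killUj // killUi jF jG jA jh; ring.
have P0 : P != 0 by exact: (rf_P0 form).
have {e jf4 rE} : F * kill j r2 - kill j s = kill j u2 * x + kill j u4 * G.
  move: e jf4 jP rE P0; move: (f4) (P) (S) => q p t e jq jp rE p0.
  apply: (mulfI p0); have := congr1 (kill j) e.
  rewrite rE !(rmorphD, rmorphN, rmorphM) /= jq killUi killUj // jp jF => e'.
  transitivity (F * (0 * kill j r1 + p * kill j r2) - p * kill j s); first by ring.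
  by rewrite e'; ring.
move=> e; apply: Cs; have [s' ->] := kill_diff j s.
exists (- kill j u2), s', (kill j r2), (- kill j u4).
transitivity (F * kill j r2 - (F * kill j r2 - kill j s) + y * s'); first by ring.
by rewrite e; ring.
Qed.

(** On each of the planes x = 0 and y = 0 only two generators survive, and they
    have a simple syzygy; lifting it determines all entries up to terms that
    vanish at the origin. *)
Lemma rao_syzygy c1 c2 c3 c4 :
    c1 * (x * y) + c2 * (x * P) + c3 * (y * S) + c4 * f4 = 0 ->
  [/\ c1.@[origin] = 0, c2.@[origin] = 0, c3.@[origin] = 0 & c4.@[origin] = 0].
Proof.
have [[ij _ _ _ _] _] := distinct_variables Uijkl.
have [[[iF jF] [iG jG]] [ih jh]] := ((rf_binF form, rf_binG form), rf_binh form).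
have [jA iB] := (rf_A form, rf_B form).
have ji : j != i by rewrite eq_sym.
have jP := kill_P; have iS : kill i S = S.
  by rewrite /S rmorphD !rmorphM /= killUj // iG ih iB.
have f4S : f4 = S * F + x * (A * G) by rewrite /f4 /S; ring.
have f4P : f4 = P * G + y * (B * F) by rewrite /f4 /P; ring.
have P0 : P != 0 by exact: (rf_P0 form). have S0 : S != 0 by exact: (rf_S0 form).
have Po : P.@[origin] = 0.
  by rewrite /P mevalD !mevalM mevalXU F_origin mul0r mulr0 addr0.
have So : S.@[origin] = 0.
  by rewrite /S mevalD !mevalM mevalXU G_origin mul0r mulr0 addr0.
have f4o : f4.@[origin] = 0 by apply: rao_origin; apply: rao_f4.
move: (P) (S) (f4) f4S f4P jP iS P0 S0 Po So f4o.
move=> p t q qt qp jp it p0 t0 po to qo e.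
have e1 : kill i c3 * y + kill i c4 * F = 0.
  apply: (mulfI t0); rewrite mulr0; have := congr1 (kill i) e.
  rewrite qt !(rmorphD, rmorphM) /= killUi !killUj // it iF rmorph0 => <-; ring.
have /eqP : kill j (kill i c4) * F = 0.
  have := congr1 (kill j) e1.
  by rewrite !(rmorphD, rmorphM) /= killUi jF mulr0 add0r rmorph0.
rewrite mulf_eq0 (negPf (rf_F0 form)) orbF => /eqP/kill0P[a c4E].
have c3E : kill i c3 = - (a * F).
  apply: (mulfI (mpolyX_neq0 K (U_(j))%MM)); apply/eqP; rewrite -subr_eq0; apply/eqP.
  by rewrite -e1 c4E; ring.
have [b c3E'] := kill_diff i c3; have [c c4E'] := kill_diff i c4.
have [c' cE] := kill_diff j c.
rewrite c3E in c3E'; rewrite c4E in c4E'.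
have e2 : kill j c2 * x + x * kill j c * G = 0.
  apply: (mulfI p0); rewrite mulr0; have := congr1 (kill j) e.
  rewrite qp c4E' !(rmorphD, rmorphM) /= !killUi !killUj // jp jG rmorph0 => <-; ring.
have c2E : kill j c2 = - (kill j c * G).
  apply: (mulfI (mpolyX_neq0 K (U_(i))%MM)); apply/eqP; rewrite -subr_eq0; apply/eqP.
  by rewrite -e2; ring.
have [b' c2E'] := kill_diff j c2; rewrite c2E in c2E'.
have c1E : c1 = - (b' * p + b * t + c' * q + kill j c * B * F + a * A * G).
  apply: (mulfI (mulf_neq0 (mpolyX_neq0 K (U_(i))%MM) (mpolyX_neq0 K (U_(j))%MM))).
  apply/eqP; rewrite -subr_eq0; apply/eqP; rewrite -[RHS]e.
  transitivity (x * y * c1 + (x * y) * (b' * p + b * t + c' * q)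
    + x * kill j c * (q - p * G) + y * a * (q - t * F)).
    have -> : q - p * G = y * (B * F) by rewrite qp; ring.
    by have -> : q - t * F = x * (A * G) by [rewrite qt; ring]; ring.
  by rewrite {1}c2E' c3E' c4E' {3}cE; ring.
split.
- by rewrite c1E !(mevalN, mevalD, mevalM) po to qo F_origin G_origin; ring.
- by rewrite c2E' !(mevalN, mevalD, mevalM, mevalXU) G_origin; ring.
- by rewrite c3E' !(mevalN, mevalD, mevalM, mevalXU) F_origin; ring.
- by rewrite c4E' !(mevalN, mevalD, mevalM, mevalXU); ring.
Qed.

(** The transition matrices to another generating set and back multiply to the
    identity modulo syzygies; at the origin this is an identity of rank four. *)
Theorem rao_generators_ge (s : seq R) :
  (forall f, I f <-> ideal_gen s f) -> (4 <= size s)%N.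
Proof.
move=> sI; pose g := [:: x * y; x * P; y * S; f4].
have gI f : I f <-> ideal_gen g f by rewrite rao_genP; split=> /ideal_gen4.
have /choice[C CE] : forall a : 'I_4, exists c : 'I_(size s) -> R,
    g`_a = \sum_b c b * s`_b.
  move=> a; have /gI/sI[c ->] : ideal_gen g g`_a by apply/mem_ideal_gen/mem_nth.
  by exists c.
have /choice[D DE] : forall b : 'I_(size s), exists d : 'I_4 -> R,
    s`_b = \sum_a d a * g`_a.
  move=> b; have /sI/gI[d ->] : ideal_gen s s`_b by apply/mem_ideal_gen/mem_nth.
  by exists d.
pose E a b := \sum_c C a c * D c b - (a == b)%:R.
have Eo a b : (E a b).@[origin] = 0.
  have : \sum_b E a b * g`_b = 0.
    rewrite (eq_bigr (fun b => \sum_c C a c * D c b * g`_b - (a == b)%:R * g`_b)); last first.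
      by move=> c _; rewrite mulrBl mulr_suml.
    rewrite sumrB exchange_big /= [X in _ - X](bigD1 a) //= eqxx mul1r.
    rewrite [X in _ - (_ + X)]big1 ?addr0; last first.
      by move=> c /negPf ca; rewrite eq_sym ca mul0r.
    apply/eqP; rewrite subr_eq0 CE; apply/eqP; apply: eq_bigr => c _.
    by rewrite DE mulr_sumr; apply: eq_bigr => d _; rewrite mulrA.
  rewrite !big_ord_recl big_ord0 /= addr0 !addrA => /rao_syzygy[h0 h1 h2 h3].
  have : (b : nat) \in iota 0 4 by rewrite mem_iota ltn_ord.
  rewrite !inE => /or4P[] /eqP be.
  - by rewrite (_ : b = ord0) //; apply: val_inj.
  - by rewrite (_ : b = lift ord0 ord0) //; apply: val_inj.
  - by rewrite (_ : b = lift ord0 (lift ord0 ord0)) //; apply: val_inj.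
  - by rewrite (_ : b = lift ord0 (lift ord0 (lift ord0 ord0))) //; apply: val_inj.
pose MC := \matrix_(a < 4, b < size s) (C a b).@[origin].
pose MD := \matrix_(b < size s, a < 4) (D b a).@[origin].
have : MC *m MD = 1%:M.
  apply/matrixP => a b; rewrite !mxE; apply/eqP; rewrite -subr_eq0; apply/eqP.
  rewrite -[RHS](Eo a b) /E mevalB; congr (_ - _).
    rewrite (raddf_sum (meval origin)) /=; apply: eq_bigr => c _.
    by rewrite !mxE mevalM.
  by case: eqP => _; rewrite ?meval1 ?meval0.
move=> /(congr1 mxrank); rewrite mxrank1 => r4.
apply: (@leq_trans (\rank (MC *m MD))); first by rewrite r4.
by apply: leq_trans (mxrankM_maxl _ _) (rank_leq_col _).
Qed.

(** A chain of two primes below the origin forces the codimension of the vertex to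
    be at least two, while its depth is at most one. *)
Theorem rao_not_cohen_macaulay (Q : comNzRingType) (pr : {rmorphism R -> Q})
    (p q : R -> Prop) :
    (forall a, exists f, pr f = a) -> (forall f, pr f = 0 <-> I f) ->
    is_prime p -> is_prime q -> (forall f, I f -> p f) ->
    (forall f, p f -> q f) -> (exists f, q f /\ ~ p f) ->
    (forall f, q f -> f.@[origin] = 0) -> (exists f, f.@[origin] = 0 /\ ~ q f) ->
  ~ cohen_macaulay Q.
Proof.
move=> surj prI pp pq Ip sub_pq [b0 [qb0 pb0]] sub_qo [b1 [ob1 qb1]] [_ CM].
have push (r : R -> Prop) : is_prime r -> (forall f, I f -> r f) ->
    is_prime (fun a => exists2 f, pr f = a & r f) /\
    forall f, (exists2 f', pr f' = pr f & r f') <-> r f.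
  move=> [ir r1 pr_r] Ir.
  have back f : (exists2 f', pr f' = pr f & r f') <-> r f.
    split=> [[f' e rf']|rf]; last by exists f.
    apply: (ideal_congr ir _ rf'); apply: Ir; apply/prI.
    by rewrite rmorphB e subrr.
  split=> //; split; first split.
  - by exists 0; [rewrite rmorph0 | apply: ideal0].
  - move=> _ _ [f <- rf] [g <- rg]; exists (f + g); first by rewrite rmorphD.
    exact: idealD.
  - move=> c _ [f <- rf]; have [d <-] := surj c; exists (d * f); first by rewrite rmorphM.
    exact: ideal_mull.
  - by rewrite -(rmorph1 pr) => /back.
  - move=> a b; have [f <-] := surj a; have [g <-] := surj b.
    by rewrite -rmorphM => /back/pr_r[hyp|hyp]; [left|right]; apply/back.
have po : is_prime (fun f : R => f.@[origin] = 0).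
  exact: (is_prime_ker (meval origin : {rmorphism R -> K})).
have Iq f : I f -> q f by move=> /Ip/sub_pq.
have [pp' ppE] := push p pp Ip; have [pq' pqE] := push q pq Iq.
have [po' poE] := push _ po rao_origin.
have [Pp PpE] := prime_idealr_of pp'; have [Pq PqE] := prime_idealr_of pq'.
have [Po PoE] := prime_idealr_of po'.
have maxPo : maximal_ideal Po.
  move=> J PoJ a; apply/idP/idP => [aJ|]; last exact: PoJ.
  apply: contraT => aPo; have [f fa] := surj a.
  have fo : f.@[origin] != 0.
    by apply: contraNneq aPo => fo; apply/PoE; exists f.
  have : pr (f - f.@[origin]%:MP) \in J.
    by apply: PoJ; apply/PoE/poE; rewrite mevalB mevalC subrr.
  rewrite rmorphB fa => hyp.
  have cJ : pr (f.@[origin]%:MP) \in J by rewrite -(subKr a (pr _)) rpredB.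
  have := idealMr (pr (f.@[origin])^-1%:MP) cJ.
  by rewrite -rmorphM -mpolyCM mulVf // rmorph1 idealr1.
have [n [[[s [sn sP [reg _]]] _] [_ codim]]] := CM Po maxPo.
have n2 : (2 <= n)%N.
  apply: codim; exists (fun m => match m with 0%N => Pp | 1%N => Pq | _ => Po end).
  split=> //; case=> [_|[_|//]]; split=> /=.
  - by move=> a; have [f <-] := surj a; move=> /PpE/ppE/sub_pq hyp; apply/PqE/pqE.
  - by move=> hyp; apply/pb0/ppE/PpE/hyp/PqE/pqE.
  - by move=> a; have [f <-] := surj a; move=> /PqE/pqE/sub_qo hyp; apply/PoE/poE.
  - by move=> hyp; apply/qb1/pqE/PqE/hyp/PoE/poE.
case: s sn sP reg => [|a [|b s]] sn sP reg; rewrite -?sn // in n2.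
have [al ala] := surj a; have [be beb] := surj b.
apply: (@rao_depth al be).
- by apply/poE/PoE; rewrite ala; apply: sP; rewrite mem_head.
- by apply/poE/PoE; rewrite beb; apply: sP; rewrite !inE eqxx orbT.
- move=> u /prI Iu; apply/prI/(ideal_gen_nil _); apply: (reg 0%N) => //=.
  by apply/ideal_gen_nil; rewrite -ala -rmorphM.
have tE u : ideal_gen [:: a] (pr u) <-> adjoin I al u.
  split=> [/ideal_gen_cons[c [g [/ideal_gen_nil-> e]]]|[v [c [/prI Iv ->]]]].
    have [d dc] := surj c; exists (u - d * al), d; rewrite subrK; split=> //.
    by apply/prI; rewrite rmorphB rmorphM dc ala e addr0 subrr.
  apply/ideal_gen_cons; exists (pr c), 0; split; first exact/ideal_gen_nil.
  by rewrite rmorphD rmorphM Iv ala add0r addr0.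
move=> u /tE hyp; apply/tE; apply: (reg 1%N) => //=.
by rewrite -beb -rmorphM.
Qed.

End RaoForm.

(** * Purity of curves and linear coordinates *)

Section Curves.
Variables (K : closedFieldType).
Local Notation R := {mpoly K[4]}.
Local Notation origin := (fun _ : 'I_4 => 0 : K).
Variable I : idealr R.
Hypothesis curveI : is_curve I.

Lemma homogeneous_prime_origin (P : idealr R) f :
  homogeneous_ideal P -> f \in P -> f.@[origin] = 0.
Proof.
move=> hP /(hP _ 0%N); have [c fc] := dhomog0P (pihomogP mdeg 0 f).
have -> : f.@[origin] = c.
  have fE := pihomog_partitionE (leqnn (msize f)).
  have [f0|f0] := posnP (msize f).
    have f00 : f = 0 by apply/eqP; rewrite -msize_poly_eq0 f0.
    by move: fc; rewrite f00 pihomog0 meval0 => /esym/eqP; rewrite mpolyC_eq0 => /eqP.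
  rewrite {1}fE (raddf_sum (meval origin)) /= (bigD1 (Ordinal f0)) //= fc mevalC.
  rewrite big1 ?addr0 // => -[[|d] lt] //= _.
  exact: homog_pos_origin (pihomogP mdeg d.+1 f).
rewrite fc => cP; apply/eqP; apply: contraT => c0.
have := idealMr c^-1%:MP cP; rewrite -mpolyCM mulVf // => h.
by rewrite mpolyC1 idealr1 in h.
Qed.

(** Components have dimension one, so each of their primes p lies strictly below
    that of a closed point. *)
Lemma associated_prime_point u : u \notin I -> exists p q : prime_idealr R,
  [/\ forall g, g * u \in I -> g \in p, homogeneous_ideal q, {subset I <= p},
      strict_sub p q & exists a, 'X_a \notin q].
Proof.
move=> /negP uI; have iI := ideal_idealr I.
have [v [pv sub]] := associated_prime_exists (@hilbert_basis K 4) iI uI.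
have [P PE] := prime_idealr_of pv.
have assP : associated_prime I P by exists v; move=> g; apply: PE.
have [_ _ /(_ P assP)[[p [p0 ptp strp]] _]] := curveI.
have [h1 h2] := ptp 1%N (leqnn _).
exists (p 0%N), (p 1%N); split=> //.
- by move=> g /sub/PE gP; rewrite p0.
- by move=> g gI; rewrite p0; apply/PE; rewrite mulrC; apply: idealMr.
- exact: strp.
Qed.

(** An associated prime containing q and w would lie in the middle of a chain of
    primes of length five, between 0, p, q below and a closed point and the
    origin above. *)
Lemma curve_codim_two_pure : codim_two_pure (fun f => f \in I).
Proof.
move=> p q u w pp pq [a pa a0] sub_pq [b qb pb] qu wu qw.
apply: contrapT => /negP uI.
have [P [Q [uP hQ IP [subPQ strPQ] [d XQ]]]] := associated_prime_point uI.
have [c [cQ cP]] : exists c, c \in Q /\ c \notin P.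
  apply: contrapT => /forallNP none; apply: strPQ => c cQ.
  by apply: contraT => cP; case: (none c).
pose J (m : nat) : R -> Prop := match m with
  | 0%N => fun f => f = 0 | 1%N => p | 2%N => q | 3%N => fun f => f \in P
  | 4%N => fun f => f \in Q | _ => fun f => f.@[origin] = 0 end.
have iJ m : is_ideal (J m).
  case: m => [|[|[|[|[|m]]]]] /=.
  - by split=> [|? ? -> ->|e ? ->]; rewrite ?addr0 ?mulr0.
  - by case: pp.
  - by case: pq.
  - exact: ideal_idealr.
  - exact: ideal_idealr.
  - by case: (is_prime_ker (meval origin : {rmorphism R -> K})).
have := @chain_unit K 4 [tuple a; b; w; c; 'X_d] J iJ.
rewrite /= meval1 => contra; have /eqP := oner_neq0 K; apply; apply: contra.
have [ip _ ppr] := pp; have [iq _ pqr] := pq.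
case=> [[|[|[|[|[|//]]]]] lt]; rewrite (tnth_nth 0) /=; split=> //.
- by move=> f ->; apply: ideal0.
- by move=> f /eqP; rewrite mulf_eq0 (negPf a0) => /eqP.
- by move=> f /ppr[].
- by move=> f /qu/uP.
- exact: uP.
- by move=> f /pqr[].
- by move=> f; rewrite prime_idealrM (negPf cP).
- by move=> f; apply: homogeneous_prime_origin.
- by rewrite mevalXU.
- by move=> f; rewrite prime_idealrM (negPf XQ).
Qed.

End Curves.

Section Coordinates.
Variables (K : closedFieldType) (i j k l : 'I_4).
Hypothesis Uijkl : uniq [:: i; j; k; l].
Local Notation R := {mpoly K[4]}.
Local Notation origin := (fun _ : 'I_4 => 0 : K).
Variables (I : idealr R) (phi psi : {rmorphism R -> R}).
Hypothesis curveI : is_curve I.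
Hypotheses (phiK : cancel phi psi) (psiK : cancel psi phi).
Hypothesis phi_homog : forall d f, pihomog mdeg d (phi f) = phi (pihomog mdeg d f).
Hypothesis psi_homog : forall d f, pihomog mdeg d (psi f) = psi (pihomog mdeg d f).
Hypotheses (phiC : forall c, phi c%:MP = c%:MP) (psiC : forall c, psi c%:MP = c%:MP).

(** The ideal of the curve in the new coordinates. *)
Definition transported (f : R) : Prop := psi f \in I.

Lemma transported_ideal : is_ideal transported.
Proof.
rewrite /transported; split=> [|a b|c a]; rewrite ?rmorph0 ?rmorphD ?rmorphM.
- exact: rpred0.
- exact: rpredD.
- exact: idealMr.
Qed.

Lemma transported_homogeneous : homogeneous_set transported.
Proof.
have [hI _ _] := curveI.
by move=> d f; rewrite /transported -psi_homog => /(hI _ d).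
Qed.

Lemma is_prime_preimage (p : R -> Prop) (th : {rmorphism R -> R}) :
  is_prime p -> is_prime (fun f => p (th f)).
Proof.
move=> [[h0 hD hM] h1 hp]; split; first split=> [|a b|c a];
  rewrite ?rmorph0 ?rmorph1 ?rmorphD ?rmorphM //.
- exact: hD.
- exact: hM.
- by move=> a b; rewrite rmorphM => /hp.
Qed.

Lemma transported_pure : codim_two_pure transported.
Proof.
move=> p q u w pp pq [a pa a0] sub_pq [b qb pb] qu wu qw.
apply: (curve_codim_two_pure curveI (p := fun f => p (phi f)) (q := fun f => q (phi f))
          (w := psi w)).
- exact: is_prime_preimage.
- exact: is_prime_preimage.
- exists (psi a); first by rewrite psiK.
  by apply: contraNneq a0 => e; rewrite -(psiK a) e rmorph0.
- by move=> f /sub_pq.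
- by exists (psi b); rewrite psiK.
- by move=> f /qu; rewrite /transported rmorphM phiK.
- by rewrite -rmorphM.
- by rewrite psiK.
Qed.

(** Otherwise the ideal of the plane X_j = 0 would be associated to the curve,
    although a line and a point of this plane form a chain of length two. *)
Lemma residual_not_plane : transported ('X_i * 'X_j) ->
  exists f, transported ('X_i * f) /\ kill j f <> 0.
Proof.
have [[ij ik il jk jl] kl] := distinct_variables Uijkl.
have kj : k != j by rewrite eq_sym.
have ki : k != i by rewrite eq_sym.
move=> Ixy; apply: contrapT => /forallNP none.
have colon f : transported ('X_i * f) <-> kill j f = 0.
  split=> [If|/kill0P[g ->]]; first by apply: contrapT => jf; case: (none f).
  by rewrite mulrA mulrC; apply: ideal_mull => //; apply: transported_ideal.
pose t0 : {rmorphism R -> R} := kill j \o phi.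
pose t1 : {rmorphism R -> R} := kill i \o t0.
pose t2 : {rmorphism R -> R} := kill k \o t1.
have [P0 P0E] := prime_idealr_of (is_prime_ker t0).
have [P1 P1E] := prime_idealr_of (is_prime_ker t1).
have [P2 P2E] := prime_idealr_of (is_prime_ker t2).
have ass : associated_prime I P0.
  exists (psi 'X_i) => g; rewrite P0E -[t0 g]/(kill j (phi g)) -colon /transported.
  by rewrite rmorphM phiK mulrC.
have hom0 : homogeneous_ideal P0.
  move=> f d /P0E f0; apply/P0E.
  by rewrite /t0 /= -phi_homog -pihomog_kill [kill j (phi f)]f0 pihomog0.
have hom1 : homogeneous_ideal P1.
  move=> f d /P1E f0; apply/P1E.
  by rewrite /t1 /t0 /= -phi_homog -!pihomog_kill [kill i _]f0 pihomog0.
have hom2 : homogeneous_ideal P2.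
  move=> f d /P2E f0; apply/P2E.
  by rewrite /t2 /t1 /t0 /= -phi_homog -!pihomog_kill [kill k _]f0 pihomog0.
have sub01 : {subset P0 <= P1}.
  by move=> f /P0E f0; apply/P1E; rewrite /t1 /= [kill j (phi f)]f0 rmorph0.
have sub12 : {subset P1 <= P2}.
  by move=> f /P1E f0; apply/P2E; rewrite /t2 /= [kill i _]f0 rmorph0.
have [d Xd] : exists d, 'X_d \notin P2.
  apply: contrapT => /forallNP all2.
  have t2X a : t2 'X_a = 0.
    by apply/P2E; have := all2 a; case: (_ \in _).
  have t2l : t2 (psi 'X_l) = 'X_l.
    by rewrite /t2 /t1 /t0 /= psiK !killUj // eq_sym.
  have e : forall f, t2 f = (f.@[origin])%:MP.
    apply: (@mpoly_morph_ext K 4 R t2 (@mpolyC 4 K \o meval origin)) => [c|a].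
      by rewrite /t2 /t1 /t0 /= phiC !killC mevalC.
    by rewrite t2X /= mevalXU mpolyC0.
  have := congr1 (kill l) t2l; rewrite e killC killUi -e t2l => /eqP.
  by rewrite (negPf (mpolyX_neq0 _ _)).
have pt2 : is_point P2 by split=> //; exists d.
have pt1 : is_point P1 by split=> //; exists d; apply: contra Xd => /sub12.
have pt0 : is_point P0 by split=> //; exists d; apply: contra Xd => /sub01/sub12.
have [_ _ /(_ P0 ass)[_ maxP]] := curveI.
suff /maxP : exists p : nat -> prime_idealr R,
    [/\ p 0%N =i P0, forall m, (m <= 2)%N -> is_point (p m)
      & forall m, (m < 2)%N -> strict_sub (p m) (p m.+1)] by [].
exists (fun m => match m with 0%N => P0 | 1%N => P1 | _ => P2 end).
split=> //; first by case=> [|[|m]].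
case=> [_|[_|//]]; split=> //= sub.
- have /sub/P0E : psi 'X_i \in P1.
    by apply/P1E; rewrite /t1 /t0 /= psiK killUj // killUi.
  by rewrite /t0 /= psiK killUj // => /eqP; rewrite (negPf (mpolyX_neq0 _ _)).
- have /sub/P1E : psi 'X_k \in P2.
    by apply/P2E; rewrite /t2 /t1 /t0 /= psiK (killUj kj) (killUj ki) killUi.
  rewrite /t1 /t0 /= psiK (killUj kj) (killUj ki) => /eqP.
  by rewrite (negPf (mpolyX_neq0 _ _)).
Qed.

Lemma psi_origin f : (forall a, (psi 'X_a).@[origin] = 0) ->
  (psi f).@[origin] = f.@[origin].
Proof.
move=> psi0; have := @mpoly_morph_ext K 4 K (meval origin \o psi) (meval origin) _ _ f.
by apply=> [c|a] /=; rewrite ?psiC // psi0 mevalXU.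
Qed.

(** The closure of a component and one of its closed points. *)
Lemma transported_chain :
    (forall a, (psi 'X_a).@[origin] = 0) -> (forall a, (phi 'X_a).@[origin] = 0) ->
  exists p q : R -> Prop, [/\ is_prime p /\ is_prime q,
    forall f, transported f -> p f, forall f, p f -> q f,
    exists f, q f /\ ~ p f & (forall f, q f -> f.@[origin] = 0) /\
    exists f, f.@[origin] = 0 /\ ~ q f].
Proof.
move=> psi0 phi0; have I1 : 1 \notin I by rewrite idealr1.
have [P [Q [_ hQ IP [PQ QP] [a aQ]]]] := associated_prime_point curveI I1.
exists (fun f => psi f \in P), (fun f => psi f \in Q); split.
- by split; apply: is_prime_preimage (is_prime_idealr _).
- by move=> f /IP.
- by move=> f /PQ.
- apply: contrapT => /forallNP none; apply: QP => f fQ.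
  by apply: contraT => /negP fP; case: (none (phi f)); rewrite phiK.
split=> [f /(homogeneous_prime_origin hQ)|]; first by rewrite psi_origin.
by exists (phi 'X_a); rewrite phiK; split; [apply: phi0 | apply/negP].
Qed.

Lemma transported_generated (s : seq R) :
  (forall f, transported f <-> ideal_gen s f) -> generates (map psi s) I.
Proof.
move=> sI f; split=> [fI|].
  have /sI : transported (phi f) by rewrite /transported phiK.
  move=> /(ideal_gen_sub (J := fun g => ideal_gen (map psi s) (psi g))).
  rewrite phiK; apply=> [|a as_]; last by apply/mem_ideal_gen/map_f.
  have [h0 hD hM] := is_ideal_gen (map psi s).
  by split=> [|a b|c a]; rewrite ?rmorph0 ?rmorphD ?rmorphM //; [apply: hD | apply: hM].
apply: ideal_gen_sub (ideal_idealr I) _ => _ /mapP[a as_ ->].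
exact/sI/mem_ideal_gen.
Qed.

Lemma generated_transported (s : seq R) : generates s I ->
  forall f, transported f <-> ideal_gen (map phi s) f.
Proof.
move=> sI f; split=> [/sI|].
  move=> /(ideal_gen_sub (J := fun g => ideal_gen (map phi s) (phi g))).
  rewrite psiK; apply=> [|a as_]; last by apply/mem_ideal_gen/map_f.
  have [h0 hD hM] := is_ideal_gen (map phi s).
  by split=> [|a b|c a]; rewrite ?rmorph0 ?rmorphD ?rmorphM //; [apply: hD | apply: hM].
apply: ideal_gen_sub transported_ideal _ => _ /mapP[a as_ ->].
by rewrite /transported phiK; apply/sI/mem_ideal_gen.
Qed.

End Coordinates.

Section LinearChange.
Variable (K : closedFieldType) (n : nat).
Local Notation R := {mpoly K[n]}.

Definition linear_sub (M : 'M[K]_n) : {rmorphism R -> R} :=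
  sub (fun a => \sum_b M a b *: 'X_b).

Lemma change_coordE M (f : R) : change_coord M f = linear_sub M f.
Proof.
rewrite /change_coord /linear_sub sub.unlock /=.
by apply: eq_bigr => m _; congr (_ * _); apply: eq_bigr => a _; rewrite tnth_mktuple.
Qed.

Lemma linear_sub_mul M N (f : R) : linear_sub N (linear_sub M f) = linear_sub (M *m N) f.
Proof.
apply: (sub_ext (p := linear_sub N \o linear_sub M)) => [c|c|a] /=; rewrite ?subC //.
rewrite !subU rmorph_sum /= (eq_bigr (fun b => \sum_c (M a b * N b c) *: 'X_c)).
  by rewrite exchange_big /=; apply: eq_bigr => c _; rewrite mxE scaler_suml.
move=> b _; rewrite subZ subU scaler_sumr; apply: eq_bigr => c _.
by rewrite scalerA.
Qed.

Lemma linear_sub1 (f : R) : linear_sub 1%:M f = f.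
Proof.
apply: (sub_ext (q := idfun)) => [c|c|a] //=; rewrite ?subC // subU.
rewrite (bigD1 a) //= mxE eqxx scale1r big1 ?addr0 // => b /negPf ba.
by rewrite mxE eq_sym ba scale0r.
Qed.

Lemma linear_subK M : M \in unitmx -> cancel (linear_sub M) (linear_sub (invmx M)).
Proof. by move=> uM f; rewrite linear_sub_mul mulmxV // linear_sub1. Qed.

Lemma linear_subVK M : M \in unitmx -> cancel (linear_sub (invmx M)) (linear_sub M).
Proof. by move=> uM f; rewrite linear_sub_mul mulVmx // linear_sub1. Qed.

Lemma linear_sub_homog M d (f : R) :
  pihomog mdeg d (linear_sub M f) = linear_sub M (pihomog mdeg d f).
Proof.
by apply: pihomog_sub => a; apply: rpred_sum => b _; apply/dhomogZ/dhomogX1.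
Qed.

Lemma linear_sub_origin M a : (linear_sub M 'X_a).@[fun=> 0] = 0.
Proof.
rewrite subU (raddf_sum (meval _)) /= big1 // => b _.
by rewrite mevalZ mevalXU mulr0.
Qed.

Lemma linear_formE (f : R) : f \is 1.-homog -> f = \sum_a f@_U_(a) *: 'X_a.
Proof.
move=> /dhomogP f1; apply/mpolyP => m; rewrite raddf_sum /=.
have [mf|mf] := boolP (m \in msupp f).
  have /mdeg1P[a /eqP am] : mdeg m == 1%N by apply/eqP; exact: f1.
  rewrite (bigD1 a) //= mcoeffZ mcoeffX {2}am eqxx mulr1 big1 ?addr0 ?am //.
  by move=> b /negPf ba; rewrite mcoeffZ mcoeffX eq_mnm1 ba mulr0.
rewrite memN_msupp_eq0 // big1 // => b _; rewrite mcoeffZ mcoeffX.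
by case: eqP => [e|]; [rewrite e memN_msupp_eq0 // mul0r | rewrite mulr0].
Qed.

(** The coefficients of u and v form a matrix of rank two, which an invertible
    matrix brings to the first two rows of the identity. *)
Lemma coordinates_exist (u v : R) (a b : 'I_n) :
    (a : nat) = 0%N -> (b : nat) = 1%N ->
    u \is 1.-homog -> u != 0 -> v \is 1.-homog -> (forall c : K, v != c *: u) ->
  exists2 M, M \in unitmx & linear_sub M u = 'X_a /\ linear_sub M v = 'X_b.
Proof.
move=> a0 b1 u1 u0 v1 uv.
pose L := \matrix_(r < 2, d < n) (if r == 0 then u else v)@_U_(d).
have freeL : row_free L.
  apply: inj_row_free => w /rowP wL.
  have comb : w 0 0 *: u + w 0 1 *: v = 0.
    rewrite (linear_formE u1) (linear_formE v1) !scaler_sumr -big_split big1 //= => d _.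
    have := wL d; rewrite !mxE !big_ord_recl big_ord0 !mxE /= addr0 => e.
    rewrite !scalerA -scalerDl (_ : _ + _ = 0) ?scale0r //; rewrite -[RHS]e.
    by congr (_ * _ + w 0 _ * _); apply: val_inj.
  have w1 : w 0 1 = 0.
    apply/eqP; apply: contraT => w1; have /eqP := uv (- (w 0 1)^-1 * w 0 0); case.
    apply: (scalerI w1); rewrite scalerA mulrA mulrN divff // mulN1r scaleNr.
    by apply/eqP; rewrite -addr_eq0 addrC comb.
  have w0 : w 0 0 = 0.
    by move/eqP: comb; rewrite w1 scale0r addr0 scaler_eq0 (negPf u0) orbF => /eqP.
  apply/rowP => d; rewrite mxE; have : (d : nat) \in iota 0 2 by rewrite mem_iota ltn_ord.
  rewrite !inE => /orP[] /eqP e.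
    by rewrite -w0; congr (w _ _); apply: val_inj.
  by rewrite -w1; congr (w _ _); apply: val_inj.
have n2 : (2 <= n)%N by rewrite -b1 ltn_ord.
pose B : 'M[K]_n := pinvmx L *m pid_mx 2.
have LB : L *m B = pid_mx 2 by rewrite mulmxA mulmxVp // mul1mx.
have [|M uM LM] := @complete_unitmx K 2 n L B.
  by rewrite LB rank_pid_mx // (eqP freeL).
exists M => //; rewrite LB in LM.
have image (r : 'I_2) w (d : 'I_n) : w = (if r == 0 then u else v) -> (r : nat) = d ->
    w \is 1.-homog -> linear_sub M w = 'X_d.
  move=> wE rd w1; rewrite (linear_formE w1) rmorph_sum /=.
  rewrite (eq_bigr (fun e => \sum_f (L r e * M e f) *: 'X_f)); last first.
    move=> e _; rewrite subZ subU scaler_sumr; apply: eq_bigr => f _.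
    by rewrite scalerA mxE -wE.
  rewrite exchange_big /= (eq_bigr (fun f => (L *m M) r f *: 'X_f)); last first.
    by move=> f _; rewrite mxE scaler_suml.
  rewrite -LM (bigD1 d) //= mxE rd eqxx -rd ltn_ord scale1r big1 ?addr0 // => f fd.
  by rewrite mxE rd [_ == _ :> nat]eq_sym (negPf (fd : (f : nat) != d)) scale0r.
by split; [apply: (image 0) | apply: (image 1)].
Qed.

End LinearChange.

(** * The theorem *)

Section Assembly.
Variable K : closedFieldType.
Local Notation R := {mpoly K[4]}.
Local Notation origin := (fun _ : 'I_4 => 0 : K).

Lemma axis_ideal (i j : 'I_4) (f : R) :
  kill j (kill i f) = 0 -> ideal_gen [:: 'X_i; 'X_j] f.
Proof.
have [g fE] := kill_diff i f; have [g' kE] := kill_diff j (kill i f).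
move=> f0; rewrite f0 add0r in kE.
apply/ideal_gen2; exists g, g'; rewrite {1}fE kE; ring.
Qed.

Lemma rao_regular_sequence (i j k l : 'I_4) (I : R -> Prop) (A B F G h : R) :
  uniq [:: i; j; k; l] -> rao_form i j k l I A B F G h ->
  regular_sequence [:: 'X_i; 'X_j; F; G].
Proof.
move=> U form; have [[ij _ _ _ _] _] := distinct_variables U.
have ji : j != i by rewrite eq_sym.
have [[iF jF] [iG jG]] := (rf_binF form, rf_binG form).
split; last first.
  move=> /ideal_gen4[a [b [c [d /(congr1 (meval origin))/eqP]]]].
  rewrite !(mevalD, mevalM, mevalXU) meval1 (F_origin form) (G_origin form).
  by rewrite !mulr0 !addr0 oner_eq0.
case=> [_ a|[_ a|[_ a|[_ a|//]]]] /=.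
- move=> /ideal_gen_nil/eqP; rewrite mulf_eq0 (negPf (mpolyX_neq0 _ _)) => /eqP->.
  exact/ideal_gen_nil.
- move=> /ideal_gen_cons[c [_ [/ideal_gen_nil->]]]; rewrite addr0 => e.
  have /eqP : 'X_j * kill i a = 0.
    by have := congr1 (kill i) e; rewrite !rmorphM /= killUi killUj // mulr0.
  rewrite mulf_eq0 (negPf (mpolyX_neq0 _ _)) => /eqP/kill0P[g ->].
  apply/ideal_gen_cons; exists g, 0; split; first exact/ideal_gen_nil.
  by rewrite addr0 mulrC.
- move=> /ideal_gen2[c [d e]]; apply: axis_ideal; apply: (mulfI (rf_F0 form)).
  have := congr1 (kill j \o kill i) e.
  by rewrite /= !(rmorphD, rmorphM) /= killUi (killUj ji) killUi iF jF !mulr0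
     rmorph0 mulr0 addr0.
move=> /ideal_gen3[c [d [b e]]].
have : kill j (kill i a) * G = kill j (kill i b) * F.
  have := congr1 (kill j \o kill i) e.
  rewrite /= !(rmorphD, rmorphM) /= killUi (killUj ji) killUi iF jF iG jG !mulr0.
  by rewrite rmorph0 mulr0 !add0r mulrC.
move=> /(rf_coprime form)[w [aw _]].
have [g aE] := kill_diff i a; have [g' kE] := kill_diff j (kill i a).
apply/ideal_gen3; exists g, g', w; rewrite aE {1}kE aw; ring.
Qed.

Lemma coordinates_uniq :
  uniq [:: inord 0; inord 1; inord 2; inord 3 : 'I_4].
Proof. by rewrite /= !inE -!val_eqE /= !inordK. Qed.

End Assembly.

Theorem theorem1p2 (K : closedFieldType) (I : idealr {mpoly K[4]})
  (hC : is_curve I)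
  (hQ : exists q : {mpoly K[4]}, reducible_reduced_quadric q /\ q \in I) :
  (~ arithmetically_cohen_macaulay I <-> min_gens I 4) /\
  (~ arithmetically_cohen_macaulay I ->
   exists (M : 'M[K]_4) (A B F G h : {mpoly K[4]}),
     let gens := [:: x * y; x ^+ 2 * A + x * h * F; y ^+ 2 * B + y * h * G;
                     x * A * G + y * B * F + h * F * G] in
     M \in unitmx /\
     (forall f, f \in I <-> ideal_gen gens (change_coord M f)) /\
     (forall f, f \in [:: A; B; F; G; h] -> f \is homog mdeg) /\
     (forall f, f \in gens -> f \is homog mdeg) /\
     free_of_xy h /\
     regular_sequence [:: x; y; F; G] /\
     (h = 0 -> ~ dvdr y A /\ ~ dvdr x B)).
Proof.
have [q [[l [l' [l1 l0 l'1 l'0 [l'l qE]]]] qI]] := hQ.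
have U := coordinates_uniq.
set i0 : 'I_4 := inord 0 in U; set i1 : 'I_4 := inord 1 in U.
set i2 : 'I_4 := inord 2 in U; set i3 : 'I_4 := inord 3 in U.
have U' : uniq [:: i1; i0; i2; i3].
  by move: U; rewrite /= !inE !negb_or [i0 == i1]eq_sym; do !case: (_ == _).
have i0E : (i0 : nat) = 0%N by rewrite inordK.
have i1E : (i1 : nat) = 1%N by rewrite inordK.
have [M uM [Ml Ml']] := coordinates_exist i0E i1E l1 l0 l'1 l'l.
pose phi := linear_sub M; pose psi := linear_sub (invmx M).
have phiK : cancel phi psi := linear_subK uM.
have psiK : cancel psi phi := linear_subVK uM.
have phi_hom d f : pihomog mdeg d (phi f) = phi (pihomog mdeg d f) := linear_sub_homog M d f.
have psi_hom d f : pihomog mdeg d (psi f) = psi (pihomog mdeg d f) := linear_sub_homog _ d f.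
have phiC c : phi c%:MP = c%:MP by apply: subC.
have psiC c : psi c%:MP = c%:MP by apply: subC.
pose T := transported I psi.
have iT : is_ideal T by apply: transported_ideal.
have hT : homogeneous_set T by apply: transported_homogeneous hC psi_hom.
have pT : codim_two_pure T by apply: (transported_pure hC phiK psiK).
have Txy : T ('X_i0 * 'X_i1) by rewrite /T /transported -Ml -Ml' -rmorphM phiK -qE.
have Tyx : T ('X_i1 * 'X_i0) by rewrite mulrC.
have exy := residual_not_plane U hC phiK psiK phi_hom phiC Txy.
have exx := residual_not_plane U' hC phiK psiK phi_hom phiC Tyx.
have [r [rsurj rE]] := ideal_quot_morphism I.
pose pr : {rmorphism {mpoly K[4]} -> {ideal_quot I}} := r \o psi.
have prsurj a : exists f, pr f = a.
  by have [f <-] := rsurj a; exists (phi f); rewrite /pr /= phiK.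
have prT f : pr f = 0 <-> T f by rewrite /pr /= -rE.
have residual_case i j k n : uniq [:: i; j; k; n] -> T ('X_i * 'X_j) ->
    residual_plane_curves i j T -> arithmetically_cohen_macaulay I /\ ~ min_gens I 4.
  move=> Uij Tij res; split.
    apply: (residual_cohen_macaulay Uij prsurj); first exact/prT.
    have [P [S [h1 h2 h3 [s [s3 sE]]]]] := res; exists P, S; split=> //.
    - by move=> f; rewrite prT h2.
    - by move=> f; rewrite -h3; split=> -[g /prT]; exists g.
    - by exists s; split=> // f; rewrite prT.
  have [_ [_ [_ _ _ [s [s3 sE]]]]] := res.
  case=> _ /(_ _ (transported_generated phiK sE)).
  by rewrite size_map s3.
have rao_case A B F G h : rao_form i0 i1 i2 i3 T A B F G h ->
    ~ arithmetically_cohen_macaulay I /\ min_gens I 4.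
  move=> form; split.
    have [p [p' [[pp pp'] Tp sub ex [p'o ex']]]] :=
      transported_chain hC phiK psiC (linear_sub_origin _) (linear_sub_origin _).
    exact: (rao_not_cohen_macaulay U iT pT form prsurj prT pp pp' Tp sub ex p'o ex').
  split; last first.
    move=> s /(generated_transported phiK psiK)/(rao_generators_ge U form).
    by rewrite size_map.
  eexists; split; first exact: (transported_generated phiK (rf_gen form)).
  by [].
have [/(residual_case _ _ _ _ U Txy)[acm ngen]|/(residual_case _ _ _ _ U' Tyx)[acm ngen]|
    [A [B [F [G [h form]]]]]] := classification U iT hT pT Txy exy exx.
- by split=> [|/(_ acm)//]; split=> // /(_ acm).
- by split=> [|/(_ acm)//]; split=> // /(_ acm).
have [nacm gen4] := rao_case _ _ _ _ _ form.
split; [by split | move=> _].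
have [m Fm] := rf_homF form; have [m' Gm'] := rf_homG form.
have xE : 'X_i0 = x :> {mpoly K[4]} by [].
have yE : 'X_i1 = y :> {mpoly K[4]} by [].
have homX (a : 'I_4) : ('X_a : {mpoly K[4]}) \is homog mdeg.
  by apply/homogP; exists 1%N; apply: dhomogX1.
have homM (f g : {mpoly K[4]}) : f \is homog mdeg -> g \is homog mdeg ->
    f * g \is homog mdeg.
  by move=> /homogP[d fd] /homogP[e ge]; apply/homogP; exists (d + e)%N; apply: dhomogM.
exists M, A, B, F, G, h => /=; split=> //; split; [|split; [|split; [|split; [|split]]]].
- by move=> f; rewrite change_coordE -(rf_gen form) /T /transported phiK.
- move=> f; rewrite !inE => /or4P[/eqP->|/eqP->|/eqP->|/orP[] /eqP->].
  + exact: rf_homA form.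
  + exact: rf_homB form.
  + by apply/homogP; exists m.+1.
  + by apply/homogP; exists m'.+1.
  + exact: rf_homh form.
- move=> f; rewrite !inE -xE -yE => /or4P[] /eqP->.
  + exact: homM.
  + have -> : 'X_i0 ^+ 2 * A + 'X_i0 * h * F = 'X_i0 * ('X_i0 * A + h * F) by ring.
    by apply: homM => //; exact: rf_homP form.
  + have -> : 'X_i1 ^+ 2 * B + 'X_i1 * h * G = 'X_i1 * ('X_i1 * B + h * G) by ring.
    by apply: homM => //; exact: rf_homS form.
  + exact: rf_homf form.
- move=> n nh; have [ih jh] := rf_binh form.
  by split; [apply: (kill_fixP i0 h).1 | apply: (kill_fixP i1 h).1].
- exact: rao_regular_sequence U form.
move=> h0; split=> -[c].
  move=> Ac; have := rf_P0 form; rewrite h0 mul0r addr0 -(rf_A form) Ac.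
  by rewrite rmorphM killUi !mulr0 eqxx.
move=> Bc; have := rf_S0 form; rewrite h0 mul0r addr0 -(rf_B form) Bc.
by rewrite rmorphM killUi !mulr0 eqxx.
Qed.
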